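(* Let $A,B\in\mathbb{C}$ with $|B|\le1$ and $A\neq B$. Let $z_0\in\mathbb{D}\setminus\{0\}$ be fixed and let $\lambda\in\mathbb{C}$ be such that $|\lambda|\le|A-B|/2$. Let $\gamma_1=2\lambda/(A-B)$, and $$V_{\mathcal{CV}(A,B)}(z_0):=\{\log f'(z_0): f\in\mathcal{CV}(A,B)\},$$ $$V_{\mathcal{CV}(A,B)}(z_0,\lambda):=\{\log f'(z_0): f\in\mathcal{CV}(A,B)\text{ with }a_2(f)=\lambda\}.$$ (i) The region of variability $V_{\mathcal{CV}(A,B)}(z_0)$ is a convex closed Jordan domain and coincides with the set $K(\overline{\mathbb{D}}(0,|z_0|))$, where $$K(z)=\int_0^z\frac{A-B}{1+B\zeta}\, d\zeta$$ is a convex univalent function in $\mathbb{D}$. Furthermore, for $|\varepsilon|=1$ and $f\in\mathcal{CV}(A,B)$, the equality $\log f'(z_0)=K(\varepsilon z_0)$ holds if, and only if, $f(z)=\varepsilon^{-1}F(\varepsilon z)$ for all $z\in\mathbb{D}$, where $F(z)=\int_0^ze^{K(\zeta)}\, d\zeta$. (ii) If $|\gamma_1|=1$ then $V_{\mathcal{CV}(A,B)}(z_0,\lambda)=\{w_0\}$, where $w_0=\int_0^{z_0}\zeta^{-1}\{P_{A,B}(\gamma_1\zeta)-1\}\, d\zeta$. (iii) If $|\gamma_1|<1$ then $V_{\mathcal{CV}(A,B)}(z_0,\lambda)=Q_{\gamma_1}(z_0,\overline{\mathbb{D}}):=\{Q_{\gamma_1}(z_0,\varepsilon):\varepsilon\in\overline{\mathbb{D}}\}$,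 where for $z\in\mathbb{D}$ and $\varepsilon\in\overline{\mathbb{D}}$ $$Q_{\gamma_1}(z,\varepsilon)=\int_0^{z}\frac{(A-B)\sigma_{\gamma_1}(\varepsilon\zeta)}{1+B\zeta\sigma_{\gamma_1}(\varepsilon\zeta)}\, d\zeta ,$$ and $Q_{\gamma_1}(z_0,\varepsilon)$ is a convex, univalent and analytic function of $\varepsilon\in\overline{\mathbb{D}}$. Furthermore, for $\varepsilon\in\partial\mathbb{D}$ and $f\in\mathcal{CV}(A,B)$ with $a_2(f)=\lambda$, the equality $\log f'(z_0)=Q_{\gamma_1}(z_0,\varepsilon)$ holds if, and only if, $$f(z)=\int_0^ze^{Q_{\gamma_1}(\zeta,\varepsilon)}\, d\zeta,\quad z\in\mathbb{D}.$$
   Context: $\mathbb{D}=\{z\in\mathbb{C}:|z|<1\}$, with closure $\overline{\mathbb{D}}$, and $\overline{\mathbb{D}}(0,r)=\{z\in\mathbb{C}: |z|\le r\}$. For $a\in\mathbb{D}$, $\sigma_a(z)=\dfrac{z+a}{1+\overline{a}z}$. $P_{A,B}(z)=\dfrac{1+Az}{1+Bz}$, a conformal map of $\mathbb{D}$ onto a convex domain. $\mathcal{CV}(A,B)$ is the class of analytic functions $f$ in $\mathbb{D}$ with $f(0)=f'(0)-1=0$ such that $1+zf''(z)/f'(z)$ is analytic in $\mathbb{D}$ (so $f'$ has no zeros) and $1+\frac{zf''(z)}{f'(z)}\prec\frac{1+Az}{1+Bz}$, where $\prec$ denotes subordination ($g\prec P$ means $g=P\circ\omega$ for some analytic $\omega:\mathbb{D}\to\mathbb{D}$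 with $\omega(0)=0$). $\log f'$ is the single-valued analytic branch of the logarithm of $f'$ in $\mathbb{D}$ with $\log f'(0)=0$. $a_2(f)=f''(0)/2$. A convex univalent function in $\mathbb{D}$ is an injective analytic function whose image of $\mathbb{D}$ is convex. ''Convex, univalent and analytic function of $\varepsilon\in\overline{\mathbb{D}}$'' means: analytic in a neighbourhood of $\overline{\mathbb{D}}$, injective on $\overline{\mathbb{D}}$, and mapping $\mathbb{D}$ onto a convex domain. A closed Jordan domain is the union of a Jordan curve and its interior. Integrands $\zeta^{-1}\{\cdot\}$ have removable singularities at $0$. *)

(* Defs.v *)
From Stdlib Require Import Reals ClassicalEpsilon.
From Coquelicot Require Import Coquelicot.

Open Scope R_scope.
Open Scope C_scope.

Definition unit_disc (z : C) : Prop := (Cmod z < 1)%R.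

Definition closed_disc (r : R) (z : C) : Prop := (Cmod z <= r)%R.

Definition image (S : C -> Prop) (f : C -> C) (w : C) : Prop :=
  exists z : C, S z /\ f z = w.

Definition injective_on (S : C -> Prop) (f : C -> C) : Prop :=
  forall x y : C, S x -> S y -> f x = f y -> x = y.

Definition convex_set (S : C -> Prop) : Prop :=
  forall (x y : C) (t : R), S x -> S y -> (0 <= t <= 1)%R ->
    S ((1 - t) * x + t * y).

Definition bounded_set (S : C -> Prop) : Prop :=
  exists M : R, forall z : C, S z -> (Cmod z <= M)%R.

(* Connectedness in the topological sense; Coquelicot's [is_connected] is about
   order-convex subsets of [R]. *)
Definition connected (S : C -> Prop) : Prop :=
  forall U V : C -> Prop,
    open (T := C_UniformSpace) U -> open (T := C_UniformSpace) V ->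
    (forall z, S z -> U z \/ V z) ->
    (exists z, S z /\ U z) -> (exists z, S z /\ V z) ->
    exists z, S z /\ U z /\ V z.

Definition component (S : C -> Prop) (z w : C) : Prop :=
  exists T : C -> Prop,
    connected T /\ (forall u, T u -> S u) /\ T z /\ T w.

Definition domain (S : C -> Prop) : Prop :=
  (exists z, S z) /\ open (T := C_UniformSpace) S /\ connected S.

Definition jordan_curve (J : C -> Prop) : Prop :=
  exists c : R -> C,
    continuous_on (U := C_UniformSpace) (fun t => 0 <= t <= 1)%R c /\
    c 0%R = c 1%R /\
    (forall s t : R, (0 <= s < 1)%R -> (0 <= t < 1)%R -> c s = c t -> s = t) /\
    (forall w : C, J w <-> exists t : R, (0 <= t <= 1)%R /\ c t = w).

(* The interior of a Jordan curve is the bounded component of its complement. *)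
Definition jordan_interior (J : C -> Prop) (z : C) : Prop :=
  ~ J z /\ bounded_set (component (fun w => ~ J w) z).

Definition closed_jordan_domain (S : C -> Prop) : Prop :=
  exists J : C -> Prop, jordan_curve J /\
    forall w : C, S w <-> J w \/ jordan_interior J w.

Definition analytic_on (S : C -> Prop) (f : C -> C) : Prop :=
  forall z : C, S z -> ex_derive (K := C_AbsRing) (V := C_NormedModule) f z.

(* The integral of [g] along the segment from [0] to [z]; for [g] analytic in
   the unit disc this is the integral along any path.  The value of the
   integrand at the single point [0] is irrelevant, so a removable singularity
   there needs no special treatment. *)
Definition Cint (g : C -> C) (z : C) : C :=
  RInt (V := C_R_CompleteNormedModule) (fun t : R => z * g (t * z)) 0 1.

Definition Cexp (z : C) : C :=
  ((exp (Re z) * cos (Im z))%R, (exp (Re z) * sin (Im z))%R).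

Definition is_log_branch (h L : C -> C) : Prop :=
  analytic_on unit_disc L /\ L 0 = 0 /\
  forall z : C, unit_disc z -> Cexp (L z) = h z.

(* The branch of [log h] in the unit disc which vanishes at [0].  If it exists
   (it does when [h] is analytic without zeros and [h 0 = 1]) its values in the
   unit disc are determined by [is_log_branch]. *)
Definition log_branch (h : C -> C) : C -> C :=
  epsilon (inhabits (fun _ : C => RtoC 0)) (is_log_branch h).

Definition log_deriv (f : C -> C) : C -> C := log_branch (C_derive f).

Definition convex_univalent (f : C -> C) : Prop :=
  analytic_on unit_disc f /\ injective_on unit_disc f /\
  convex_set (image unit_disc f).

Definition convex_univalent_closed (f : C -> C) : Prop :=
  (exists U : C -> Prop, open (T := C_UniformSpace) U /\
     (forall z, closed_disc 1 z -> U z) /\ analytic_on U f) /\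
  injective_on (closed_disc 1) f /\
  domain (image unit_disc f) /\ convex_set (image unit_disc f).

Definition subordinate (g P : C -> C) : Prop :=
  exists omega : C -> C,
    analytic_on unit_disc omega /\
    (forall z, unit_disc z -> unit_disc (omega z)) /\
    omega 0 = 0 /\
    forall z, unit_disc z -> g z = P (omega z).

Definition sigma (a z : C) : C := (z + a) / (1 + Cconj a * z).

Definition P_fun (A B z : C) : C := (1 + A * z) / (1 + B * z).

Definition convexity_quotient (f : C -> C) (z : C) : C :=
  1 + z * C_derive (C_derive f) z / C_derive f z.

(* A zero of [f'] is a pole of [1 + z f''/f'] (or makes it undefined); since
   division by zero is total here, [f' <> 0] is part of the requirement that
   this quotient be analytic. *)
Definition CV (A B : C) (f : C -> C) : Prop :=
  analytic_on unit_disc f /\ f 0 = 0 /\ C_derive f 0 - 1 = 0 /\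
  (forall z, unit_disc z -> C_derive f z <> 0) /\
  analytic_on unit_disc (convexity_quotient f) /\
  subordinate (convexity_quotient f) (P_fun A B).

Definition a2 (f : C -> C) : C := C_derive (C_derive f) 0 / 2.

Definition V_CV (A B z0 w : C) : Prop :=
  exists f : C -> C, CV A B f /\ log_deriv f z0 = w.

Definition V_CV_coef (A B z0 lambda w : C) : Prop :=
  exists f : C -> C, CV A B f /\ a2 f = lambda /\ log_deriv f z0 = w.

Definition K_fun (A B : C) : C -> C :=
  Cint (fun zeta => (A - B) / (1 + B * zeta)).

Definition F_fun (A B : C) : C -> C :=
  Cint (fun zeta => Cexp (K_fun A B zeta)).

Definition Q_fun (A B gamma z eps : C) : C :=
  Cint (fun zeta =>
          (A - B) * sigma gamma (eps * zeta)
          / (1 + B * zeta * sigma gamma (eps * zeta))) z.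

(* Main.v *)
(* Write [omega z = z phi z] for the Schwarz function of [f]; then
   [f'' / f' = (A - B) phi / (1 + B z phi)] with [|phi| <= 1], and the integral of the right-hand
   side is [log f']. In (i) put [chi = phi]; in (iii) [phi 0 = gamma1], so Schwarz's lemma gives
   [phi z = sigma gamma1 (z chi z)]. In both cases [|chi| <= 1] is otherwise arbitrary and
   [log f' z0 = int_0^z0 M_z (chi z) dz] for Moebius maps [M_z] of determinant [kappa z ^ k],
   and the constants [chi = x] give [H x = int_0^z0 M_z x dz], which is [K] or [Q].

   For [|eps| = rho <= 1] and [|chi| <= rho], put [D z = int_0^z (M eps - M chi)] and
   [E z = int_0^z eps M' eps]. Since [M_z] maps discs to discs, [Re (D' / E') >= 0]; since
   [Re (1 + z E'' / E') > 0], Jack's lemma gives first [Re (E / (z E')) > 0] and then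
   [Re (D / E) >= 0], with equality only if [chi = eps]. At [z0] this says that the half-plane
   with outward normal [eps H' eps] at [H eps] contains every value of the functional. This
   yields the injectivity of [H] and the uniqueness of the extremal functions; and a point lying
   in all these half-planes belongs to the image of the closed disc of radius [rho], because a
   nearest point of that image is either a critical point of [H] or a boundary value where the
   distance vector is a negative multiple of the normal. Convexity and the description of the
   region of variability follow. *)

From Stdlib Require Import Reals Lra Lia Classical ClassicalEpsilon.
From Coquelicot Require Import Coquelicot.
Require Import Defs.

Open Scope R_scope.
Open Scope C_scope.

(** * Complex derivatives *)

(** The integrals [D] and [E] are both divisible by [z ^ (k + 1)], so their quotients are singular
    in form at the origin. Writing [D = eps z ^ (k + 1) P] and [E = eps z ^ (k + 1) N] turns them
    into solutions of regular equations [(k + 1) N + z N' = W] and [(k + 1) P + z P' = W q], to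
    which Jack's lemma applies on the whole disc, the origin included. The exponent is [k = 0] for
    [K]; for [Q] it is [k = 1], because [sigma gamma (x z)] depends on [x] only through [x z].

    The half-plane property is proved for every radius [rho <= 1]: injectivity compares points of
    different modulus, and the open disc is exhausted by smaller closed ones. The nearest-point
    argument does the work of the open mapping theorem, and convexity that of the Jordan curve
    theorem: outside a convex set there is a ray to infinity. The equality case rests on a maximum
    principle for functions with nonnegative real part. *)

Notation is_Cderive := (is_derive (K := C_AbsRing) (V := C_NormedModule)).

Lemma Cplus_minus (z w : C) : z + (w - z) = w.
Proof. ring. Qed.

Lemma is_Cderive_iff (f : C -> C) (z l : C) :
  is_Cderive f z l <->
  forall eps : R, (0 < eps)%R -> exists delta : R, (0 < delta)%R /\
    forall h : C, (Cmod h < delta)%R ->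
      (Cmod (f (z + h)%C - f z - l * h) <= eps * Cmod h)%R.
Proof.
  split.
  - intros [_ H] eps Heps.
    destruct (H z (fun P HP => HP) (mkposreal eps Heps)) as [d Hd].
    exists d; split; [apply cond_pos|].
    intros h Hh.
    assert (Hb : ball (M := AbsRing_UniformSpace C_AbsRing) z d (z + h)).
    { change (Cmod (z + h - z) < d)%R.
      now replace (z + h - z) with h by ring. }
    specialize (Hd _ Hb).
    change (Cmod (f (z + h)%C - f z - (z + h - z) * l)
            <= eps * Cmod (z + h - z))%R in Hd.
    replace (z + h - z) with h in Hd by ring.
    now rewrite (Cmult_comm l h).
  - intros H; split; [apply is_linear_scal_l|].
    intros x Hx.
    apply (is_filter_lim_locally_unique (K := C_AbsRing)
             (V := AbsRing_NormedModule C_AbsRing)) in Hx; subst x.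
    intros eps; destruct (H eps (cond_pos eps)) as [d [Hd H']].
    exists (mkposreal d Hd); intros y Hy.
    change (Cmod (y - z) < d)%R in Hy.
    change (Cmod (f y - f z - (y - z) * l) <= eps * Cmod (y - z))%R.
    specialize (H' _ Hy).
    rewrite Cplus_minus in H'.
    now rewrite (Cmult_comm (y - z) l).
Qed.

Lemma is_Cderive_unique (f : C -> C) (z l m : C) :
  is_Cderive f z l -> is_Cderive f z m -> l = m.
Proof.
  intros Hl Hm.
  now rewrite <- (is_C_derive_unique _ _ _ Hl), (is_C_derive_unique _ _ _ Hm).
Qed.

Lemma is_Cderive_ext_loc (f g : C -> C) (z l : C) (r : R) :
  (0 < r)%R -> (forall w, (Cmod (w - z) < r)%R -> f w = g w) ->
  is_Cderive f z l -> is_Cderive g z l.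
Proof.
  intros Hr Hfg Hf. apply is_Cderive_iff; intros eps Heps.
  destruct (proj1 (is_Cderive_iff _ _ _) Hf eps Heps) as [d [Hd H]].
  exists (Rmin d r); split; [now apply Rmin_case|].
  intros h Hh.
  rewrite <- !Hfg.
  - apply H. eapply Rlt_le_trans; [exact Hh|apply Rmin_l].
  - replace (z - z) with (RtoC 0) by ring. now rewrite Cmod_0.
  - replace (z + h - z) with h by ring.
    eapply Rlt_le_trans; [exact Hh|apply Rmin_r].
Qed.

Lemma is_Cderive_const (c z : C) : is_Cderive (fun _ => c) z (RtoC 0).
Proof. apply (is_derive_const (K := C_AbsRing) (V := C_NormedModule)). Qed.

Lemma is_Cderive_id (z : C) : is_Cderive (fun x => x) z (RtoC 1).
Proof.
  apply is_Cderive_iff; intros eps Heps; exists 1%R; split; [lra|].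
  intros h _. replace (z + h - z - 1 * h) with (RtoC 0) by ring.
  rewrite Cmod_0. apply Rmult_le_pos; [lra|apply Cmod_ge_0].
Qed.

Lemma is_Cderive_plus (f g : C -> C) (z l m : C) :
  is_Cderive f z l -> is_Cderive g z m ->
  is_Cderive (fun x => f x + g x) z (l + m).
Proof. apply (is_derive_plus (K := C_AbsRing) (V := C_NormedModule)). Qed.

Lemma is_Cderive_bound (f : C -> C) (z l : C) :
  is_Cderive f z l -> exists d : R, (0 < d)%R /\
    forall h, (Cmod h < d)%R -> (Cmod (f (z + h)%C - f z) <= (Cmod l + 1) * Cmod h)%R.
Proof.
  intros H. destruct (proj1 (is_Cderive_iff _ _ _) H 1%R Rlt_0_1) as [d [Hd H']].
  exists d; split; [easy|]. intros h Hh.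
  replace (f (z + h) - f z) with ((f (z + h) - f z - l * h) + l * h) by ring.
  eapply Rle_trans; [apply Cmod_triangle|].
  rewrite Cmod_mult. specialize (H' h Hh). lra.
Qed.

(* The chain rule for increments [k h] with linear part [m h], where [h] ranges over a space
   with size [N h]. *)
Lemma is_Cderive_chain {X : Type} (N : X -> R) (k m : X -> C) (f : C -> C) (z l : C) (c : R) :
  is_Cderive f z l -> (0 <= c)%R -> (forall h, (0 <= N h)%R) ->
  (forall h, (Cmod (m h) <= c * N h)%R) ->
  (forall eps : R, (0 < eps)%R -> exists d : R, (0 < d)%R /\
     forall h, (N h < d)%R -> (Cmod (k h - m h) <= eps * N h)%R) ->
  forall eps : R, (0 < eps)%R -> exists d : R, (0 < d)%R /\
    forall h, (N h < d)%R -> (Cmod (f (z + k h)%C - f z - l * m h) <= eps * N h)%R.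
Proof.
  intros Hf Hc HN Hm Hk eps Heps.
  pose proof (Cmod_ge_0 l) as Hl.
  (* The error is at most [e1 |k h| + |l| e2 N h], where [|k h| <= (c + 1) N h]; each term gets
     [eps / 2]. Adding [1] to [c] and [|l|] avoids division by zero. *)
  set (e1 := (eps / (2 * (c + 1)))%R).
  set (e2 := (eps / (2 * (Cmod l + 1)))%R).
  assert (He1 : (0 < e1)%R) by (apply Rdiv_lt_0_compat; lra).
  assert (He2 : (0 < e2)%R) by (apply Rdiv_lt_0_compat; lra).
  destruct (Hk 1%R Rlt_0_1) as [d0 [Hd0 B]].
  destruct (proj1 (is_Cderive_iff _ _ _) Hf e1 He1) as [d1 [Hd1 H1]].
  destruct (Hk e2 He2) as [d2 [Hd2 H2]].
  set (d3 := (d1 / (c + 1))%R).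
  assert (Hd3 : (0 < d3)%R) by (apply Rdiv_lt_0_compat; lra).
  exists (Rmin d0 (Rmin d2 d3)); split; [repeat apply Rmin_case; easy|].
  intros h Hh.
  apply Rmin_Rgt_l in Hh; destruct Hh as [Hh0 Hh].
  apply Rmin_Rgt_l in Hh; destruct Hh as [Hh2 Hh3].
  specialize (B h Hh0). specialize (H2 h Hh2). specialize (Hm h). specialize (HN h).
  assert (B' : (Cmod (k h) <= (c + 1) * N h)%R).
  { replace (k h) with ((k h - m h) + m h) by ring.
    eapply Rle_trans; [apply Cmod_triangle|]. lra. }
  assert (Hkd : (Cmod (k h) < d1)%R).
  { eapply Rle_lt_trans; [exact B'|].
    apply Rlt_gt, (Rmult_lt_compat_l (c + 1)) in Hh3; [|lra].
    replace ((c + 1) * d3)%R with d1 in Hh3 by (unfold d3; field; lra). lra. }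
  specialize (H1 (k h) Hkd).
  replace (f (z + k h) - f z - l * m h)
    with ((f (z + k h) - f z - l * k h) + l * (k h - m h)) by ring.
  eapply Rle_trans; [apply Cmod_triangle|].
  rewrite Cmod_mult.
  assert (E1 : (e1 * Cmod (k h) <= eps / 2 * N h)%R).
  { apply Rle_trans with (e1 * ((c + 1) * N h))%R.
    - apply Rmult_le_compat_l; lra.
    - apply Req_le. unfold e1. field. lra. }
  assert (E2 : (Cmod l * Cmod (k h - m h) <= eps / 2 * N h)%R).
  { apply Rle_trans with ((Cmod l + 1) * (e2 * N h))%R.
    - apply Rmult_le_compat; try apply Cmod_ge_0; lra.
    - apply Req_le. unfold e2. field. lra. }
  lra.
Qed.

Lemma is_Cderive_comp (f g : C -> C) (z l m : C) :
  is_Cderive f (g z) l -> is_Cderive g z m ->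
  is_Cderive (fun x => f (g x)) z (l * m).
Proof.
  intros Hf Hg. apply is_Cderive_iff; intros eps Heps.
  destruct (is_Cderive_chain Cmod (fun h => g (z + h) - g z) (fun h => m * h) f (g z) l (Cmod m))
    with (eps := eps) as [d [Hd H]]; auto using Cmod_ge_0.
  - intros h. rewrite Cmod_mult. lra.
  - now apply is_Cderive_iff.
  - exists d. split; [easy|]. intros h Hh. specialize (H h Hh).
    now rewrite Cplus_minus, Cmult_assoc in H.
Qed.

Lemma is_Cderive_sqr (z : C) : is_Cderive (fun x => x * x) z (2 * z).
Proof.
  apply is_Cderive_iff; intros eps Heps; exists eps; split; [easy|].
  intros h Hh. replace ((z + h) * (z + h) - z * z - 2 * z * h) with (h * h) by ring.
  rewrite Cmod_mult. apply Rmult_le_compat_r; [apply Cmod_ge_0|lra].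
Qed.

Lemma is_Cderive_scal (k : C) (f : C -> C) (z l : C) :
  is_Cderive f z l -> is_Cderive (fun x => k * f x) z (k * l).
Proof.
  intros H.
  assert (Hk : is_Cderive (fun x => k * x) (f z) k).
  { apply is_Cderive_iff; intros eps Heps; exists 1%R; split; [lra|].
    intros h _. replace (k * (f z + h) - k * f z - k * h) with (RtoC 0) by ring.
    rewrite Cmod_0. apply Rmult_le_pos; [lra|apply Cmod_ge_0]. }
  exact (is_Cderive_comp _ f z k l Hk H).
Qed.

(* Polarization: [4 f g = (f + g)^2 - (f - g)^2] reduces products to squares. *)
Lemma is_Cderive_mult (f g : C -> C) (z l m : C) :
  is_Cderive f z l -> is_Cderive g z m ->
  is_Cderive (fun x => f x * g x) z (l * g z + f z * m).
Proof.
  intros Hf Hg.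
  assert (Hp := is_Cderive_comp _ _ _ _ _
                  (is_Cderive_sqr _) (is_Cderive_plus _ _ _ _ _ Hf Hg)).
  assert (Hm := is_Cderive_comp _ _ _ _ _ (is_Cderive_sqr _)
                  (is_Cderive_plus _ _ _ _ _ Hf (is_Cderive_scal (-(1)) _ _ _ Hg))).
  assert (H := is_Cderive_scal (/ 4) _ _ _
                 (is_Cderive_plus _ _ _ _ _ Hp (is_Cderive_scal (-(1)) _ _ _ Hm))).
  cbv beta in H.
  replace (l * g z + f z * m) with
    (/ 4 * (2 * (f z + g z) * (l + m) + -(1) * (2 * (f z + -(1) * g z) * (l + -(1) * m))))
    by (field; auto).
  revert H. apply is_derive_ext. intros t.
  change (/ 4 * ((f t + g t) * (f t + g t)
                 + -(1) * ((f t + -(1) * g t) * (f t + -(1) * g t))) = f t * g t).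
  field; auto.
Qed.

Lemma is_Cderive_inv_id (z : C) : z <> 0 -> is_Cderive Cinv z (- / (z * z)).
Proof.
  intros Hz. assert (Hm := proj1 (Cmod_gt_0 z) Hz).
  apply is_Cderive_iff; intros eps Heps.
  (* The remainder is [h^2 / (z^2 (z + h))], and [|z + h| >= |z| / 2] when [|h| < |z| / 2]. *)
  set (K := (2 / (Cmod z * Cmod z * Cmod z))%R).
  assert (HK : (0 < K)%R).
  { apply Rdiv_lt_0_compat; [lra|]. repeat apply Rmult_lt_0_compat; lra. }
  exists (Rmin (Cmod z / 2) (eps / K)); split.
  - apply Rmin_case; apply Rdiv_lt_0_compat; lra.
  - intros h Hh.
    assert (Hh1 : (Cmod h < Cmod z / 2)%R) by (eapply Rlt_le_trans; [exact Hh|apply Rmin_l]).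
    assert (Hh2 : (Cmod h < eps / K)%R) by (eapply Rlt_le_trans; [exact Hh|apply Rmin_r]).
    assert (Hzh : (Cmod z / 2 <= Cmod (z + h))%R).
    { assert (T := Cmod_triangle (z + h) (- h)).
      replace (z + h + - h) with z in T by ring. rewrite Cmod_opp in T. lra. }
    assert (Hn : z + h <> 0) by (apply Cmod_gt_0; lra).
    replace (/ (z + h) - / z - - / (z * z) * h) with (h * h * / (z * z * (z + h)))
      by (field; auto).
    rewrite !Cmod_mult, Cmod_inv, !Cmod_mult by (repeat apply Cmult_neq_0; auto).
    apply Rle_trans with (Cmod h * Cmod h * K)%R.
    + apply Rmult_le_compat_l; [apply Rmult_le_pos; apply Cmod_ge_0|].
      unfold K.
      replace (2 / (Cmod z * Cmod z * Cmod z))%R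
        with (/ (Cmod z * Cmod z * (Cmod z / 2)))%R by (field; lra).
      apply Rinv_le_contravar.
      * repeat apply Rmult_lt_0_compat; lra.
      * apply Rmult_le_compat_l; [|lra]. apply Rmult_le_pos; lra.
    + rewrite (Rmult_comm eps), Rmult_assoc. apply Rmult_le_compat_l; [apply Cmod_ge_0|].
      apply (Rmult_lt_compat_r K) in Hh2; [|lra].
      replace (eps / K * K)%R with eps in Hh2 by (field; lra). lra.
Qed.

Lemma is_Cderive_div (f g : C -> C) (z l m : C) :
  is_Cderive f z l -> is_Cderive g z m -> g z <> 0 ->
  is_Cderive (fun x => f x / g x) z ((l * g z - f z * m) / (g z * g z)).
Proof.
  intros Hf Hg Hz.
  assert (H := is_Cderive_mult _ _ _ _ _ Hf
                 (is_Cderive_comp _ _ _ _ _ (is_Cderive_inv_id _ Hz) Hg)).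
  replace ((l * g z - f z * m) / (g z * g z))
    with (l * / g z + f z * (- / (g z * g z) * m)) by (field; auto).
  exact H.
Qed.

(** * Continuity, paths and integrals *)

Notation Ccontinuous := (continuous (U := C_UniformSpace)).
Notation Ccontinuous_at := (continuous (T := C_UniformSpace) (U := C_UniformSpace)).
Notation is_path_derive := (is_derive (K := R_AbsRing) (V := C_R_NormedModule)).
Notation is_CInt := (is_RInt (V := C_R_NormedModule)).
Notation CInt := (RInt (V := C_R_CompleteNormedModule)).

Lemma norm_C_R (z : C) : norm (V := C_R_NormedModule) z = Cmod z.
Proof.
  destruct z as [x y].
  change (sqrt (Rabs x ^ 2 + Rabs y ^ 2) = sqrt (x ^ 2 + y ^ 2)).
  now rewrite !pow2_abs.
Qed.

Lemma Ccontinuous_pair {T : UniformSpace} (f g : T -> R) (x : T) :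
  continuous f x -> continuous g x -> Ccontinuous (fun t => (f t, g t)) x.
Proof.
  intros Hf Hg P [eps He].
  assert (H1 := Hf _ (locally_ball (f x) eps)).
  assert (H2 := Hg _ (locally_ball (g x) eps)).
  unfold filtermap in *. generalize (filter_and _ _ H1 H2).
  apply filter_imp. intros t [A B]. apply He. now split.
Qed.

Lemma Ccontinuous_Re {T : UniformSpace} (f : T -> C) (x : T) :
  Ccontinuous f x -> continuous (fun t => Re (f t)) x.
Proof. intros H. apply (continuous_comp f fst); [exact H|apply continuous_fst]. Qed.

Lemma Ccontinuous_Im {T : UniformSpace} (f : T -> C) (x : T) :
  Ccontinuous f x -> continuous (fun t => Im (f t)) x.
Proof. intros H. apply (continuous_comp f snd); [exact H|apply continuous_snd]. Qed.

Lemma Ccontinuous_plus {T : UniformSpace} (f g : T -> C) (x : T) :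
  Ccontinuous f x -> Ccontinuous g x -> Ccontinuous (fun t => f t + g t) x.
Proof.
  intros Hf Hg. unfold Cplus.
  apply Ccontinuous_pair; apply (continuous_plus (V := R_NormedModule)).
  - now apply Ccontinuous_Re. - now apply Ccontinuous_Re.
  - now apply Ccontinuous_Im. - now apply Ccontinuous_Im.
Qed.

Lemma Ccontinuous_mult {T : UniformSpace} (f g : T -> C) (x : T) :
  Ccontinuous f x -> Ccontinuous g x -> Ccontinuous (fun t => f t * g t) x.
Proof.
  intros Hf Hg.
  assert (H1 := Ccontinuous_Re _ _ Hf). assert (H2 := Ccontinuous_Im _ _ Hf).
  assert (H3 := Ccontinuous_Re _ _ Hg). assert (H4 := Ccontinuous_Im _ _ Hg).
  unfold Cmult. apply Ccontinuous_pair.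
  - apply (continuous_minus (V := R_NormedModule));
      now apply (continuous_mult (K := R_AbsRing)).
  - apply (continuous_plus (V := R_NormedModule));
      now apply (continuous_mult (K := R_AbsRing)).
Qed.

Lemma Ccontinuous_RtoC {T : UniformSpace} (f : T -> R) (x : T) :
  continuous f x -> Ccontinuous (fun t => RtoC (f t)) x.
Proof. intros H. apply Ccontinuous_pair; [exact H|apply continuous_const]. Qed.

Lemma Ccontinuous_const {T : UniformSpace} (c : C) (x : T) : Ccontinuous (fun _ => c) x.
Proof. apply continuous_const. Qed.

(** The uniform structure of [C] is that of a product, with square balls; the estimates are made in
    round ones. *)
Lemma locally_Cmod (z : C) (P : C -> Prop) :
  locally (T := C_UniformSpace) z P <->
  exists d : R, (0 < d)%R /\ forall w, (Cmod (w - z) < d)%R -> P w.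
Proof.
  split; intros H.
  - apply locally_C in H. destruct H as [d Hd]. exists d; split; [apply cond_pos|].
    intros w Hw. apply Hd. exact Hw.
  - apply locally_C. destruct H as [d [Hd H]]. exists (mkposreal d Hd).
    intros w Hw. apply H. exact Hw.
Qed.

Lemma Ccontinuous_iff {T : UniformSpace} (f : T -> C) (x : T) :
  Ccontinuous f x <->
  forall eps : R, (0 < eps)%R -> locally x (fun t => (Cmod (f t - f x) < eps)%R).
Proof.
  split.
  - intros H eps He.
    apply (H (fun w => (Cmod (w - f x) < eps)%R)).
    apply locally_Cmod. now exists eps.
  - intros H P HP. apply locally_Cmod in HP. destruct HP as [d [Hd HP]].
    unfold filtermap. generalize (H d Hd). apply filter_imp. intros t Ht. now apply HP.
Qed.

Lemma continuous_Cmod {T : UniformSpace} (f : T -> C) (x : T) :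
  Ccontinuous f x -> continuous (fun t => Cmod (f t)) x.
Proof.
  intros H P [eps He]. unfold filtermap. generalize (proj1 (Ccontinuous_iff f x) H eps (cond_pos eps)).
  apply filter_imp. intros t Ht. apply He.
  change (Rabs (Cmod (f t) - Cmod (f x)) < eps)%R.
  eapply Rle_lt_trans; [|exact Ht].
  apply Rabs_le; split.
  - assert (T1 := Cmod_triangle (f t) (f x - f t)).
    replace (f t + (f x - f t)) with (f x) in T1 by ring.
    replace (f x - f t) with (- (f t - f x)) in T1 by ring.
    rewrite Cmod_opp in T1. lra.
  - assert (T1 := Cmod_triangle (f x) (f t - f x)).
    rewrite Cplus_minus in T1. lra.
Qed.

Lemma is_Cderive_continuous (f : C -> C) (z l : C) :
  is_Cderive f z l -> Ccontinuous_at f z.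
Proof.
  intros H. apply Ccontinuous_iff; intros eps Heps. apply locally_Cmod.
  destruct (is_Cderive_bound _ _ _ H) as [d [Hd B]].
  assert (Hl := Cmod_ge_0 l).
  exists (Rmin d (eps / (Cmod l + 1))); split.
  - apply Rmin_case; [easy|]. apply Rdiv_lt_0_compat; lra.
  - intros w Hw.
    assert (H1 : (Cmod (w - z) < d)%R) by (eapply Rlt_le_trans; [exact Hw|apply Rmin_l]).
    assert (H2 : (Cmod (w - z) < eps / (Cmod l + 1))%R)
      by (eapply Rlt_le_trans; [exact Hw|apply Rmin_r]).
    specialize (B _ H1). rewrite Cplus_minus in B.
    eapply Rle_lt_trans; [exact B|].
    apply (Rmult_lt_compat_l (Cmod l + 1)) in H2; [|lra].
    replace ((Cmod l + 1) * (eps / (Cmod l + 1)))%R with eps in H2 by (field; lra). lra.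
Qed.

Lemma Ccontinuous_inv {T : UniformSpace} (f : T -> C) (x : T) :
  Ccontinuous f x -> f x <> 0 -> Ccontinuous (fun t => / f t) x.
Proof.
  intros Hf H0. apply (continuous_comp f Cinv); [exact Hf|].
  exact (is_Cderive_continuous _ _ _ (is_Cderive_inv_id _ H0)).
Qed.

Lemma Ccontinuous_div {T : UniformSpace} (f g : T -> C) (x : T) :
  Ccontinuous f x -> Ccontinuous g x -> g x <> 0 -> Ccontinuous (fun t => f t / g t) x.
Proof.
  intros Hf Hg H0. apply Ccontinuous_mult; [exact Hf|]. now apply Ccontinuous_inv.
Qed.

(** * Derivatives and integrals along real paths *)

Lemma is_path_derive_iff (f : R -> C) (t : R) (l : C) :
  is_path_derive f t l <->
  forall eps : R, (0 < eps)%R -> exists delta : R, (0 < delta)%R /\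
    forall h : R, (Rabs h < delta)%R ->
      (Cmod (f (t + h)%R - f t - h * l) <= eps * Rabs h)%R.
Proof.
  split.
  - intros [_ H] eps Heps.
    destruct (H t (fun P HP => HP) (mkposreal eps Heps)) as [d Hd].
    exists d; split; [apply cond_pos|].
    intros h Hh.
    assert (Hb : ball t d (t + h)%R).
    { change (Rabs (t + h - t) < d)%R. now replace (t + h - t)%R with h by ring. }
    specialize (Hd _ Hb). cbv beta in Hd. rewrite norm_C_R in Hd.
    change (Cmod (f (t + h)%R - f t - scal (V := C_R_ModuleSpace) (t + h - t)%R l)
            <= eps * Rabs (t + h - t))%R in Hd.
    rewrite scal_R_Cmult in Hd.
    now replace (t + h - t)%R with h in Hd by ring.
  - intros H; split; [apply (is_linear_scal_l (V := C_R_NormedModule))|].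
    intros x Hx.
    apply (is_filter_lim_locally_unique (K := R_AbsRing) (V := R_NormedModule)) in Hx; subst x.
    intros eps; destruct (H eps (cond_pos eps)) as [d [Hd H']].
    exists (mkposreal d Hd); intros y Hy.
    change (Rabs (y - t) < d)%R in Hy.
    rewrite norm_C_R.
    change (Cmod (f y - f t - scal (V := C_R_ModuleSpace) (y - t)%R l) <= eps * Rabs (y - t))%R.
    rewrite scal_R_Cmult.
    specialize (H' _ Hy). now rewrite Rplus_minus in H'.
Qed.

Lemma is_path_derive_comp (f : C -> C) (g : R -> C) (t : R) (l m : C) :
  is_Cderive f (g t) l -> is_path_derive g t m ->
  is_path_derive (fun s => f (g s)) t (l * m).
Proof.
  intros Hf Hg. apply is_path_derive_iff; intros eps Heps.
  destruct (is_Cderive_chain Rabs (fun h => g (t + h)%R - g t) (fun h => h * m) f (g t) l (Cmod m))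
    with (eps := eps) as [d [Hd H]]; auto using Cmod_ge_0, Rabs_pos.
  - intros h. rewrite Cmod_mult, Cmod_R. lra.
  - now apply is_path_derive_iff.
  - exists d. split; [easy|]. intros h Hh. specialize (H h Hh).
    rewrite Cplus_minus in H. now replace (h * (l * m)) with (l * (h * m)) by ring.
Qed.

Lemma is_path_derive_pair (f g : R -> R) (t : R) (l m : R) :
  is_derive f t l -> is_derive g t m -> is_path_derive (fun s => (f s, g s)) t (l, m).
Proof.
  intros Hf Hg.
  apply (filterdiff_ext_lin _ (fun y : R => (scal y l, scal y m)));
    [|intros y; reflexivity].
  apply (filterdiff_comp_2 (fun s => f s) (fun s => g s) (fun x y => (x, y))
     (fun y : R => scal y l) (fun y : R => scal y m) (fun x y => (x, y)) Hf Hg).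
  apply (filterdiff_ext_lin (fun p : R * R => p) (fun p => p)).
  - apply (filterdiff_ext (fun p : R * R => p)); [now intros []|apply filterdiff_id].
  - now intros [].
Qed.

Lemma is_path_derive_affine (a b : C) (t : R) : is_path_derive (fun s => a + s * b) t b.
Proof.
  apply is_path_derive_iff; intros eps Heps; exists 1%R; split; [lra|].
  intros h _. rewrite RtoC_plus.
  replace (a + (t + h) * b - (a + t * b) - h * b) with (RtoC 0) by ring.
  rewrite Cmod_0. apply Rmult_le_pos; [lra|apply Rabs_pos].
Qed.

Lemma is_path_derive_continuous (f : R -> C) (t : R) (l : C) :
  is_path_derive f t l -> Ccontinuous f t.
Proof.
  intros H. apply (ex_derive_continuous (K := R_AbsRing) (V := C_R_NormedModule)).
  now exists l.
Qed.

Lemma Ccontinuous_affine (a b : C) (t : R) : Ccontinuous (fun s : R => a + s * b) t.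
Proof. exact (is_path_derive_continuous _ _ _ (is_path_derive_affine a b t)). Qed.

Lemma is_CInt_CInt (f : R -> C) (a b : R) (l : C) : is_CInt f a b l -> CInt f a b = l.
Proof. apply (is_RInt_unique (V := C_R_CompleteNormedModule)). Qed.

Lemma CInt_correct (f : R -> C) (a b : R) :
  (a <= b)%R -> (forall t, (a <= t <= b)%R -> Ccontinuous f t) ->
  is_CInt f a b (CInt f a b).
Proof.
  intros Hab H. apply (RInt_correct (V := C_R_CompleteNormedModule)).
  apply (ex_RInt_continuous (V := C_R_CompleteNormedModule)).
  rewrite Rmin_left, Rmax_right by easy. exact H.
Qed.

(** The integral is one in a real vector space, so linearity extracts only real factors; a complex
    factor is treated through its components. *)
Lemma is_CInt_mult_l (k : C) (f : R -> C) (a b : R) (l : C) :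
  is_CInt f a b l -> is_CInt (fun t => k * f t) a b (k * l).
Proof.
  intros H.
  assert (H1 := is_RInt_fct_extend_fst (U := R_NormedModule) (V := R_NormedModule) f a b l H).
  assert (H2 := is_RInt_fct_extend_snd (U := R_NormedModule) (V := R_NormedModule) f a b l H).
  apply (is_RInt_fct_extend_pair (U := R_NormedModule) (V := R_NormedModule)); cbn.
  - apply (is_RInt_minus (V := R_NormedModule)); now apply (is_RInt_scal (V := R_NormedModule)).
  - apply (is_RInt_plus (V := R_NormedModule)); now apply (is_RInt_scal (V := R_NormedModule)).
Qed.

Lemma is_CInt_minus (f g : R -> C) (a b : R) (l m : C) :
  is_CInt f a b l -> is_CInt g a b m -> is_CInt (fun t => f t - g t) a b (l - m).
Proof. apply (is_RInt_minus (V := C_R_NormedModule)). Qed.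

Lemma is_CInt_ext (f g : R -> C) (a b : R) (l : C) :
  (a <= b)%R -> (forall t, (a < t < b)%R -> f t = g t) ->
  is_CInt f a b l -> is_CInt g a b l.
Proof.
  intros Hab H. apply (is_RInt_ext (V := C_R_NormedModule)).
  rewrite Rmin_left, Rmax_right by easy. exact H.
Qed.

Lemma CInt_ext (f g : R -> C) (a b : R) :
  (a <= b)%R -> (forall t, (a < t < b)%R -> f t = g t) -> CInt f a b = CInt g a b.
Proof.
  intros Hab H. apply (RInt_ext (V := C_R_CompleteNormedModule)).
  rewrite Rmin_left, Rmax_right by easy. exact H.
Qed.

Lemma is_CInt_bound (f : R -> C) (a b : R) (l : C) (M : R) :
  (a <= b)%R -> (forall t, (a <= t <= b)%R -> (Cmod (f t) <= M)%R) ->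
  is_CInt f a b l -> (Cmod l <= (b - a) * M)%R.
Proof.
  intros Hab H Hf. rewrite <- norm_C_R.
  apply (norm_RInt_le_const (V := C_R_NormedModule) f a b l M Hab); [|exact Hf].
  intros x Hx. rewrite norm_C_R. now apply H.
Qed.

Lemma is_CInt_derive (f df : R -> C) (a b : R) :
  (a <= b)%R ->
  (forall t, (a <= t <= b)%R -> is_path_derive f t (df t)) ->
  (forall t, (a <= t <= b)%R -> Ccontinuous df t) ->
  is_CInt df a b (f b - f a).
Proof.
  intros Hab H1 H2.
  apply (is_RInt_derive (V := C_R_CompleteNormedModule) f df a b);
    rewrite Rmin_left, Rmax_right by easy; easy.
Qed.

(** * Goursat's lemma *)

Lemma RtoC_neq_0 (r : R) : r <> 0%R -> RtoC r <> 0.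
Proof. intros H E. apply H. now injection E. Qed.

Lemma analytic_on_continuous (S : C -> Prop) (f : C -> C) (z : C) :
  analytic_on S f -> S z -> Ccontinuous_at f z.
Proof. intros H Hz. destruct (H z Hz) as [l Hl]. exact (is_Cderive_continuous _ _ _ Hl). Qed.

Lemma Ccontinuous_comp {T : UniformSpace} (f : C -> C) (g : T -> C) (x : T) :
  Ccontinuous g x -> Ccontinuous_at f (g x) ->
  Ccontinuous (fun t => f (g t)) x.
Proof. intros Hg Hf. now apply (continuous_comp g f). Qed.

Lemma closed_disc_segment (r : R) (a b : C) (t : R) :
  closed_disc r a -> closed_disc r b -> (0 <= t <= 1)%R ->
  closed_disc r (a + t * (b - a)).
Proof.
  unfold closed_disc. intros Ha Hb Ht.
  replace (a + t * (b - a)) with ((1 - t)%R * a + t * b) by (rewrite RtoC_minus; ring).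
  eapply Rle_trans; [apply Cmod_triangle|].
  rewrite !Cmod_mult, !Cmod_R, !Rabs_right by lra.
  assert (((1 - t) * Cmod a <= (1 - t) * r)%R) by (apply Rmult_le_compat_l; lra).
  assert ((t * Cmod b <= t * r)%R) by (apply Rmult_le_compat_l; lra).
  lra.
Qed.

Lemma unit_disc_segment (a b : C) (t : R) :
  unit_disc a -> unit_disc b -> (0 <= t <= 1)%R -> unit_disc (a + t * (b - a)).
Proof.
  unfold unit_disc. intros Ha Hb Ht.
  apply Rle_lt_trans with (Rmax (Cmod a) (Cmod b)); [|now apply Rmax_case].
  apply closed_disc_segment; [apply Rmax_l|apply Rmax_r|easy].
Qed.

Definition seg (f : C -> C) (a b : C) : C :=
  CInt (fun t => (b - a) * f (a + t * (b - a))) 0 1.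

Lemma Cint_seg (f : C -> C) (z : C) : Cint f z = seg f 0 z.
Proof.
  apply CInt_ext; [lra|]. intros t _.
  f_equal; [ring|]. f_equal. ring.
Qed.

Lemma continuous_seg (f : C -> C) (a b : C) (t : R) :
  Ccontinuous_at f (a + t * (b - a)) ->
  Ccontinuous (fun s : R => (b - a) * f (a + s * (b - a))) t.
Proof.
  intros H. apply Ccontinuous_mult; [apply Ccontinuous_const|].
  apply (Ccontinuous_comp f (fun s : R => a + s * (b - a))); [|exact H].
  apply Ccontinuous_affine.
Qed.

Section Segments.

Variable f : C -> C.
Hypothesis Hf : forall z, unit_disc z ->
  Ccontinuous_at f z.

Lemma seg_correct (a b : C) :
  unit_disc a -> unit_disc b ->
  is_CInt (fun t => (b - a) * f (a + t * (b - a))) 0 1 (seg f a b).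
Proof.
  intros Ha Hb. apply CInt_correct; [lra|]. intros t Ht.
  apply continuous_seg, Hf. now apply unit_disc_segment.
Qed.

(** The increment [v] may be negative: [u = 1] and [v = -1] yield the reversed segment. *)
Lemma seg_part (a b : C) (u v : R) :
  unit_disc a -> unit_disc b -> (0 <= u <= 1)%R -> (0 <= u + v <= 1)%R ->
  is_CInt (fun t => (b - a) * f (a + t * (b - a))) u (u + v)
    (seg f (a + u * (b - a)) (a + (u + v)%R * (b - a))).
Proof.
  intros Ha Hb Hu Huv.
  set (g := fun t : R => (b - a) * f (a + t * (b - a))).
  assert (Hg : ex_RInt (V := C_R_CompleteNormedModule) g u (u + v)).
  { apply (ex_RInt_continuous (V := C_R_CompleteNormedModule)).
    intros t Ht. apply continuous_seg, Hf. apply unit_disc_segment; try easy.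
    revert Ht. apply Rmin_case; apply Rmax_case; lra. }
  assert (Hi := RInt_correct (V := C_R_CompleteNormedModule) _ _ _ Hg).
  match goal with |- is_RInt _ _ _ ?x => replace x with (CInt g u (u + v)); [exact Hi|] end.
  symmetry. apply is_CInt_CInt.
  assert (Hc := is_RInt_comp_lin (V := C_R_NormedModule) g v u 0 1 (CInt g u (u + v))).
  replace (v * 0 + u)%R with u in Hc by ring. replace (v * 1 + u)%R with (u + v)%R in Hc by ring.
  specialize (Hc Hi). revert Hc. apply is_CInt_ext; [lra|]. intros t _.
  change (scal (V := C_R_ModuleSpace) v (g (v * t + u)%R) =
    (a + (u + v)%R * (b - a) - (a + u * (b - a))) *
    f (a + u * (b - a) + t * (a + (u + v)%R * (b - a) - (a + u * (b - a))))).
  rewrite scal_R_Cmult. unfold g. rewrite !RtoC_plus, RtoC_mult.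
  rewrite Cmult_assoc. f_equal; [ring|]. f_equal. ring.
Qed.

Lemma seg_rev (a b : C) : unit_disc a -> unit_disc b -> seg f b a = - seg f a b.
Proof.
  intros Ha Hb.
  assert (H := seg_part a b 1 (-1) Ha Hb ltac:(lra) ltac:(lra)).
  replace (1 + -1)%R with 0%R in H by ring.
  replace (a + 1%R * (b - a)) with b in H by ring.
  replace (a + 0%R * (b - a)) with a in H by ring.
  apply (is_RInt_swap (V := C_R_NormedModule)) in H.
  apply is_CInt_CInt in H.
  change (seg f a b = - seg f b a) in H. rewrite H. ring.
Qed.

Lemma seg_split (a b : C) (u : R) :
  unit_disc a -> unit_disc b -> (0 <= u <= 1)%R ->
  seg f a b = seg f a (a + u * (b - a)) + seg f (a + u * (b - a)) b.
Proof.
  intros Ha Hb Hu.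
  assert (H1 := seg_part a b 0 u Ha Hb ltac:(lra) ltac:(lra)).
  assert (H2 := seg_part a b u (1 - u) Ha Hb ltac:(lra) ltac:(lra)).
  replace (u + (1 - u))%R with 1%R in H2 by ring.
  replace (0 + u)%R with u in H1 by ring.
  replace (a + 1%R * (b - a)) with b in H2 by ring.
  replace (a + 0%R * (b - a)) with a in H1 by ring.
  apply is_CInt_CInt. exact (is_RInt_Chasles (V := C_R_NormedModule) _ _ _ _ _ _ H1 H2).
Qed.

Definition triangle_int (T : C * C * C) : C :=
  let '(a, b, c) := T in seg f a b + seg f b c + seg f c a.

Definition in_disc (T : C * C * C) (r : R) : Prop :=
  let '(a, b, c) := T in closed_disc r a /\ closed_disc r b /\ closed_disc r c.

Definition sides_le (T : C * C * C) (d : R) : Prop :=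
  let '(a, b, c) := T in
  (Cmod (b - a) <= d /\ Cmod (c - b) <= d /\ Cmod (a - c) <= d)%R.

Definition vertex (T : C * C * C) : C := fst (fst T).

Definition mid (a b : C) : C := a + (/ 2)%R * (b - a).

(** A quarter carrying at least a fourth of the integral. The middle triangle is returned untested
    when the corner triangles fail; [quarter_large] shows that it then qualifies. *)
Definition quarter (T : C * C * C) : C * C * C :=
  let '(a, b, c) := T in
  let T1 := (a, mid a b, mid a c) in
  let T2 := (mid a b, b, mid b c) in
  let T3 := (mid a c, mid b c, c) in
  let large T' := Rle_dec (Cmod (triangle_int T) / 4) (Cmod (triangle_int T')) in
  if large T1 then T1 else if large T2 then T2 else if large T3 then T3
  else (mid b c, mid a c, mid a b).

Lemma half_C : RtoC (/ 2) = / 2.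
Proof. rewrite RtoC_inv; [easy|lra]. Qed.

Lemma two_neq_0 : RtoC 2 <> 0.
Proof. apply RtoC_neq_0; lra. Qed.

Lemma mid_disc (r : R) (a b : C) :
  closed_disc r a -> closed_disc r b -> closed_disc r (mid a b).
Proof. intros Ha Hb. apply closed_disc_segment; try easy. lra. Qed.

(** Each inner edge belongs to the middle triangle and to one corner triangle, with opposite
    orientations, and cancels. *)
Lemma triangle_subdivide (a b c : C) (r : R) :
  (r < 1)%R -> in_disc (a, b, c) r ->
  triangle_int (a, b, c) =
  triangle_int (a, mid a b, mid a c) + triangle_int (mid a b, b, mid b c) +
  triangle_int (mid a c, mid b c, c) + triangle_int (mid b c, mid a c, mid a b).
Proof.
  intros Hr [Ha [Hb Hc]].
  assert (Hu : forall z, closed_disc r z -> unit_disc z)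
    by (intros z Hz; eapply Rle_lt_trans; [exact Hz|exact Hr]).
  assert (Hab := Hu _ (mid_disc _ _ _ Ha Hb)).
  assert (Hbc := Hu _ (mid_disc _ _ _ Hb Hc)).
  assert (Hac := Hu _ (mid_disc _ _ _ Ha Hc)).
  apply Hu in Ha, Hb, Hc.
  assert (Hca : mid a c = mid c a)
    by (unfold mid; rewrite half_C; field; apply two_neq_0).
  unfold triangle_int.
  rewrite (seg_split a b (/ 2)), (seg_split b c (/ 2)), (seg_split c a (/ 2)) by (easy || lra).
  fold (mid a b) (mid b c) (mid c a). rewrite <- Hca.
  rewrite (seg_rev (mid a b) (mid a c)), (seg_rev (mid b c) (mid a b)),
    (seg_rev (mid a c) (mid b c)) by easy. ring.
Qed.

Lemma quarter_large (T : C * C * C) (r : R) :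
  (r < 1)%R -> in_disc T r -> (Cmod (triangle_int T) / 4 <= Cmod (triangle_int (quarter T)))%R.
Proof.
  destruct T as [[a b] c]. intros Hr H.
  assert (E := triangle_subdivide a b c r Hr H). unfold quarter.
  repeat (destruct Rle_dec; [assumption|]).
  rewrite E in *. clear E.
  set (t1 := triangle_int (a, mid a b, mid a c)) in *.
  set (t2 := triangle_int (mid a b, b, mid b c)) in *.
  set (t3 := triangle_int (mid a c, mid b c, c)) in *.
  set (t4 := triangle_int (mid b c, mid a c, mid a b)) in *.
  assert (A1 := Cmod_triangle (t1 + t2 + t3) t4).
  assert (A2 := Cmod_triangle (t1 + t2) t3).
  assert (A3 := Cmod_triangle t1 t2). lra.
Qed.

Lemma quarter_geometry (T : C * C * C) (r d : R) :
  in_disc T r -> sides_le T d ->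
  in_disc (quarter T) r /\ sides_le (quarter T) (d / 2) /\
  (Cmod (vertex (quarter T) - vertex T) <= d)%R.
Proof.
  destruct T as [[a b] c]. intros [Ha [Hb Hc]] [H1 [H2 H3]].
  assert (Hab := mid_disc _ _ _ Ha Hb).
  assert (Hbc := mid_disc _ _ _ Hb Hc).
  assert (Hac := mid_disc _ _ _ Ha Hc).
  assert (half : forall z w, w = / 2 * z \/ w = - (/ 2 * z) ->
            (Cmod z <= d)%R -> (Cmod w <= d / 2)%R).
  { intros z w Hw Hz.
    replace (Cmod w) with (Cmod (/ 2 * z)).
    - rewrite <- half_C, Cmod_mult, Cmod_R, Rabs_right by lra. lra.
    - destruct Hw; subst w; [|rewrite Cmod_opp]; easy. }
  assert (Hd : (0 <= d)%R) by (eapply Rle_trans; [apply Cmod_ge_0|exact H1]).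
  assert (D1 : (Cmod (mid a b - a) <= d / 2)%R)
    by (apply (half (b - a)); auto; left; unfold mid; rewrite half_C; ring).
  assert (D2 : (Cmod (mid a c - a) <= d / 2)%R)
    by (apply (half (a - c)); auto; right; unfold mid; rewrite half_C; ring).
  assert (D3 : (Cmod (mid b c - a) <= d)%R).
  { replace (mid b c - a) with ((mid a b - a) + (mid a c - a))
      by (unfold mid; rewrite half_C; field; apply two_neq_0).
    eapply Rle_trans; [apply Cmod_triangle|]. lra. }
  assert (D0 : (Cmod (a - a) <= d)%R).
  { replace (a - a) with (RtoC 0) by ring. now rewrite Cmod_0. }
  unfold quarter.
  assert (side : forall w,
    (w = / 2 * (b - a) \/ w = - (/ 2 * (b - a))) \/
    (w = / 2 * (c - b) \/ w = - (/ 2 * (c - b))) \/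
    (w = / 2 * (a - c) \/ w = - (/ 2 * (a - c))) -> (Cmod w <= d / 2)%R).
  { intros w [Hw|[Hw|Hw]]; [now apply (half (b - a))|now apply (half (c - b))|
      now apply (half (a - c))]. }
  repeat destruct Rle_dec; unfold in_disc, sides_le, vertex; simpl fst;
    (split; [auto|]); (split; [|lra]);
    repeat split; apply side; unfold mid; rewrite half_C;
    first [left; left; field; apply two_neq_0 | left; right; field; apply two_neq_0
      | right; left; left; field; apply two_neq_0 | right; left; right; field; apply two_neq_0
      | right; right; left; field; apply two_neq_0 | right; right; right; field; apply two_neq_0].
Qed.

End Segments.

Lemma closed_disc_unit_disc (r : R) (z : C) : (r < 1)%R -> closed_disc r z -> unit_disc z.
Proof. intros Hr Hz. eapply Rle_lt_trans; [exact Hz|exact Hr]. Qed.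

Lemma is_Cderive_affine (c d z : C) : is_Cderive (fun x => c + d * x) z d.
Proof.
  assert (H := is_Cderive_plus _ _ _ _ _ (is_Cderive_const c z)
                 (is_Cderive_scal d _ _ _ (is_Cderive_id z))).
  replace (0 + d * 1) with d in H by ring. exact H.
Qed.

(** This replaces the intersection of the nested triangles: their first vertices converge, with an
    explicit rate. *)
Lemma geometric_cauchy (u : nat -> C) (d : R) :
  (forall n, (Cmod (u (S n) - u n) <= d * (/ 2) ^ n)%R) ->
  exists p : C, forall n, (Cmod (u n - p) <= 2 * d * (/ 2) ^ n)%R.
Proof.
  intros H.
  assert (Hd : (0 <= d)%R).
  { specialize (H O). rewrite pow_O, Rmult_1_r in H.
    eapply Rle_trans; [apply Cmod_ge_0|exact H]. }
  assert (Hp : forall n, (0 < (/ 2) ^ n)%R) by (intros n; apply pow_lt; lra).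
  assert (B : forall n k, (Cmod (u (n + k)%nat - u n) <= 2 * d * (/ 2) ^ n)%R).
  { intros n k.
    (* The factor [1 - (/ 2) ^ k] is that of the partial geometric sum, which lets the induction on
       [k] close. *)
    enough (E : (Cmod (u (n + k)%nat - u n) <= 2 * d * (/ 2) ^ n * (1 - (/ 2) ^ k))%R).
    { eapply Rle_trans; [exact E|].
      assert (0 <= 2 * d * (/ 2) ^ n)%R
        by (apply Rmult_le_pos; [lra|apply Rlt_le, Hp]).
      specialize (Hp k). nra. }
    induction k as [|k IH].
    - rewrite Nat.add_0_r. replace (u n - u n) with (RtoC 0) by ring.
      rewrite Cmod_0. simpl. lra.
    - rewrite Nat.add_succ_r.
      replace (u (S (n + k)) - u n) with ((u (S (n + k)) - u (n + k)%nat) + (u (n + k)%nat - u n))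
        by ring.
      eapply Rle_trans; [apply Cmod_triangle|].
      specialize (H (n + k)%nat). rewrite pow_add in H.
      simpl pow. lra. }
  assert (Hc : forall (pr : C -> R), (forall z w, Rabs (pr z - pr w) <= Cmod (z - w))%R ->
            ex_finite_lim_seq (fun n => pr (u n))).
  { intros pr Hpr. apply ex_lim_seq_cauchy_corr. intros eps.
    destruct (pow_lt_1_zero (/ 2)%R ltac:(rewrite Rabs_right; lra)
                (eps / (4 * d + 1))%R) as [N HN].
    { apply Rlt_gt, Rdiv_lt_0_compat; [apply cond_pos|lra]. }
    exists N. intros n m Hn Hm.
    specialize (HN N (Nat.le_refl N)). rewrite Rabs_right in HN by (apply Rle_ge, Rlt_le, Hp).
    eapply Rle_lt_trans; [apply Hpr|].
    assert (Bn := B N (n - N)%nat). assert (Bm := B N (m - N)%nat).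
    replace (N + (n - N))%nat with n in Bn by lia.
    replace (N + (m - N))%nat with m in Bm by lia.
    replace (u n - u m) with ((u n - u N) + - (u m - u N)) by ring.
    eapply Rle_lt_trans; [apply Cmod_triangle|]. rewrite Cmod_opp.
    apply (Rmult_lt_compat_l (4 * d + 1)) in HN; [|lra].
    replace ((4 * d + 1) * (eps / (4 * d + 1)))%R with (pos eps) in HN by (field; lra).
    specialize (Hp N). nra. }
  destruct (Hc Re) as [x Hx].
  { intros z w. replace (Re z - Re w)%R with (Re (z - w)) by reflexivity. apply re_le_Cmod. }
  destruct (Hc Im) as [y Hy].
  { intros z w. replace (Im z - Im w)%R with (Im (z - w)) by reflexivity.
    eapply Rle_trans; [apply Rmax_r|apply Rmax_Cmod]. }
  set (p := (x, y) : C). exists p. intros n.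
  assert (HF : filterlim u eventually (locally (T := C_UniformSpace) p)).
  { intros P [eps HP].
    apply is_lim_seq_spec in Hx, Hy.
    unfold filtermap. generalize (filter_and _ _ (Hx eps) (Hy eps)). apply filter_imp.
    intros m [H1 H2]. apply HP. now split. }
  apply le_epsilon. intros eps He.
  assert (HL := HF (fun w => Cmod (w - p) < eps)%R).
  destruct HL as [N HN].
  { apply locally_Cmod. now exists eps. }
  specialize (HN (n + N)%nat ltac:(lia)). specialize (B n N).
  replace (u n - p) with (- (u (n + N)%nat - u n) + (u (n + N)%nat - p)) by ring.
  eapply Rle_trans; [apply Cmod_triangle|]. rewrite Cmod_opp. lra.
Qed.

(** An affine function has a primitive and integrates to [0] around a triangle, so in [goursat] the
    integrand may be compared with its tangent at the limit point. *)
Lemma seg_affine (c d a b : C) :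
  seg (fun z => c + d * z) a b = (c * b + d * (b * b) / 2) - (c * a + d * (a * a) / 2).
Proof.
  apply is_CInt_CInt.
  set (F := fun z => c * z + d / 2 * (z * z)).
  assert (HF : forall z, is_Cderive F z (c + d * z)).
  { intros z. unfold F.
    replace (c + d * z) with (c * 1 + d / 2 * (2 * z)) by (field; apply two_neq_0).
    apply is_Cderive_plus; apply is_Cderive_scal; [apply is_Cderive_id|apply is_Cderive_sqr]. }
  assert (H := is_CInt_derive (fun t : R => F (a + t * (b - a)))
     (fun t => (b - a) * (c + d * (a + t * (b - a)))) 0 1 ltac:(lra)).
  replace (c * b + d * (b * b) / 2 - (c * a + d * (a * a) / 2))
    with (F (a + 1%R * (b - a)) - F (a + 0%R * (b - a)))
    by (unfold F; field; apply two_neq_0).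
  apply H.
  - intros t _. rewrite Cmult_comm.
    apply (is_path_derive_comp F (fun t : R => a + t * (b - a))); [apply HF|].
    apply is_path_derive_affine.
  - intros t _.
    apply (continuous_seg (fun z => c + d * z)).
    exact (is_Cderive_continuous _ _ _ (is_Cderive_affine c d _)).
Qed.

Lemma seg_bound (f : C -> C) (a b : C) (M : R) :
  (forall z, unit_disc z -> Ccontinuous_at f z) ->
  unit_disc a -> unit_disc b ->
  (forall t : R, (0 <= t <= 1)%R -> (Cmod (f (a + t * (b - a))%C) <= M)%R) ->
  (Cmod (seg f a b) <= Cmod (b - a) * M)%R.
Proof.
  intros Hf Ha Hb H.
  assert (Hi := seg_correct f Hf a b Ha Hb).
  replace (Cmod (b - a) * M)%R with ((1 - 0) * (Cmod (b - a) * M))%R by ring.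
  eapply is_CInt_bound; [lra| |exact Hi].
  intros t Ht. cbv beta. rewrite Cmod_mult. apply Rmult_le_compat_l; [apply Cmod_ge_0|]. now apply H.
Qed.

Lemma seg_minus (f g : C -> C) (a b : C) :
  (forall z, unit_disc z -> Ccontinuous_at f z) ->
  (forall z, unit_disc z -> Ccontinuous_at g z) ->
  unit_disc a -> unit_disc b ->
  seg (fun z => f z - g z) a b = seg f a b - seg g a b.
Proof.
  intros Hf Hg Ha Hb. apply is_CInt_CInt.
  generalize (is_CInt_minus _ _ _ _ _ _ (seg_correct f Hf a b Ha Hb) (seg_correct g Hg a b Ha Hb)).
  apply is_CInt_ext; [lra|]. intros t _. ring.
Qed.

(** Bisection of triangles. The radius [r < 1] keeps the limit of the vertices inside the open disc,
    where [f] has a derivative. *)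
Theorem goursat (f : C -> C) (T : C * C * C) (r : R) :
  analytic_on unit_disc f -> (r < 1)%R -> in_disc T r -> triangle_int f T = 0.
Proof.
  intros Hf Hr HT.
  assert (Hc : forall z, unit_disc z ->
            Ccontinuous_at f z)
    by (intros z; apply analytic_on_continuous, Hf).
  destruct T as [[a0 b0] c0].
  set (d := Rmax (Cmod (b0 - a0)) (Rmax (Cmod (c0 - b0)) (Cmod (a0 - c0)))).
  assert (Hd : sides_le (a0, b0, c0) d).
  { repeat split; unfold d.
    - apply Rmax_l.
    - eapply Rle_trans; [apply Rmax_l|apply Rmax_r].
    - eapply Rle_trans; [apply Rmax_r|apply Rmax_r]. }
  set (U := fun n => Nat.iter n (quarter f) (a0, b0, c0)).
  assert (HU : forall n, in_disc (U n) r /\ sides_le (U n) (d * (/ 2) ^ n) /\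
            (Cmod (triangle_int f (a0, b0, c0)) * (/ 4) ^ n <= Cmod (triangle_int f (U n)))%R).
  { induction n as [|n [I1 [I2 I3]]].
    - simpl. rewrite !Rmult_1_r. auto using Rle_refl.
    - destruct (quarter_geometry f (U n) r _ I1 I2) as [Q1 [Q2 _]].
      split; [exact Q1|]. split.
      + change (U (S n)) with (quarter f (U n)). simpl pow.
        now replace (d * (/ 2 * (/ 2) ^ n))%R with (d * (/ 2) ^ n / 2)%R by field.
      + assert (Q := quarter_large f Hc (U n) r Hr I1).
        change (U (S n)) with (quarter f (U n)). simpl pow. lra. }
  destruct (geometric_cauchy (fun n => vertex (U n)) d) as [p Hp].
  { intros n. destruct (HU n) as [I1 [I2 _]].
    apply (quarter_geometry f (U n) r _ I1 I2). }
  assert (Hvr : forall n, (Cmod (vertex (U n)) <= r)%R).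
  { intros n. destruct (HU n) as [I1 _]. destruct (U n) as [[a b] c]. apply I1. }
  assert (Hpow : forall e, (0 < e)%R -> exists n, (d * (/ 2) ^ n < e)%R).
  { intros e He.
    destruct (pow_lt_1_zero (/ 2)%R ltac:(rewrite Rabs_right; lra) (e / (Rabs d + 1))%R) as [N HN].
    { apply Rlt_gt, Rdiv_lt_0_compat; [easy|]. generalize (Rabs_pos d); lra. }
    exists N. specialize (HN N (Nat.le_refl N)).
    assert (0 < (/ 2) ^ N)%R by (apply pow_lt; lra).
    rewrite Rabs_right in HN by lra.
    assert (Hd1 := Rabs_pos d). assert (Hd2 := Rle_abs d).
    apply (Rmult_lt_compat_l (Rabs d + 1)) in HN; [|lra].
    replace ((Rabs d + 1) * (e / (Rabs d + 1)))%R with e in HN by (field; lra). nra. }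
  assert (Hpr : (Cmod p <= r)%R).
  { apply le_epsilon. intros e He. destruct (Hpow (e / 2)%R) as [n Hn]; [lra|].
    specialize (Hp n). specialize (Hvr n). cbv beta in Hp.
    replace p with (vertex (U n) + - (vertex (U n) - p)) by ring.
    eapply Rle_trans; [apply Cmod_triangle|]. rewrite Cmod_opp. lra. }
  apply Cmod_eq_0. apply Rle_antisym; [|apply Cmod_ge_0].
  destruct (Hf p (closed_disc_unit_disc r p Hr Hpr)) as [l Hl].
  apply le_epsilon. intros eps He. rewrite Rplus_0_l.
  (* Each of the three sides of the [n]-th triangle contributes at most [dn] times [3 e dn], in
     total [9 e d^2 4^(-n)]. The summand [1] covers a degenerate triangle. *)
  set (e := (eps / (9 * (d * d) + 1))%R).
  assert (He1 : (0 < e)%R) by (apply Rdiv_lt_0_compat; nra).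
  destruct (proj1 (is_Cderive_iff _ _ _) Hl e He1) as [delta [Hdelta HD]].
  destruct (Hpow (delta / 3)%R) as [n Hn]; [lra|].
  destruct (HU n) as [I1 [I2 I3]]. specialize (Hp n). cbv beta in Hp.
  set (dn := (d * (/ 2) ^ n)%R) in *.
  set (A := fun z => (f p - l * p) + l * z).
  assert (HA : forall z, unit_disc z ->
            Ccontinuous_at A z).
  { intros z _. exact (is_Cderive_continuous _ _ _ (is_Cderive_affine _ _ z)). }
  assert (Hside : forall a b, closed_disc r a -> closed_disc r b ->
     (Cmod (a - vertex (U n)) <= dn)%R -> (Cmod (b - vertex (U n)) <= dn)%R ->
     (Cmod (b - a) <= dn)%R ->
     (Cmod (seg f a b - seg A a b) <= 3 * e * (dn * dn))%R).
  { intros a b Ha Hb Hav Hbv Hab.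
    apply (closed_disc_unit_disc r) in Ha, Hb; try easy.
    rewrite <- (seg_minus f A a b Hc HA Ha Hb).
    apply Rle_trans with (Cmod (b - a) * (3 * e * dn))%R.
    - apply seg_bound; try easy.
      + intros z Hz.
        apply (continuous_minus (V := C_R_NormedModule)); [now apply Hc|now apply HA].
      + intros t Ht. set (z := a + t * (b - a)).
        (* The point is within [dn] of the vertex by convexity of the disc, and the vertex within
           [2 dn] of [p]. *)
        assert (Hz : (Cmod (z - p) <= 3 * dn)%R).
        { replace (z - p) with (((a - vertex (U n)) + t * ((b - vertex (U n)) - (a - vertex (U n))))
             + (vertex (U n) - p)) by (unfold z; ring).
          eapply Rle_trans; [apply Cmod_triangle|].
          assert (Hs := closed_disc_segment dn _ _ t Hav Hbv Ht). unfold closed_disc in Hs.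
          unfold dn in *. lra. }
        unfold A. replace (f z - (f p - l * p + l * z)) with (f z - f p - l * (z - p)) by ring.
        specialize (HD (z - p)). rewrite Cplus_minus in HD.
        eapply Rle_trans; [apply HD; lra|]. nra.
    - assert (H0 := Cmod_ge_0 (b - a)).
      replace (3 * e * (dn * dn))%R with (dn * (3 * e * dn))%R by ring.
      apply Rmult_le_compat_r; [|easy]. apply Rmult_le_pos; lra. }
  destruct (U n) as [[a b] c] eqn:EU. unfold vertex in Hside. simpl fst in Hside.
  destruct I1 as [Ja [Jb Jc]], I2 as [K1 [K2 K3]].
  assert (Haa : (Cmod (a - a) <= dn)%R).
  { replace (a - a) with (RtoC 0) by ring. rewrite Cmod_0.
    eapply Rle_trans; [apply Cmod_ge_0|exact K1]. }
  assert (Hca : (Cmod (c - a) <= dn)%R).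
  { replace (c - a) with (- (a - c)) by ring. now rewrite Cmod_opp. }
  assert (S1 := Hside a b Ja Jb Haa K1 K1).
  assert (S2 := Hside b c Jb Jc K1 Hca K2).
  assert (S3 := Hside c a Jc Ja Hca Haa K3).
  assert (HT3 : (Cmod (triangle_int f (a, b, c)) <= 9 * e * (dn * dn))%R).
  { unfold triangle_int.
    replace (seg f a b + seg f b c + seg f c a) with
      ((seg f a b - seg A a b) + (seg f b c - seg A b c) + (seg f c a - seg A c a)).
    - eapply Rle_trans; [apply Cmod_triangle|].
      assert (H := Cmod_triangle (seg f a b - seg A a b) (seg f b c - seg A b c)). lra.
    - unfold A. rewrite !seg_affine. unfold Cdiv. ring. }
  assert (E4 : (dn * dn = d * d * (/ 4) ^ n)%R).
  { unfold dn. replace (/ 4)%R with (/ 2 * / 2)%R by field. rewrite Rpow_mult_distr. ring. }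
  rewrite E4 in HT3.
  assert (P4 : (0 < (/ 4) ^ n)%R) by (apply pow_lt; lra).
  apply Rle_trans with (9 * e * (d * d))%R.
  - apply Rmult_le_reg_r with ((/ 4) ^ n)%R; [easy|]. lra.
  - unfold e. replace (9 * (eps / (9 * (d * d) + 1)) * (d * d))%R
      with (eps - eps / (9 * (d * d) + 1))%R by (field; nra).
    unfold e in He1. lra.
Qed.

(** The triangle with vertices [0], [z], [z + h] reduces the increment of the integral to the
    segment from [z] to [z + h], where [f] is close to [f z]. *)
Theorem is_Cderive_Cint (f : C -> C) (z : C) :
  analytic_on unit_disc f -> unit_disc z -> is_Cderive (Cint f) z (f z).
Proof.
  intros Hf Hz.
  assert (Hc : forall z, unit_disc z ->
            Ccontinuous_at f z)
    by (intros w; apply analytic_on_continuous, Hf).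
  apply is_Cderive_iff. intros eps He.
  assert (HL := proj1 (Ccontinuous_iff (T := C_UniformSpace) f z) (Hc z Hz) eps He).
  apply locally_Cmod in HL. destruct HL as [d [Hd H]].
  unfold unit_disc in Hz.
  exists (Rmin d (1 - Cmod z)). split; [apply Rmin_case; lra|].
  intros h Hh. apply Rmin_Rgt_l in Hh. destruct Hh as [Hh1 Hh2].
  assert (Hzh : unit_disc (z + h)).
  { eapply Rle_lt_trans; [apply Cmod_triangle|]. lra. }
  assert (H0 : unit_disc 0) by (unfold unit_disc; rewrite Cmod_0; lra).
  assert (G : triangle_int f (RtoC 0, z, z + h) = 0).
  { apply (goursat f _ (Rmax (Cmod z) (Cmod (z + h)))); [easy|now apply Rmax_case|].
    split; [|split; [apply Rmax_l|apply Rmax_r]].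
    unfold closed_disc. rewrite Cmod_0. eapply Rle_trans; [|apply Rmax_l]. apply Cmod_ge_0. }
  unfold triangle_int in G. rewrite (seg_rev f Hc 0 (z + h) H0 Hzh) in G.
  rewrite !Cint_seg.
  (* The constant [f z] is written as an affine function so that [seg_affine] computes its
     integral. *)
  assert (Hk : forall w, unit_disc w ->
     Ccontinuous_at (fun x : C => f z + 0 * x) w).
  { intros w _. exact (is_Cderive_continuous _ _ _ (is_Cderive_affine _ _ w)). }
  replace (seg f 0 (z + h) - seg f 0 z - f z * h)
    with (seg f z (z + h) - seg (fun x => f z + 0 * x) z (z + h)).
  2:{ rewrite seg_affine.
      replace (seg f z (z + h)) with (seg f 0 (z + h) - seg f 0 z
         + (seg f 0 z + seg f z (z + h) + - seg f 0 (z + h))) by ring.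
      rewrite G. unfold Cdiv. ring. }
  rewrite <- (seg_minus f (fun x : C => f z + 0 * x) z (z + h) Hc Hk Hz Hzh).
  replace (eps * Cmod h)%R with (Cmod (z + h - z) * eps)%R.
  2:{ replace (z + h - z) with h by ring. ring. }
  apply seg_bound; try easy.
  - intros w Hw.
    apply (continuous_minus (V := C_R_NormedModule)); [now apply Hc|now apply Hk].
  - intros t Ht. replace (z + h - z) with h by ring.
    apply Rlt_le. replace (f (z + t * h) - (f z + 0 * (z + t * h))) with (f (z + t * h) - f z) by ring.
    apply H. replace (z + t * h - z) with (t * h) by ring.
    rewrite Cmod_mult, Cmod_R, Rabs_right by lra.
    assert (0 <= Cmod h)%R by apply Cmod_ge_0. nra.
Qed.

(** * Cauchy's formula *)

Lemma analytic_on_C_derive (S : C -> Prop) (f : C -> C) (z : C) :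
  analytic_on S f -> S z -> is_Cderive f z (C_derive f z).
Proof. intros H Hz. exact (C_derive_correct f z 0 (H z Hz)). Qed.

Lemma unit_disc_0 : unit_disc 0.
Proof. unfold unit_disc. rewrite Cmod_0. lra. Qed.

Lemma unit_disc_near (z : C) :
  unit_disc z -> exists d : R, (0 < d)%R /\ forall w, (Cmod (w - z) < d)%R -> unit_disc w.
Proof.
  unfold unit_disc. intros H. exists (1 - Cmod z)%R. split; [lra|].
  intros w Hw. assert (T := Cmod_triangle z (w - z)). rewrite Cplus_minus in T. lra.
Qed.

Lemma is_Cderive_ext_disc (f g : C -> C) (z l : C) :
  (forall w, unit_disc w -> f w = g w) -> unit_disc z ->
  is_Cderive f z l -> is_Cderive g z l.
Proof.
  intros H Hz. destruct (unit_disc_near z Hz) as [d [Hd Hw]].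
  apply (is_Cderive_ext_loc f g z l d Hd). intros w Hwd. now apply H, Hw.
Qed.

Lemma analytic_on_ext_disc (f g : C -> C) :
  (forall w, unit_disc w -> f w = g w) -> analytic_on unit_disc f -> analytic_on unit_disc g.
Proof.
  intros H Hf z Hz. destruct (Hf z Hz) as [l Hl]. exists l.
  now apply (is_Cderive_ext_disc f).
Qed.

Lemma unit_disc_scale (z : C) (t : R) : unit_disc z -> (0 <= t <= 1)%R -> unit_disc (t * z).
Proof.
  unfold unit_disc. intros Hz Ht. rewrite Cmod_mult, Cmod_R, Rabs_right by lra.
  assert (0 <= Cmod z)%R by apply Cmod_ge_0. nra.
Qed.

Lemma is_path_derive_zero_const (g : R -> C) (a b : R) :
  (forall t, (a <= t <= b)%R -> is_path_derive g t (RtoC 0)) -> (a < b)%R -> g a = g b.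
Proof. apply (eq_is_derive (V := C_R_NormedModule)). Qed.

Lemma derive_eq_disc (f g : C -> C) (df : C -> C) (z : C) :
  (forall w, unit_disc w -> is_Cderive f w (df w)) ->
  (forall w, unit_disc w -> is_Cderive g w (df w)) ->
  f 0 = g 0 -> unit_disc z -> f z = g z.
Proof.
  intros Hf Hg H0 Hz.
  assert (E : f (0 + 0%R * z) - g (0 + 0%R * z) = f (0 + 1%R * z) - g (0 + 1%R * z)).
  { apply (is_path_derive_zero_const (fun t : R => f (0 + t * z) - g (0 + t * z))); [|lra].
    intros t Ht.
    assert (Ht' : unit_disc (0 + t * z)).
    { rewrite Cplus_0_l. now apply unit_disc_scale. }
    assert (H := is_path_derive_comp (fun w => f w + -(1) * g w) (fun t : R => 0 + t * z) t _ _
      (is_Cderive_plus _ _ _ _ _ (Hf _ Ht') (is_Cderive_scal (-(1)) _ _ _ (Hg _ Ht')))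
      (is_path_derive_affine 0 z t)).
    replace ((df (0 + t * z) + -(1) * df (0 + t * z)) * z) with (RtoC 0) in H by ring.
    revert H. apply (is_derive_ext (K := R_AbsRing) (V := C_R_NormedModule)).
    intros s. ring_simplify. reflexivity. }
  replace (0 + 1%R * z) with z in E by ring.
  replace (0 + 0%R * z) with (RtoC 0) in E by ring.
  rewrite H0 in E. apply Ceq_minus. rewrite <- E. ring.
Qed.

Lemma is_path_derive_Re (g : R -> C) (t : R) (l : C) :
  is_path_derive g t l -> is_derive (fun s => Re (g s)) t (Re l).
Proof.
  intros H.
  apply (filterdiff_ext_lin _ (fun y : R => Re (scal (V := C_R_NormedModule) y l))); [|reflexivity].
  apply (filterdiff_comp g (fun p : C_R_NormedModule => fst p) _ (fun p => fst p) H).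
  apply filterdiff_linear, is_linear_fst.
Qed.

Lemma is_path_derive_Im (g : R -> C) (t : R) (l : C) :
  is_path_derive g t l -> is_derive (fun s => Im (g s)) t (Im l).
Proof.
  intros H.
  apply (filterdiff_ext_lin _ (fun y : R => Im (scal (V := C_R_NormedModule) y l))); [|reflexivity].
  apply (filterdiff_comp g (fun p : C_R_NormedModule => snd p) _ (fun p => snd p) H).
  apply filterdiff_linear, is_linear_snd.
Qed.

Lemma is_CInt_Re (g : R -> C) (a b : R) (l : C) :
  is_CInt g a b l -> is_RInt (fun t => Re (g t)) a b (Re l).
Proof. apply (is_RInt_fct_extend_fst (U := R_NormedModule) (V := R_NormedModule)). Qed.

Lemma is_CInt_Im (g : R -> C) (a b : R) (l : C) :
  is_CInt g a b l -> is_RInt (fun t => Im (g t)) a b (Im l).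
Proof. apply (is_RInt_fct_extend_snd (U := R_NormedModule) (V := R_NormedModule)). Qed.

Lemma CInt_components (g : R -> C) (a b : R) :
  (a <= b)%R -> (forall t, (a <= t <= b)%R -> Ccontinuous g t) ->
  CInt g a b = (RInt (fun t => Re (g t)) a b, RInt (fun t => Im (g t)) a b).
Proof.
  intros Hab H. assert (Hi := CInt_correct g a b Hab H).
  rewrite (is_RInt_unique _ _ _ _ (is_CInt_Re _ _ _ _ Hi)).
  rewrite (is_RInt_unique _ _ _ _ (is_CInt_Im _ _ _ _ Hi)).
  now destruct (CInt g a b).
Qed.

Lemma is_path_derive_CInt_param (g dg : R -> R -> C) (a b s0 : R) (eta : posreal) :
  (a <= b)%R ->
  (forall s t, ball s0 eta s -> is_path_derive (fun s => g s t) s (dg s t)) ->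
  (forall s t, ball s0 eta s -> Ccontinuous (g s) t) ->
  (forall t, continuous (U := C_UniformSpace) (fun p : R * R => dg (fst p) (snd p)) (s0, t)) ->
  is_path_derive (fun s => CInt (g s) a b) s0 (CInt (dg s0) a b).
Proof.
  intros Hab Hd Hg Hdg.
  assert (H0 : ball s0 eta s0) by apply ball_center.
  assert (Hdg0 : forall t, Ccontinuous (dg s0) t).
  { intros t. apply (continuous_comp_2 (fun _ => s0) (fun t => t) dg);
      [apply continuous_const|apply continuous_id|apply Hdg]. }
  (* The real theorem on parameter integrals is applied to each component, [pr] standing for [Re] or
     [Im]. *)
  assert (main : forall pr : C -> R,
     (forall s t, ball s0 eta s -> is_derive (fun s => pr (g s t)) s (pr (dg s t))) ->
     (forall s t, ball s0 eta s -> continuous (fun t => pr (g s t)) t) ->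
     (forall t, continuous (fun p : R * R => pr (dg (fst p) (snd p))) (s0, t)) ->
     is_derive (fun s => RInt (fun t => pr (g s t)) a b) s0 (RInt (fun t => pr (dg s0 t)) a b)).
  { intros pr P1 P2 P3.
    replace (RInt (fun t => pr (dg s0 t)) a b)
      with (RInt (fun t => Derive (fun u => pr (g u t)) s0) a b).
    2:{ apply RInt_ext. intros t _. apply is_derive_unique. now apply P1. }
    apply (is_derive_RInt_param (fun s t => pr (g s t))).
    - exists eta. intros s Hs t _. exists (pr (dg s t)). now apply P1.
    - intros t _. apply (continuity_2d_pt_ext_loc (fun s t => pr (dg s t))).
      + exists eta. intros u v Hu _. symmetry. apply is_derive_unique, P1. exact Hu.
      + apply continuity_2d_pt_filterlim. apply P3.
    - exists eta. intros s Hs. apply (ex_RInt_continuous (V := R_CompleteNormedModule)).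
      intros t _. now apply P2. }
  rewrite (CInt_components (dg s0)) by (easy || (intros; apply Hdg0)).
  apply (is_derive_ext_loc (K := R_AbsRing) (V := C_R_NormedModule)
    (fun s => (RInt (fun t => Re (g s t)) a b, RInt (fun t => Im (g s t)) a b))).
  { exists eta. intros s Hs. symmetry. apply CInt_components; [easy|]. intros t _. now apply Hg. }
  apply is_path_derive_pair; apply main.
  - intros s t Hs. now apply is_path_derive_Re, Hd.
  - intros s t Hs. now apply Ccontinuous_Re, Hg.
  - intros t. apply (Ccontinuous_Re (fun p : R * R => dg (fst p) (snd p))), Hdg.
  - intros s t Hs. now apply is_path_derive_Im, Hd.
  - intros s t Hs. now apply Ccontinuous_Im, Hg.
  - intros t. apply (Ccontinuous_Im (fun p : R * R => dg (fst p) (snd p))), Hdg.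
Qed.

(** * Integrals over circles *)

Definition circle (r t : R) : C := r * (cos t, sin t).

Lemma is_path_derive_circle (r t : R) : is_path_derive (circle r) t (Ci * circle r t).
Proof.
  unfold circle.
  assert (H := is_path_derive_comp (fun z => r * z) _ t _ _
     (is_Cderive_scal r _ _ _ (is_Cderive_id _))
     (is_path_derive_pair cos sin t _ _ (is_derive_cos t) (is_derive_sin t))).
  replace (Ci * (r * (cos t, sin t))) with (r * 1 * (- sin t, cos t)%R); [exact H|].
  unfold Ci, Cmult, RtoC; simpl. f_equal; ring.
Qed.

Lemma Cmod_circle (r t : R) : (0 <= r)%R -> Cmod (circle r t) = r.
Proof.
  intros Hr. unfold circle. rewrite Cmod_mult, Cmod_R, Rabs_right by lra.
  unfold Cmod; simpl. replace (cos t * (cos t * 1) + sin t * (sin t * 1))%R with 1%R.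
  - rewrite sqrt_1. ring.
  - assert (H := sin2_cos2 t). unfold Rsqr in H. lra.
Qed.

Lemma circle_2PI (r : R) : circle r (2 * PI) = circle r 0.
Proof. unfold circle. now rewrite cos_2PI, sin_2PI, cos_0, sin_0. Qed.

Lemma Ccontinuous_circle (r t : R) : Ccontinuous (circle r) t.
Proof. exact (is_path_derive_continuous _ _ _ (is_path_derive_circle r t)). Qed.

Lemma circle_neq (r t : R) (a : C) : (Cmod a < r)%R -> circle r t - a <> 0.
Proof.
  intros Ha E. apply Ceq_minus in E.
  assert (Hr : (0 <= r)%R) by (generalize (Cmod_ge_0 a); lra).
  rewrite <- E, Cmod_circle in Ha; lra.
Qed.

Lemma is_CInt_circle_derive (r : R) (G : C -> C) (g : R -> C) :
  (forall t, is_path_derive (fun t => G (circle r t)) t (g t)) ->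
  (forall t, Ccontinuous g t) -> is_CInt g 0 (2 * PI) (RtoC 0).
Proof.
  intros HG Hg. assert (HP := PI_RGT_0).
  assert (H := is_CInt_derive (fun t => G (circle r t)) g 0 (2 * PI) ltac:(lra)
    (fun t _ => HG t) (fun t _ => Hg t)).
  cbv beta in H. rewrite circle_2PI in H.
  replace (G (circle r 0) - G (circle r 0)) with (RtoC 0) in H by ring. exact H.
Qed.

Lemma Ccontinuous_minus {T : UniformSpace} (f g : T -> C) (x : T) :
  Ccontinuous f x -> Ccontinuous g x -> Ccontinuous (fun t => f t - g t) x.
Proof. apply (continuous_minus (V := C_R_NormedModule)). Qed.

Lemma is_Cderive_minus (f g : C -> C) (z l m : C) :
  is_Cderive f z l -> is_Cderive g z m -> is_Cderive (fun x => f x - g x) z (l - m).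
Proof. apply (is_derive_minus (K := C_AbsRing) (V := C_NormedModule)). Qed.

Lemma is_Cderive_eq (f : C -> C) (z l m : C) : is_Cderive f z l -> l = m -> is_Cderive f z m.
Proof. now intros H <-. Qed.

Lemma is_path_derive_eq (f : R -> C) (t : R) (l m : C) :
  is_path_derive f t l -> l = m -> is_path_derive f t m.
Proof. now intros H <-. Qed.

Ltac ccont :=
  lazymatch goal with
  | |- continuous (fun _ => ?c) _ => apply continuous_const
  | |- continuous (fun t => (_ + _)%C) _ => apply Ccontinuous_plus; ccont
  | |- continuous (fun t => (_ - _)%C) _ => apply Ccontinuous_minus; ccont
  | |- continuous (fun t => (_ * _)%C) _ => apply Ccontinuous_mult; ccont
  | |- continuous (fun t => (_ / _)%C) _ => apply Ccontinuous_div; [ccont|ccont|]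
  | |- continuous (fun t => circle ?r t) _ => apply Ccontinuous_circle
  | |- continuous (circle ?r) _ => apply Ccontinuous_circle
  | |- continuous (fun t => RtoC _) _ => apply Ccontinuous_RtoC; ccont
  | |- continuous (fun t => t) _ => apply continuous_id
  | |- continuous fst _ => apply continuous_fst
  | |- continuous snd _ => apply continuous_snd
  | |- _ => try assumption
  end.

Section CauchyFormula.

Variables (F f : C -> C) (a : C) (r : R).
Hypothesis HF : forall z, unit_disc z -> is_Cderive F z (f z).
Hypothesis Hf : forall z, unit_disc z ->
  Ccontinuous_at f z.
Hypothesis Har : (Cmod a < r)%R.
Hypothesis Hr1 : (r < 1)%R.

Let w := circle r.

Let Hr0 : (0 < r)%R.
Proof. generalize (Cmod_ge_0 a). lra. Qed.

Let Hwa (t : R) : w t - a <> 0.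
Proof. now apply circle_neq. Qed.

(** Since [|w t - a| <= 2 r], changing the parameter by less than [(1 - r) / 2] moves the point by
    at most [(1 - r) r], less than the gap [1 - r] to the unit circle. *)
Let disc_homotopy (s0 s t : R) :
  (0 <= s0 <= 1)%R -> (Rabs (s - s0) < (1 - r) / 2)%R -> unit_disc (a + s * (w t - a)).
Proof.
  intros Hs0 Hs.
  assert (Hw : (Cmod (w t) = r)%R) by (apply Cmod_circle; lra).
  assert (H0 : closed_disc r (a + s0 * (w t - a)))
    by (apply closed_disc_segment; unfold closed_disc; lra).
  unfold closed_disc in H0. unfold unit_disc.
  replace (a + s * (w t - a)) with ((a + s0 * (w t - a)) + (s - s0)%R * (w t + - a))
    by (rewrite RtoC_minus; ring).
  eapply Rle_lt_trans; [apply Cmod_triangle|].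
  rewrite (Cmod_mult (RtoC _)), Cmod_R.
  assert (T := Cmod_triangle (w t) (- a)). rewrite Cmod_opp in T.
  assert (P1 := Rabs_pos (s - s0)). assert (P2 := Cmod_ge_0 (w t + - a)).
  assert (P3 := Cmod_ge_0 a).
  assert (Rabs (s - s0) * Cmod (w t + - a) <= (1 - r) / 2 * (2 * r))%R
    by (apply Rmult_le_compat; lra).
  nra.
Qed.

Let circle_derive (t : R) : is_path_derive w t (Ci * w t).
Proof. apply is_path_derive_circle. Qed.

(** The integrand is the derivative in [t] of [F (a + s (w t - a)) / (i s)], or of [f a w t / i]
    when [s = 0], and the circle closes up. *)
Let homotopy_zero (s : R) : (0 <= s <= 1)%R ->
  CInt (fun t => f (a + s * (w t - a)) * w t) 0 (2 * PI) = RtoC 0.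
Proof.
  intros Hs. apply is_CInt_CInt.
  assert (Hin : forall t, unit_disc (a + s * (w t - a))).
  { intros t. apply (disc_homotopy s); [easy|]. (rewrite Rminus_diag, Rabs_R0; lra). }
  assert (Hcont : forall t, Ccontinuous (fun t : R => f (a + s * (w t - a)) * w t) t).
  { intros t. apply Ccontinuous_mult; [|apply Ccontinuous_circle].
    apply (Ccontinuous_comp f (fun t : R => a + s * (w t - a))); [unfold w; ccont|now apply Hf]. }
  destruct (Req_dec s 0) as [E|E].
  - subst s.
    apply (is_CInt_circle_derive r (fun z => f a * / Ci * z)); [|exact Hcont].
    intros t.
    assert (H := is_path_derive_comp (fun z => f a * / Ci * z) w t _ _
      (is_Cderive_scal _ _ _ _ (is_Cderive_id _)) (circle_derive t)).
    refine (is_path_derive_eq _ _ _ _ H _).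
    replace (a + 0%R * (w t - a)) with a by ring. field. apply Ci_nz.
  - assert (HsC : RtoC s <> 0) by now apply RtoC_neq_0.
    apply (is_CInt_circle_derive r (fun z => / (Ci * s) * F (a - s * a + s * z))).
    2: exact Hcont.
    intros t.
    assert (Hin' : unit_disc (a - s * a + s * w t)).
    { replace (a - s * a + s * w t) with (a + s * (w t - a)) by ring. apply Hin. }
    assert (H := is_path_derive_comp (fun z => / (Ci * s) * F (a - s * a + s * z)) w t _ _
      (is_Cderive_scal _ _ _ _ (is_Cderive_comp F (fun z => a - s * a + s * z) _ _ _
         (HF _ Hin') (is_Cderive_affine _ _ _))) (circle_derive t)).
    refine (is_path_derive_eq _ _ _ _ H _).
    replace (a - s * a + s * w t) with (a + s * (w t - a)) by ring.
    field. split; [easy|apply Ci_nz].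
Qed.

(** Shrinking the argument of [F] from the circle to its point [a] does not change the integral: the
    derivative in [s] is the integral of [homotopy_zero]. Continuity of the derivative [f] is
    assumed because differentiability of derivatives is not yet available. *)
Lemma cauchy_homotopy :
  CInt (fun t => F (w t) * (w t / (w t - a))) 0 (2 * PI) =
  F a * CInt (fun t => w t / (w t - a)) 0 (2 * PI).
Proof.
  assert (HP := PI_RGT_0).
  assert (HFc : forall z, unit_disc z ->
            Ccontinuous_at F z)
    by (intros z Hz; exact (is_Cderive_continuous _ _ _ (HF z Hz))).
  assert (Hk : forall t, Ccontinuous (fun t => w t / (w t - a)) t).
  { intros t. unfold w; ccont. now apply circle_neq. }
  set (g := fun (s t : R) => F (a + s * (w t - a)) * (w t / (w t - a))).
  assert (E : CInt (g 0%R) 0 (2 * PI) = CInt (g 1%R) 0 (2 * PI)).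
  { apply (is_path_derive_zero_const (fun s => CInt (g s) 0 (2 * PI))); [|lra].
    intros s0 Hs0. rewrite <- (homotopy_zero s0 Hs0).
    assert (He : (0 < (1 - r) / 2)%R) by lra.
    apply (is_path_derive_CInt_param g (fun s t => f (a + s * (w t - a)) * w t) 0 (2 * PI) s0
             (mkposreal _ He)); [lra| | |].
    - intros s t Hs. assert (Hin := disc_homotopy s0 s t Hs0 Hs).
      assert (H := is_path_derive_comp (fun z => (w t / (w t - a)) * F z)
         (fun s : R => a + s * (w t - a)) s _ _
         (is_Cderive_scal _ _ _ _ (HF _ Hin)) (is_path_derive_affine _ _ _)).
      apply (is_path_derive_eq _ _ _ (f (a + s * (w t - a)) * w t)) in H.
      2:{ field. apply Hwa. }
      revert H. apply (is_derive_ext (K := R_AbsRing) (V := C_R_NormedModule)).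
      intros u. unfold g. apply Cmult_comm.
    - intros s t Hs. assert (Hin := disc_homotopy s0 s t Hs0 Hs).
      apply Ccontinuous_mult; [|apply Hk].
      apply (Ccontinuous_comp F (fun t : R => a + s * (w t - a))); [unfold w; ccont|now apply HFc].
    - intros t.
      assert (Hw : continuous (U := C_UniformSpace) (fun p : R * R => w (snd p)) (s0, t)).
      { apply (continuous_comp snd w); [apply continuous_snd|apply Ccontinuous_circle]. }
      apply Ccontinuous_mult; [|exact Hw].
      apply (Ccontinuous_comp (T := prod_UniformSpace R_UniformSpace R_UniformSpace)
               f (fun p : R * R => a + fst p * (w (snd p) - a))).
      + ccont.
      + apply Hf. apply (disc_homotopy s0); [easy|].
        simpl. (rewrite Rminus_diag, Rabs_R0; lra). }
  transitivity (CInt (g 1%R) 0 (2 * PI)).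
  { apply CInt_ext; [lra|]. intros t _. unfold g. f_equal. f_equal. ring. }
  rewrite <- E. apply is_CInt_CInt.
  assert (H := is_CInt_mult_l (F a) _ 0 (2 * PI) _
     (CInt_correct (fun t => w t / (w t - a)) 0 (2 * PI) ltac:(lra) (fun t _ => Hk t))).
  revert H. apply is_CInt_ext; [lra|]. intros t _. unfold g.
  now replace (a + 0%R * (w t - a)) with a by ring.
Qed.

End CauchyFormula.

(** A remainder of size [M |h|^2] uniformly in [t] can be integrated directly, without a limit
    theorem. *)
Lemma is_Cderive_CInt_param (g : C -> R -> C) (dg : R -> C) (a b : R) (z : C) (M d : R) :
  (a <= b)%R -> (0 <= M)%R -> (0 < d)%R ->
  (forall h t, (Cmod h < d)%R -> (a <= t <= b)%R -> Ccontinuous (g (z + h)) t) ->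
  (forall t, (a <= t <= b)%R -> Ccontinuous dg t) ->
  (forall h t, (Cmod h < d)%R -> (a <= t <= b)%R ->
     (Cmod (g (z + h)%C t - g z t - dg t * h) <= M * (Cmod h * Cmod h))%R) ->
  is_Cderive (fun x => CInt (g x) a b) z (CInt dg a b).
Proof.
  intros Hab HM Hd Hg Hdg H. apply is_Cderive_iff. intros eps He.
  set (N := ((b - a) * M + 1)%R).
  assert (HN : (1 <= N)%R).
  { unfold N. assert (0 <= (b - a) * M)%R by (apply Rmult_le_pos; lra). lra. }
  exists (Rmin d (eps / N)). split.
  { apply Rmin_case; [easy|]. apply Rdiv_lt_0_compat; lra. }
  intros h Hh. apply Rmin_Rgt_l in Hh. destruct Hh as [H1 H2].
  assert (Hz : forall t, (a <= t <= b)%R -> Ccontinuous (g z) t).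
  { intros t Ht. rewrite <- (Cplus_0_r z). apply Hg; [now rewrite Cmod_0|easy]. }
  assert (I := is_CInt_minus _ _ _ _ _ _
     (is_CInt_minus _ _ _ _ _ _ (CInt_correct (g (z + h)) a b Hab (fun t => Hg h t H1))
        (CInt_correct (g z) a b Hab Hz))
     (is_CInt_mult_l h _ _ _ _ (CInt_correct dg a b Hab Hdg))).
  rewrite (Cmult_comm (CInt dg a b) h).
  eapply Rle_trans;
    [apply (is_CInt_bound _ a b _ (M * (Cmod h * Cmod h)) Hab) with (2 := I)|].
  - intros t Ht. cbv beta. rewrite (Cmult_comm h). apply (H h t H1 Ht).
  - assert (Hh := Cmod_ge_0 h).
    apply Rlt_gt, (Rmult_lt_compat_l N) in H2; [|lra].
    replace (N * (eps / N))%R with eps in H2 by (field; lra).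
    apply Rle_trans with (N * Cmod h * Cmod h)%R; [unfold N; nra|].
    apply Rmult_le_compat_r; lra.
Qed.

Lemma Ccontinuous_pow {T : UniformSpace} (f : T -> C) (n : nat) (x : T) :
  Ccontinuous f x -> Ccontinuous (fun t => f t ^ n) x.
Proof.
  intros H. induction n as [|n IH]; simpl; [apply continuous_const|].
  now apply Ccontinuous_mult.
Qed.

Lemma Ccontinuous_bounded (f : R -> C) (a b : R) :
  (a <= b)%R -> (forall t, (a <= t <= b)%R -> Ccontinuous f t) ->
  exists B : R, (0 <= B)%R /\ forall t, (a <= t <= b)%R -> (Cmod (f t) <= B)%R.
Proof.
  intros Hab H.
  destruct (continuity_ab_maj (fun t => Cmod (f t)) a b Hab) as [m [Hm _]].
  { intros t Ht. apply continuity_pt_filterlim. now apply continuous_Cmod, H. }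
  exists (Cmod (f m)). split; [apply Cmod_ge_0|exact Hm].
Qed.

(* With [v = / (u - h)] and [w = / u] this is the first order Taylor formula for [u ^ -n]. *)
Lemma inv_pow_taylor (n : nat) (K : R) :
  (0 <= K)%R -> exists M : R, (0 <= M)%R /\ forall v w h : C,
    (Cmod v <= K)%R -> (Cmod w <= K)%R -> v - w = h * v * w ->
    (Cmod (v ^ n - w ^ n - INR n * w ^ S n * h) <= M * (Cmod h * Cmod h))%R.
Proof.
  intros HK. induction n as [|n [M [HM IH]]].
  - exists 0%R. split; [lra|]. intros v w h _ _ _. simpl.
    replace (1 - 1 - 0 * (w * 1) * h) with (RtoC 0) by ring. rewrite Cmod_0. lra.
  - exists (K * M + INR (S n) * (K * K ^ S (S n)))%R.
    assert (HP : (0 <= K ^ S (S n))%R) by now apply pow_le.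
    assert (Hn := pos_INR (S n)).
    split; [apply Rplus_le_le_0_compat; [now apply Rmult_le_pos|]; now apply Rmult_le_pos, Rmult_le_pos|].
    intros v w h Hv Hw E. specialize (IH v w h Hv Hw E).
    replace (v ^ S n - w ^ S n - INR (S n) * w ^ S (S n) * h) with
      (v * (v ^ n - w ^ n - INR n * w ^ S n * h) + INR (S n) * (v * w ^ S (S n)) * (h * h)).
    + eapply Rle_trans; [apply Cmod_triangle|].
      rewrite !Cmod_mult, Cmod_pow, Cmod_R, Rabs_right by lra.
      assert (Hh : (0 <= Cmod h * Cmod h)%R) by apply Rle_0_sqr.
      rewrite Rmult_plus_distr_r. apply Rplus_le_compat.
      * rewrite Rmult_assoc. apply Rmult_le_compat; auto using Cmod_ge_0.
      * apply Rmult_le_compat_r; [easy|]. apply Rmult_le_compat_l; [easy|].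
        apply Rmult_le_compat; auto using Cmod_ge_0.
        -- apply pow_le, Cmod_ge_0.
        -- apply pow_incr. auto using Cmod_ge_0.
    + rewrite S_INR, RtoC_plus, !Cpow_S.
      transitivity (v * v ^ n - w * w ^ n - (INR n + 1) * (w * (w * w ^ n)) * h
        + (h * v * w - (v - w)) * (w ^ n + (INR n + 1) * h * (w * w ^ n)) ).
      * ring.
      * rewrite <- E. ring.
Qed.

(** An arbitrary continuous density and a general exponent make the family closed under
    differentiation; the factor [1 / (2 pi)] is left to the users. *)
Definition cauchy_integral (r : R) (c : R -> C) (n : nat) (a : C) : C :=
  CInt (fun t => c t * (/ (circle r t - a)) ^ n) 0 (2 * PI).

Lemma is_Cderive_cauchy_integral (r : R) (c : R -> C) (n : nat) (a : C) :
  (forall t, Ccontinuous c t) -> (Cmod a < r)%R ->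
  is_Cderive (cauchy_integral r c n) a (INR n * cauchy_integral r c (S n) a).
Proof.
  intros Hc Ha. assert (HP := PI_RGT_0). assert (Ha0 := Cmod_ge_0 a).
  set (rho := (r - Cmod a)%R).
  assert (Hrho : (0 < rho)%R) by (unfold rho; lra).
  assert (Hinv : forall h t, (Cmod h < rho / 2)%R ->
     circle r t - (a + h) <> 0 /\ (Cmod (/ (circle r t - (a + h))) <= 2 / rho)%R).
  { intros h t Hh.
    assert (Hn : circle r t - (a + h) <> 0).
    { apply circle_neq. eapply Rle_lt_trans; [apply Cmod_triangle|]. unfold rho in *. lra. }
    split; [exact Hn|]. rewrite Cmod_inv by easy.
    replace (2 / rho)%R with (/ (rho / 2))%R by (field; lra).
    apply Rinv_le_contravar; [lra|].
    assert (T := Cmod_triangle (circle r t - (a + h)) (a + h)).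
    replace (circle r t - (a + h) + (a + h)) with (circle r t) in T by ring.
    rewrite Cmod_circle in T by lra.
    assert (T2 := Cmod_triangle a h). unfold rho in *. lra. }
  assert (Hcont : forall h t m, (Cmod h < rho / 2)%R ->
     Ccontinuous (fun t => c t * (/ (circle r t - (a + h))) ^ m) t).
  { intros h t m Hh. apply Ccontinuous_mult; [apply Hc|].
    apply Ccontinuous_pow, Ccontinuous_inv; [ccont|]. now apply Hinv. }
  destruct (Ccontinuous_bounded c 0 (2 * PI) ltac:(lra) (fun t _ => Hc t)) as [B [HB HcB]].
  destruct (inv_pow_taylor n (2 / rho)) as [M [HM T]].
  { apply Rlt_le, Rdiv_lt_0_compat; lra. }
  assert (H00 : (Cmod 0 < rho / 2)%R) by (rewrite Cmod_0; lra).
  replace (INR n * cauchy_integral r c (S n) a)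
    with (CInt (fun t => INR n * (c t * (/ (circle r t - a)) ^ S n)) 0 (2 * PI)).
  2:{ apply is_CInt_CInt, is_CInt_mult_l, CInt_correct; [lra|]. intros t _.
      rewrite <- (Cplus_0_r a). now apply Hcont. }
  apply (is_Cderive_CInt_param (fun a t => c t * (/ (circle r t - a)) ^ n) _ 0 (2 * PI) a
           (B * M) (rho / 2)); [lra|now apply Rmult_le_pos|lra| | |].
  - intros h t Hh _. now apply Hcont.
  - intros t _. apply Ccontinuous_mult; [apply continuous_const|].
    rewrite <- (Cplus_0_r a). now apply Hcont.
  - intros h t Hh Ht.
    destruct (Hinv h t Hh) as [N1 B1]. destruct (Hinv 0 t H00) as [N0 B0].
    rewrite Cplus_0_r in N0, B0.
    set (v := / (circle r t - (a + h))) in *. set (w := / (circle r t - a)) in *.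
    replace (c t * v ^ n - c t * w ^ n - INR n * (c t * w ^ S n) * h)
      with (c t * (v ^ n - w ^ n - INR n * w ^ S n * h)) by ring.
    rewrite Cmod_mult, Rmult_assoc.
    apply Rmult_le_compat; try apply Cmod_ge_0; [now apply HcB|].
    apply T; try easy. unfold v, w. field. easy.
Qed.

Lemma RtoC_scale_lt (r : R) (z : C) : (0 < r)%R -> unit_disc z -> (Cmod (r * z) < r)%R.
Proof.
  unfold unit_disc. intros Hr Hz. rewrite Cmod_mult, Cmod_R, Rabs_right by lra. nra.
Qed.

(** The derivative in [a] is the integral of [w / (w - a)^2], which is the derivative along the
    circle of [i / (w - a)] and so integrates to [0]. Hence the value is that at [a = 0]. *)
Lemma cauchy_kernel_integral (r : R) (a : C) :
  (0 < r)%R -> (Cmod a < r)%R -> cauchy_integral r (circle r) 1 a = RtoC (2 * PI).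
Proof.
  intros Hr Ha. assert (HP := PI_RGT_0).
  assert (H2 : forall b, (Cmod b < r)%R -> cauchy_integral r (circle r) 2 b = 0).
  { intros b Hb. apply is_CInt_CInt.
    apply (is_CInt_circle_derive r (fun z => Ci * / (- b + 1 * z))).
    - intros t.
      assert (Hn := circle_neq r t b Hb).
      assert (Hn' : - b + 1 * circle r t <> 0)
        by (now replace (- b + 1 * circle r t) with (circle r t - b) by ring).
      assert (H := is_path_derive_comp (fun z => Ci * / (- b + 1 * z)) (circle r) t _ _
        (is_Cderive_scal _ _ _ _ (is_Cderive_comp Cinv (fun z => - b + 1 * z) _ _ _
          (is_Cderive_inv_id _ Hn') (is_Cderive_affine _ _ _))) (is_path_derive_circle r t)).
      refine (is_path_derive_eq _ _ _ _ H _).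
      replace (- b + 1 * circle r t) with (circle r t - b) by ring.
      transitivity (- (Ci * Ci) * (circle r t * (/ (circle r t - b)) ^ 2)); [simpl; field; easy|].
      replace (- (Ci * Ci)) with (RtoC 1); [ring|].
      unfold Ci, Cmult, Copp, RtoC; simpl. f_equal; ring.
    - intros t. apply Ccontinuous_mult; [apply Ccontinuous_circle|].
      apply Ccontinuous_pow, Ccontinuous_inv; [ccont|now apply circle_neq]. }
  assert (Hr0 : RtoC r <> 0) by (apply RtoC_neq_0; lra).
  replace a with (r * (a / r)) by (field; easy).
  apply (derive_eq_disc (fun z => cauchy_integral r (circle r) 1 (r * z))
           (fun _ => RtoC (2 * PI)) (fun _ => 0)).
  - intros z Hz. assert (Hrz := RtoC_scale_lt r z Hr Hz).
    eapply is_Cderive_eq.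
    + apply (is_Cderive_comp _ (fun z => r * z)); [|apply is_Cderive_scal, is_Cderive_id].
      now apply is_Cderive_cauchy_integral; [intros; apply Ccontinuous_circle|].
    + rewrite H2 by easy. ring.
  - intros z _. apply is_Cderive_const.
  - apply is_CInt_CInt.
    assert (H := is_RInt_const (V := C_R_NormedModule) 0 (2 * PI) (RtoC 1)).
    assert (Es : scal (V := C_R_NormedModule) (2 * PI - 0)%R (RtoC 1) = RtoC (2 * PI)).
    { etransitivity; [apply scal_R_Cmult|]. rewrite Rminus_0_r. apply Cmult_1_r. }
    apply (eq_ind _ (is_CInt (fun _ => RtoC 1) 0 (2 * PI)) H) in Es.
    revert Es. apply is_CInt_ext; [lra|]. intros t _. rewrite Cmult_0_r. simpl.
    replace (circle r t - 0) with (circle r t) by ring. field.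
    apply Cmod_gt_0. rewrite Cmod_circle; lra.
  - unfold unit_disc. rewrite Cmod_div, Cmod_R, Rabs_right by (easy || lra).
    apply Rlt_div_l; lra.
Qed.

Lemma cauchy_formula_C1 (F f : C -> C) (a : C) (r : R) :
  (forall z, unit_disc z -> is_Cderive F z (f z)) ->
  (forall z, unit_disc z -> Ccontinuous_at f z) ->
  (Cmod a < r)%R -> (r < 1)%R ->
  is_CInt (fun t => F (circle r t) * (circle r t / (circle r t - a))) 0 (2 * PI)
    (RtoC (2 * PI) * F a).
Proof.
  intros HF Hf Ha Hr1. assert (HP := PI_RGT_0).
  assert (Hr : (0 < r)%R) by (generalize (Cmod_ge_0 a); lra).
  rewrite Cmult_comm, <- (cauchy_kernel_integral r a Hr Ha).
  replace (cauchy_integral r (circle r) 1 a)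
    with (CInt (fun t => circle r t / (circle r t - a)) 0 (2 * PI))
    by (apply CInt_ext; [lra|intros t _; simpl; unfold Cdiv; ring]).
  rewrite <- (cauchy_homotopy F f a r HF Hf Ha Hr1).
  apply CInt_correct; [lra|]. intros t _.
  apply Ccontinuous_mult; [|ccont; now apply circle_neq].
  apply (Ccontinuous_comp F (circle r)); [apply Ccontinuous_circle|].
  apply (is_Cderive_continuous _ _ (f (circle r t))), HF. unfold unit_disc.
  rewrite Cmod_circle; lra.
Qed.

Lemma two_PI_neq_0 : RtoC (2 * PI) <> 0.
Proof. apply RtoC_neq_0. assert (H := PI_RGT_0). lra. Qed.

Lemma cauchy_representation (F f : C -> C) (r : R) :
  (forall z, unit_disc z -> is_Cderive F z (f z)) ->
  (forall z, unit_disc z -> Ccontinuous_at f z) ->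
  (0 < r < 1)%R ->
  exists c : R -> C, (forall t, Ccontinuous c t) /\
    forall a, (Cmod a < r)%R -> F a = / RtoC (2 * PI) * cauchy_integral r c 1 a.
Proof.
  intros HF Hf Hr. exists (fun t => F (circle r t) * circle r t). split.
  - intros t. apply Ccontinuous_mult; [|apply Ccontinuous_circle].
    apply (Ccontinuous_comp F (circle r)); [apply Ccontinuous_circle|].
    apply (is_Cderive_continuous _ _ (f (circle r t))), HF. unfold unit_disc.
    rewrite Cmod_circle; lra.
  - intros a Ha.
    assert (H := cauchy_formula_C1 F f a r HF Hf Ha (proj2 Hr)).
    replace (cauchy_integral r (fun t => F (circle r t) * circle r t) 1 a)
      with (RtoC (2 * PI) * F a).
    + field. apply two_PI_neq_0.
    + symmetry. apply is_CInt_CInt. revert H. assert (HP := PI_RGT_0).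
      apply is_CInt_ext; [lra|]. intros t _. simpl. unfold Cdiv. ring.
Qed.

Lemma unit_disc_radius (z : C) : unit_disc z -> exists r : R, (0 < r < 1)%R /\ (Cmod z < r)%R.
Proof.
  unfold unit_disc. intros H. assert (P := Cmod_ge_0 z).
  exists ((1 + Cmod z) / 2)%R. lra.
Qed.

Lemma is_Cderive_ext_lt (f g : C -> C) (z l : C) (r : R) :
  (forall w, (Cmod w < r)%R -> f w = g w) -> (Cmod z < r)%R ->
  is_Cderive f z l -> is_Cderive g z l.
Proof.
  intros H Hz. apply (is_Cderive_ext_loc f g z l (r - Cmod z)); [lra|].
  intros w Hw. apply H. assert (T := Cmod_triangle z (w - z)). rewrite Cplus_minus in T. lra.
Qed.

(** Cauchy's formula is available for the primitive [Cint f], whose derivative [f] is continuous. So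
    [f] is a Cauchy integral of exponent 2 and [f'] one of exponent 3, which is again
    differentiable. *)
Theorem analytic_on_derive (f : C -> C) :
  analytic_on unit_disc f -> analytic_on unit_disc (C_derive f).
Proof.
  intros Hf z Hz. destruct (unit_disc_radius z Hz) as [r [Hr Hzr]].
  destruct (cauchy_representation (Cint f) f r) as [c [Hc E]]; [| |exact Hr|].
  { intros w Hw. now apply is_Cderive_Cint. }
  { intros w. now apply analytic_on_continuous. }
  set (k := / RtoC (2 * PI)) in *.
  assert (Hr1 : forall w, (Cmod w < r)%R -> unit_disc w)
    by (intros w Hw; eapply Rlt_trans; [exact Hw|apply Hr]).
  assert (D : forall n m w, (Cmod w < r)%R ->
     is_Cderive (fun a => k * (m * cauchy_integral r c n a)) w
       (k * (m * (INR n * cauchy_integral r c (S n) w)))).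
  { intros n m w Hw. do 2 apply is_Cderive_scal. now apply is_Cderive_cauchy_integral. }
  assert (E1 : forall w, (Cmod w < r)%R -> k * (1 * cauchy_integral r c 2 w) = f w).
  { intros w Hw. apply (is_Cderive_unique (Cint f) w).
    - apply (is_Cderive_ext_lt (fun a => k * (1 * cauchy_integral r c 1 a)) _ _ _ r);
        [|easy|].
      + intros x Hx. rewrite E by easy. ring.
      + eapply is_Cderive_eq; [now apply D|]. simpl. ring.
    - apply is_Cderive_Cint; [easy|now apply Hr1]. }
  assert (E2 : forall w, (Cmod w < r)%R ->
             k * (1 * (INR 2 * cauchy_integral r c 3 w)) = C_derive f w).
  { intros w Hw. symmetry. apply is_C_derive_unique.
    apply (is_Cderive_ext_lt (fun a => k * (1 * cauchy_integral r c 2 a)) _ _ _ r);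
      [easy|easy|]. now apply D. }
  eexists. apply (is_Cderive_ext_lt (fun a => k * (INR 2 * cauchy_integral r c 3 a)) _ _ _ r).
  - intros w Hw. rewrite <- E2 by easy. ring.
  - exact Hzr.
  - now apply D.
Qed.

Theorem cauchy_formula (f : C -> C) (r : R) :
  analytic_on unit_disc f -> (0 < r < 1)%R ->
  exists c : R -> C, (forall t, Ccontinuous c t) /\
    forall a, (Cmod a < r)%R -> f a = / RtoC (2 * PI) * cauchy_integral r c 1 a.
Proof.
  intros Hf. apply (cauchy_representation f (C_derive f)).
  - intros z. now apply analytic_on_C_derive.
  - intros z. now apply analytic_on_continuous, analytic_on_derive.
Qed.

Theorem mean_value (f : C -> C) (r : R) :
  analytic_on unit_disc f -> (0 < r < 1)%R ->
  is_CInt (fun t => f (circle r t)) 0 (2 * PI) (RtoC (2 * PI) * f 0).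
Proof.
  intros Hf Hr. assert (HP := PI_RGT_0).
  generalize (cauchy_formula_C1 f (C_derive f) 0 r).
  intros H. specialize (H (fun z => analytic_on_C_derive _ f z Hf)
    (fun z => analytic_on_continuous _ _ z (analytic_on_derive _ Hf))).
  rewrite Cmod_0 in H. specialize (H (proj1 Hr) (proj2 Hr)). revert H.
  apply is_CInt_ext; [lra|]. intros t _.
  field. intros E. apply (circle_neq r t 0); [rewrite Cmod_0; lra|]. rewrite E. ring.
Qed.

(** Near [0] the quotient is the Cauchy integral with density [c / w], by
    [1 / (w - a) - 1 / w = a / (w (w - a))]; elsewhere it is [f z / z]. The two definitions agree on
    the punctured disc of radius [1 / 2]. *)
Lemma quotient_by_id (f : C -> C) :
  analytic_on unit_disc f -> f 0 = 0 ->
  exists g : C -> C, analytic_on unit_disc g /\ forall z, unit_disc z -> f z = z * g z.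
Proof.
  intros Hf H0. assert (HP := PI_RGT_0).
  destruct (cauchy_formula f (/ 2) Hf ltac:(lra)) as [c [Hc E]].
  set (r := (/ 2)%R) in *.
  assert (Hr : (0 < r < 1)%R) by (unfold r; lra).
  set (k := / RtoC (2 * PI)) in *.
  set (d := fun t => c t * / circle r t).
  assert (Hn : forall t, circle r t <> 0).
  { intros t. apply Cmod_gt_0. rewrite Cmod_circle; lra. }
  assert (Hd : forall t, Ccontinuous d t).
  { intros t. apply Ccontinuous_mult; [apply Hc|].
    apply Ccontinuous_inv; [apply Ccontinuous_circle|apply Hn]. }
  assert (Hcont : forall (e : R -> C) a t, (forall t, Ccontinuous e t) -> (Cmod a < r)%R ->
     Ccontinuous (fun t => e t * (/ (circle r t - a)) ^ 1) t).
  { intros e a t He Ha. apply Ccontinuous_mult; [apply He|].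
    apply Ccontinuous_pow, Ccontinuous_inv; [ccont|]. now apply circle_neq. }
  assert (EG : forall a, (Cmod a < r)%R -> f a = a * (k * cauchy_integral r d 1 a)).
  { intros a Ha.
    assert (Hz : (Cmod 0 < r)%R) by (rewrite Cmod_0; lra).
    replace (f a) with (f a - f 0) by (rewrite H0; ring).
    rewrite (E a Ha), (E 0 Hz).
    replace (k * cauchy_integral r c 1 a - k * cauchy_integral r c 1 0)
      with (k * (cauchy_integral r c 1 a - cauchy_integral r c 1 0)) by ring.
    replace (a * (k * cauchy_integral r d 1 a)) with (k * (a * cauchy_integral r d 1 a)) by ring.
    f_equal.
    rewrite <- (is_CInt_CInt _ _ _ (a * cauchy_integral r d 1 a) (is_CInt_mult_l a _ _ _ _
       (CInt_correct _ 0 (2 * PI) ltac:(lra) (fun t _ => Hcont d a t Hd Ha)))).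
    symmetry. apply is_CInt_CInt.
    assert (Hm := is_CInt_minus _ _ _ _ _ _
      (CInt_correct _ 0 (2 * PI) ltac:(lra) (fun t _ => Hcont c a t Hc Ha))
      (CInt_correct _ 0 (2 * PI) ltac:(lra) (fun t _ => Hcont c 0 t Hc Hz))).
    revert Hm. apply is_CInt_ext; [lra|]. intros t _.
    assert (Hna := circle_neq r t a Ha). unfold d. simpl. rewrite !Cmult_1_r.
    replace (circle r t - 0) with (circle r t) by ring. field. split; [easy|apply Hn]. }
  set (g := fun z => if Ceq_dec z 0 then k * cauchy_integral r d 1 z else f z / z).
  assert (Hg : forall z, (Cmod z < r)%R -> k * cauchy_integral r d 1 z = g z).
  { intros z Hz. unfold g. destruct (Ceq_dec z 0); [easy|].
    rewrite (EG z Hz). field. easy. }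
  exists g. split.
  - intros z Hz. destruct (Ceq_dec z 0) as [->|Hz0].
    + eexists. apply (is_Cderive_ext_lt (fun z => k * cauchy_integral r d 1 z) _ _ _ r).
      * exact Hg.
      * rewrite Cmod_0. lra.
      * apply is_Cderive_scal, is_Cderive_cauchy_integral; [easy|]. rewrite Cmod_0; lra.
    + eexists. apply (is_Cderive_ext_loc (fun z => f z / z) _ _ _ (Cmod z)).
      * now apply Cmod_gt_0.
      * intros w Hw. unfold g. destruct (Ceq_dec w 0) as [->|]; [|easy].
        exfalso. replace (0 - z) with (- z) in Hw by ring. rewrite Cmod_opp in Hw. lra.
      * apply is_Cderive_div; [now apply (analytic_on_C_derive unit_disc)|apply is_Cderive_id|easy].
  - intros z Hz. unfold g. destruct (Ceq_dec z 0) as [->|Hz0].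
    + rewrite H0. ring.
    + field. easy.
Qed.

(** * The maximum principle *)

Lemma analytic_on_comp (f g : C -> C) :
  analytic_on unit_disc f -> analytic_on unit_disc g ->
  (forall z, unit_disc z -> unit_disc (g z)) -> analytic_on unit_disc (fun z => f (g z)).
Proof.
  intros Hf Hg H z Hz. destruct (Hf _ (H z Hz)) as [l Hl]. destruct (Hg z Hz) as [m Hm].
  exists (l * m). now apply is_Cderive_comp.
Qed.

Lemma analytic_on_scal (S : C -> Prop) (k : C) (f : C -> C) :
  analytic_on S f -> analytic_on S (fun z => k * f z).
Proof. intros Hf z Hz. destruct (Hf z Hz) as [l Hl]. eexists. apply is_Cderive_scal, Hl. Qed.

Lemma analytic_on_const (S : C -> Prop) (k : C) : analytic_on S (fun _ => k).
Proof. intros z _. eexists. apply is_Cderive_const. Qed.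

Lemma analytic_on_id (S : C -> Prop) : analytic_on S (fun z => z).
Proof. intros z _. eexists. apply is_Cderive_id. Qed.

Lemma analytic_on_plus (S : C -> Prop) (f g : C -> C) :
  analytic_on S f -> analytic_on S g -> analytic_on S (fun z => f z + g z).
Proof.
  intros Hf Hg z Hz. destruct (Hf z Hz) as [l Hl]. destruct (Hg z Hz) as [m Hm].
  eexists. now apply is_Cderive_plus; [exact Hl|exact Hm].
Qed.

Lemma analytic_on_minus (S : C -> Prop) (f g : C -> C) :
  analytic_on S f -> analytic_on S g -> analytic_on S (fun z => f z - g z).
Proof.
  intros Hf Hg z Hz. destruct (Hf z Hz) as [l Hl]. destruct (Hg z Hz) as [m Hm].
  eexists. now apply is_Cderive_minus; [exact Hl|exact Hm].
Qed.

Lemma analytic_on_mult (S : C -> Prop) (f g : C -> C) :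
  analytic_on S f -> analytic_on S g -> analytic_on S (fun z => f z * g z).
Proof.
  intros Hf Hg z Hz. destruct (Hf z Hz) as [l Hl]. destruct (Hg z Hz) as [m Hm].
  eexists. now apply is_Cderive_mult; [exact Hl|exact Hm].
Qed.

Lemma analytic_on_div (S : C -> Prop) (f g : C -> C) :
  analytic_on S f -> analytic_on S g -> (forall z, S z -> g z <> 0) ->
  analytic_on S (fun z => f z / g z).
Proof.
  intros Hf Hg H z Hz. destruct (Hf z Hz) as [l Hl]. destruct (Hg z Hz) as [m Hm].
  eexists. now apply is_Cderive_div; [exact Hl|exact Hm|apply H].
Qed.

Lemma Cmod_sqr (z : C) : (Cmod z * Cmod z = Re z * Re z + Im z * Im z)%R.
Proof. generalize (Cmod2_alt z). simpl. lra. Qed.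

Lemma Cmod_lt_sqr (z w : C) :
  (Re z * Re z + Im z * Im z < Re w * Re w + Im w * Im w)%R -> (Cmod z < Cmod w)%R.
Proof.
  rewrite <- !Cmod_sqr. intros H. apply Rsqr_incrst_0; try apply Cmod_ge_0. exact H.
Qed.

Lemma Cmod_le_sqr (z w : C) :
  (Re z * Re z + Im z * Im z <= Re w * Re w + Im w * Im w)%R -> (Cmod z <= Cmod w)%R.
Proof.
  rewrite <- !Cmod_sqr. intros H. apply Rsqr_incr_0; try apply Cmod_ge_0. exact H.
Qed.

Lemma Cmod_lt_1_sqr (z : C) : (Cmod z < 1 <-> Re z * Re z + Im z * Im z < 1)%R.
Proof. rewrite <- Cmod_sqr. assert (H := Cmod_ge_0 z). split; intros; nra. Qed.

Lemma Cmod_le_1_sqr (z : C) : (Cmod z <= 1 <-> Re z * Re z + Im z * Im z <= 1)%R.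
Proof. rewrite <- Cmod_sqr. assert (H := Cmod_ge_0 z). split; intros; nra. Qed.

Lemma one_plus_neq_0 (z : C) : (Cmod z < 1)%R -> 1 + z <> 0.
Proof.
  intros H E. replace z with (- (1)) in H by (replace z with (1 + z - 1) by ring; rewrite E; ring).
  rewrite Cmod_opp, Cmod_1 in H. lra.
Qed.

Lemma Cmod_conj_mult_lt (a z : C) : (Cmod a < 1)%R -> (Cmod z <= 1)%R -> (Cmod (Cconj a * z) < 1)%R.
Proof.
  intros Ha Hz. rewrite Cmod_mult, Cmod_conj.
  assert (P1 := Cmod_ge_0 a). nra.
Qed.

Lemma sigma_denom (a z : C) : (Cmod a < 1)%R -> (Cmod z <= 1)%R -> 1 + Cconj a * z <> 0.
Proof. intros Ha Hz. now apply one_plus_neq_0, Cmod_conj_mult_lt. Qed.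

Lemma sigma_mod (a z : C) :
  (Re (z + a) * Re (z + a) + Im (z + a) * Im (z + a) =
   (Re (1 + Cconj a * z) * Re (1 + Cconj a * z) + Im (1 + Cconj a * z) * Im (1 + Cconj a * z))
   - (1 - (Re a * Re a + Im a * Im a)) * (1 - (Re z * Re z + Im z * Im z)))%R.
Proof. destruct a, z; simpl. ring. Qed.

Lemma sigma_lt_1 (a z : C) : (Cmod a < 1)%R -> (Cmod z < 1)%R -> (Cmod (sigma a z) < 1)%R.
Proof.
  intros Ha Hz. assert (Hn := sigma_denom a z Ha (Rlt_le _ _ Hz)).
  unfold sigma. rewrite Cmod_div by easy.
  apply Cmod_gt_0 in Hn. apply Rlt_div_l; [easy|]. rewrite Rmult_1_l.
  apply Cmod_lt_sqr. rewrite sigma_mod.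
  apply Cmod_lt_1_sqr in Ha, Hz. nra.
Qed.

Lemma sigma_le_1 (a z : C) : (Cmod a < 1)%R -> (Cmod z <= 1)%R -> (Cmod (sigma a z) <= 1)%R.
Proof.
  intros Ha Hz. assert (Hn := sigma_denom a z Ha Hz).
  unfold sigma. rewrite Cmod_div by easy.
  apply Cmod_gt_0 in Hn. apply Rle_div_l; [easy|]. rewrite Rmult_1_l.
  apply Cmod_le_sqr. rewrite sigma_mod.
  apply Cmod_lt_1_sqr in Ha. apply Cmod_le_1_sqr in Hz. nra.
Qed.

Lemma one_minus_sqr_neq_0 (a : C) : (Cmod a < 1)%R -> 1 - Cconj a * a <> 0.
Proof.
  intros Ha E. apply (sigma_denom a (- a) Ha).
  - rewrite Cmod_opp. lra.
  - rewrite <- E. ring.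
Qed.

Lemma sigma_sigma_opp (a z : C) :
  (Cmod a < 1)%R -> (Cmod z <= 1)%R -> sigma a (sigma (- a) z) = z.
Proof.
  intros Ha Hz.
  assert (Ha' : (Cmod (- a) < 1)%R) by now rewrite Cmod_opp.
  assert (H1 := sigma_denom (- a) z Ha' Hz).
  assert (H3 := one_minus_sqr_neq_0 a Ha).
  unfold sigma in *. rewrite Copp_conj in *.
  assert (E : 1 + Cconj a * ((z + - a) / (1 + - Cconj a * z))
              = (1 - Cconj a * a) / (1 + - Cconj a * z)) by (field; easy).
  rewrite E. field. repeat split; try easy.
Qed.

Lemma analytic_on_sigma (a : C) : (Cmod a < 1)%R -> analytic_on unit_disc (sigma a).
Proof.
  intros Ha. apply analytic_on_div.
  - apply analytic_on_plus; [apply analytic_on_id|apply analytic_on_const].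
  - apply analytic_on_plus; [apply analytic_on_const|apply analytic_on_scal, analytic_on_id].
  - intros z Hz. apply sigma_denom; [easy|]. now apply Rlt_le.
Qed.

Lemma nonneg_zero_integral (h : R -> R) (a b : R) :
  (a < b)%R -> (forall t, continuous h t) -> (forall t, (0 <= h t)%R) ->
  is_RInt h a b 0%R -> h a = 0%R.
Proof.
  intros Hab Hc Hp Hi. destruct (Req_dec (h a) 0) as [E|E]; [exact E|exfalso].
  assert (Hpos : (0 < h a)%R) by (specialize (Hp a); lra).
  destruct (Hc a _ (locally_ball (h a) (mkposreal _ Hpos))) as [d Hd].
  set (e := Rmin (d / 2) (b - a)).
  assert (He : (0 < e)%R) by (apply Rmin_case; [generalize (cond_pos d)|]; lra).
  assert (Heb : (a + e <= b)%R) by (unfold e; generalize (Rmin_r (d / 2) (b - a)); lra).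
  assert (Hed : (e < d)%R).
  { unfold e. generalize (Rmin_l (d / 2) (b - a)) (cond_pos d). lra. }
  assert (ex : forall u v, ex_RInt h u v).
  { intros u v. apply (ex_RInt_continuous (V := R_CompleteNormedModule)). auto. }
  assert (H1 : (0 < RInt h a (a + e))%R).
  { apply RInt_gt_0; [lra| |auto]. intros x Hx.
    assert (B : ball a d x) by (change (Rabs (x - a) < d)%R; rewrite Rabs_right; lra).
    specialize (Hd x B). change (Rabs (h x - h a) < h a)%R in Hd.
    apply Rabs_def2 in Hd. lra. }
  assert (H2 : (0 <= RInt h (a + e) b)%R) by (apply RInt_ge_0; auto).
  assert (H3 := RInt_Chasles h a (a + e) b (ex _ _) (ex _ _)).
  change (RInt h a (a + e) + RInt h (a + e) b = RInt h a b)%R in H3.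
  rewrite (is_RInt_unique _ _ _ _ Hi) in H3. lra.
Qed.

(** The mean of [Re p] over the circle through [z] is [Re (p 0) = 0], so [Re p] vanishes on it. The
    rotation by [b] puts [z] at parameter [0], the end point where [nonneg_zero_integral] gives the
    value. *)
Lemma Re_zero_at_0 (p : C -> C) :
  analytic_on unit_disc p -> (forall z, unit_disc z -> (0 <= Re (p z))%R) ->
  Re (p 0) = 0%R -> forall z, unit_disc z -> Re (p z) = 0%R.
Proof.
  intros Hp Hpos H0 z Hz. assert (HP := PI_RGT_0).
  destruct (Ceq_dec z 0) as [->|Hz0]; [exact H0|].
  assert (Hm : (0 < Cmod z < 1)%R) by (split; [now apply Cmod_gt_0|exact Hz]).
  set (b := z / Cmod z).
  assert (Hb : Cmod b = 1%R).
  { unfold b. rewrite Cmod_div by (apply RtoC_neq_0; lra).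
    rewrite Cmod_R, Rabs_right by lra. field. lra. }
  assert (Hbz : forall w, unit_disc w -> unit_disc (b * w)).
  { intros w Hw. unfold unit_disc. now rewrite Cmod_mult, Hb, Rmult_1_l. }
  assert (Hq : analytic_on unit_disc (fun w => p (b * w))).
  { apply (analytic_on_comp p (fun w => b * w)); try easy. apply analytic_on_scal, analytic_on_id. }
  assert (Hcirc : forall t, unit_disc (circle (Cmod z) t)).
  { intros t. unfold unit_disc. rewrite Cmod_circle; lra. }
  assert (Hi := is_CInt_Re _ _ _ _ (mean_value _ (Cmod z) Hq Hm)).
  cbv beta in Hi. rewrite re_scal_l, Cmult_0_r, H0, Rmult_0_r in Hi.
  assert (E := nonneg_zero_integral _ 0 (2 * PI) ltac:(lra)
    (fun t => Ccontinuous_Re _ t (Ccontinuous_comp (fun w => p (b * w)) (circle (Cmod z)) t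
       (Ccontinuous_circle _ t) (analytic_on_continuous _ _ _ Hq (Hcirc t))))
    (fun t => Hpos _ (Hbz _ (Hcirc t))) Hi).
  cbv beta in E. rewrite <- E. f_equal. f_equal.
  unfold circle. rewrite cos_0, sin_0.
  change (1%R, 0%R) with (RtoC 1). unfold b. field. apply RtoC_neq_0; lra.
Qed.

(** The automorphism [sigma a] carries the zero of [Re p] from [a] to the centre. *)
Theorem Re_zero_principle (p : C -> C) (a : C) :
  analytic_on unit_disc p -> (forall z, unit_disc z -> (0 <= Re (p z))%R) ->
  unit_disc a -> Re (p a) = 0%R -> forall z, unit_disc z -> Re (p z) = 0%R.
Proof.
  intros Hp Hpos Ha H0 z Hz.
  assert (Hs : forall w, unit_disc w -> unit_disc (sigma a w)) by (intros; now apply sigma_lt_1).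
  assert (Ha' : (Cmod (- a) < 1)%R) by now rewrite Cmod_opp.
  rewrite <- (sigma_sigma_opp a z Ha (Rlt_le _ _ Hz)).
  apply (Re_zero_at_0 (fun w => p (sigma a w))).
  - apply analytic_on_comp; [easy|now apply analytic_on_sigma|easy].
  - intros w Hw. now apply Hpos, Hs.
  - replace (sigma a 0) with a; [exact H0|].
    unfold sigma. rewrite Cmult_0_r, Cplus_0_r, Cplus_0_l. field.
  - now apply sigma_lt_1.
Qed.

(** * Compactness and Jack's lemma *)

Definition closed_set (S : C -> Prop) : Prop :=
  forall z, ~ S z -> exists d : R, (0 < d)%R /\ forall w, (Cmod (w - z) < d)%R -> ~ S w.

Lemma Cmod_le_Rabs (z : C) : (Cmod z <= Rabs (Re z) + Rabs (Im z))%R.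
Proof.
  apply Rsqr_incr_0_var.
  - unfold Rsqr. rewrite Cmod_sqr.
    assert (H1 := Rabs_pos (Re z)). assert (H2 := Rabs_pos (Im z)).
    assert (E1 : (Rabs (Re z) * Rabs (Re z) = Re z * Re z)%R)
      by (rewrite <- Rabs_mult; apply Rabs_right; nra).
    assert (E2 : (Rabs (Im z) * Rabs (Im z) = Im z * Im z)%R)
      by (rewrite <- Rabs_mult; apply Rabs_right; nra).
    nra.
  - generalize (Rabs_pos (Re z)) (Rabs_pos (Im z)). lra.
Qed.

Lemma Cmod_components (z : C) : (Rabs (Re z) <= Cmod z /\ Rabs (Im z) <= Cmod z)%R.
Proof.
  assert (H := Rmax_Cmod z). split; eapply Rle_trans; [|exact H| |exact H].
  - apply Rmax_l. - apply Rmax_r.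
Qed.

(* [compactness_value_2d] gives a uniform radius [d]; choosing radii below the reciprocal of
   the local bounds turns [d] into a global bound. *)
Lemma locally_bounded_bounded (S : C -> Prop) (f : C -> R) (r : R) :
  (forall z, S z -> closed_disc r z) ->
  (forall z, exists d B : R, (0 < d)%R /\ forall w, (Cmod (w - z) < d)%R -> S w -> (f w <= B)%R) ->
  exists B : R, forall z, S z -> (f z <= B)%R.
Proof.
  intros HS H.
  assert (Hd : forall z, { d : posreal | forall w, (Cmod (w - z) < 2 * d)%R -> S w -> (f w <= / d)%R }).
  { intros z. apply constructive_indefinite_description.
    destruct (H z) as [d [B [Hd HB]]].
    assert (HB1 : (0 < / (Rabs B + 1))%R)
      by (apply Rinv_0_lt_compat; generalize (Rabs_pos B); lra).
    assert (Hm : (0 < Rmin (d / 2) (/ (Rabs B + 1)))%R) by (apply Rmin_case; lra).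
    exists (mkposreal _ Hm). simpl. intros w Hw Sw.
    apply Rle_trans with (Rabs B + 1)%R.
    - eapply Rle_trans; [apply HB; [|exact Sw]|generalize (Rle_abs B); lra].
      generalize (Rmin_l (d / 2) (/ (Rabs B + 1))). lra.
    - rewrite <- (Rinv_inv (Rabs B + 1)) at 1. apply Rinv_le_contravar; [easy|apply Rmin_r]. }
  destruct (compactness_value_2d (- r) r (- r) r (fun x y => proj1_sig (Hd (x, y)))) as [d D].
  exists (/ d)%R. intros z Hz. apply Rnot_lt_le. intros Hlt.
  assert (Hr := HS z Hz). unfold closed_disc in Hr.
  destruct (Cmod_components z) as [C1 C2].
  apply (D (Re z) (Im z)).
  - split; [generalize (Rabs_maj2 (Re z))|generalize (Rle_abs (Re z))]; lra.
  - split; [generalize (Rabs_maj2 (Im z))|generalize (Rle_abs (Im z))]; lra.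
  - intros [u [v [_ [_ [H1 [H2 H3]]]]]].
    destruct (Hd (u, v)) as [e He]; simpl in H1, H2, H3.
    assert (Hz1 : (f z <= / e)%R).
    { apply He; [|exact Hz]. eapply Rle_lt_trans; [apply Cmod_le_Rabs|].
      change (Rabs (Re z - u) + Rabs (Im z - v) < 2 * e)%R. lra. }
    assert (/ e <= / d)%R by (apply Rinv_le_contravar; [apply cond_pos|exact H3]).
    lra.
Qed.

Lemma continuous_near (f : C -> R) (z : C) (eps : R) :
  continuous (T := C_UniformSpace) f z -> (0 < eps)%R ->
  exists d : R, (0 < d)%R /\ forall w, (Cmod (w - z) < d)%R -> (Rabs (f w - f z) < eps)%R.
Proof.
  intros Hf He. apply locally_Cmod.
  exact (Hf _ (locally_ball (f z) (mkposreal eps He))).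
Qed.

(** If the supremum [m] were not attained, [1 / (m - f)] would be locally bounded, hence bounded by
    some [K], and [m - 1 / K] would be a smaller upper bound. *)
Theorem extreme_value (S : C -> Prop) (f : C -> R) (r : R) :
  closed_set S -> (forall z, S z -> closed_disc r z) -> (exists z, S z) ->
  (forall z, S z -> continuous (T := C_UniformSpace) f z) ->
  exists m, S m /\ forall z, S z -> (f z <= f m)%R.
Proof.
  intros Hcl HS [z0 Hz0] Hf.
  assert (out : forall z (g : C -> R), ~ S z ->
    exists d B : R, (0 < d)%R /\ forall w, (Cmod (w - z) < d)%R -> S w -> (g w <= B)%R).
  { intros z g Hz. destruct (Hcl z Hz) as [d [Hd H]]. exists d, 0%R. split; [easy|].
    intros w Hw Sw. destruct (H w Hw Sw). }
  destruct (locally_bounded_bounded S f r HS) as [B HB].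
  { intros z. destruct (classic (S z)) as [Hz|Hz]; [|now apply out].
    destruct (continuous_near f z 1 (Hf z Hz) Rlt_0_1) as [d [Hd H]].
    exists d, (f z + 1)%R. split; [easy|]. intros w Hw _.
    specialize (H w Hw). apply Rabs_def2 in H. lra. }
  destruct (completeness (fun x => exists z, S z /\ x = f z)) as [m [Hm1 Hm2]].
  { exists B. intros x [z [Hz ->]]. now apply HB. }
  { exists (f z0), z0. auto. }
  assert (Hle : forall z, S z -> (f z <= m)%R) by (intros z Hz; apply Hm1; eauto).
  destruct (classic (exists z, S z /\ f z = m)) as [[z [Hz E]]|Hno].
  { exists z. split; [easy|]. rewrite E. exact Hle. }
  exfalso.
  assert (Hlt : forall z, S z -> (f z < m)%R).
  { intros z Hz. destruct (Rle_lt_or_eq_dec _ _ (Hle z Hz)) as [L|E]; [easy|].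
    destruct Hno. eauto. }
  destruct (locally_bounded_bounded S (fun z => / (m - f z))%R r HS) as [K HK].
  { intros z. destruct (classic (S z)) as [Hz|Hz]; [|now apply out].
    specialize (Hlt z Hz).
    destruct (continuous_near f z ((m - f z) / 2) (Hf z Hz) ltac:(lra)) as [d [Hd H]].
    exists d, (/ ((m - f z) / 2))%R. split; [easy|]. intros w Hw Sw.
    specialize (H w Hw). apply Rabs_def2 in H. apply Rinv_le_contravar; lra. }
  assert (HK0 : (0 < K)%R).
  { eapply Rlt_le_trans; [|exact (HK z0 Hz0)]. apply Rinv_0_lt_compat. specialize (Hlt z0 Hz0). lra. }
  assert (Hub : (m <= m - / K)%R).
  { apply Hm2. intros x [z [Hz ->]]. specialize (HK z Hz). specialize (Hlt z Hz).
    apply Rinv_le_contravar in HK; [|apply Rinv_0_lt_compat; lra].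
    rewrite Rinv_inv in HK. lra. }
  assert (0 < / K)%R by now apply Rinv_0_lt_compat. lra.
Qed.

Lemma closed_set_closed_disc (r : R) : closed_set (closed_disc r).
Proof.
  intros z Hz. apply Rnot_le_lt in Hz. exists (Cmod z - r)%R. split; [lra|].
  intros w Hw Hr. unfold closed_disc in Hr.
  assert (T := Cmod_triangle w (z - w)). rewrite Cplus_minus in T.
  replace (z - w) with (- (w - z)) in T by ring. rewrite Cmod_opp in T. lra.
Qed.

Lemma continuous_Re_analytic (p : C -> C) (z : C) :
  analytic_on unit_disc p -> unit_disc z -> continuous (T := C_UniformSpace) (fun w => Re (p w)) z.
Proof.
  intros Hp Hz. apply (Ccontinuous_Re (T := C_UniformSpace) p).
  now apply (analytic_on_continuous unit_disc).
Qed.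

Lemma derive_left_nonpos (h : R -> R) (l : R) :
  is_derive h 1%R l -> (forall t, (0 < t < 1)%R -> (h 1 <= h t)%R) -> (l <= 0)%R.
Proof.
  intros Hd Hm. apply Rnot_lt_le. intros Hl.
  apply is_derive_Reals in Hd.
  destruct (Hd (l / 2)%R ltac:(lra)) as [d D].
  set (e := Rmin (d / 2) (/ 2)).
  assert (He : (0 < e)%R) by (apply Rmin_case; [generalize (cond_pos d)|]; lra).
  assert (He2 : (e <= / 2)%R) by apply Rmin_r.
  assert (Hed : (e < d)%R).
  { unfold e. generalize (Rmin_l (d / 2) (/ 2)) (cond_pos d). lra. }
  specialize (D (- e)%R ltac:(lra)). rewrite Rabs_Ropp, (Rabs_right e) in D by lra.
  specialize (D Hed). apply Rabs_def2 in D.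
  specialize (Hm (1 + - e)%R ltac:(lra)).
  assert (Hq : ((h (1 + - e) - h 1) / - e <= 0)%R).
  { replace ((h (1 + - e) - h 1) / - e)%R with (- ((h (1 + - e) - h 1) * / e))%R by (field; lra).
    assert (0 <= (h (1 + - e) - h 1) * / e)%R; [|lra].
    apply Rmult_le_pos; [lra|]. apply Rlt_le, Rinv_0_lt_compat. lra. }
  lra.
Qed.

Lemma derive_min_zero (h : R -> R) (x l : R) :
  is_derive h x l -> (forall t, (h x <= h t)%R) -> l = 0%R.
Proof.
  intros Hd Hm. apply is_derive_Reals in Hd.
  assert (pr : derivable_pt h x) by (exists l; exact Hd).
  rewrite <- (derive_pt_eq_0 h x l pr Hd).
  apply (deriv_minimum h (x - 1) (x + 1) x pr); try lra. intros; apply Hm.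
Qed.

Lemma circle_0 (r : R) : circle r 0 = r.
Proof.
  unfold circle.
  rewrite cos_0, sin_0. change (1%R, 0%R) with (RtoC 1). ring.
Qed.

(* Jack's lemma: the hypothesis excludes a zero of [Re p] of minimal modulus. *)
Lemma jack (p : C -> C) :
  analytic_on unit_disc p -> (0 < Re (p 0))%R ->
  (forall z, unit_disc z -> Re (p z) = 0%R -> Im (z * C_derive p z) = 0%R ->
     (Re (z * C_derive p z) <= 0)%R -> False) ->
  forall z, unit_disc z -> (0 < Re (p z))%R.
Proof.
  intros Hp H0 Hno z Hz. apply Rnot_le_lt. intros Hle.
  set (S := fun w => closed_disc (Cmod z) w /\ (Re (p w) <= 0)%R).
  assert (HSd : forall w, S w -> unit_disc w).
  { intros w [Hw _]. eapply Rle_lt_trans; [exact Hw|exact Hz]. }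
  destruct (extreme_value S (fun w => - Cmod w)%R (Cmod z)) as [m [[Hm1 Hm2] Hmin]].
  - intros w Hw. destruct (classic (closed_disc (Cmod z) w)) as [Hd|Hd].
    + assert (Hpos : (0 < Re (p w))%R).
      { apply Rnot_le_lt. intros Hc. now apply Hw. }
      assert (Hud : unit_disc w) by (eapply Rle_lt_trans; [exact Hd|exact Hz]).
      destruct (continuous_near _ w (Re (p w)) (continuous_Re_analytic p w Hp Hud) Hpos)
        as [d [Hd0 Hd1]].
      exists d. split; [easy|]. intros v Hv [_ Hv2]. specialize (Hd1 v Hv).
      apply Rabs_def2 in Hd1. lra.
    + destruct (closed_set_closed_disc _ _ Hd) as [d [Hd0 Hd1]].
      exists d. split; [easy|]. intros v Hv [Hv1 _]. now apply (Hd1 v).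
  - now intros w [Hw _].
  - exists z. split; [apply Rle_refl|easy].
  - intros w _. apply (continuous_opp (V := R_NormedModule)).
    apply (continuous_Cmod (T := C_UniformSpace) (fun w => w)), continuous_id.
  - assert (Hmd : unit_disc m) by (apply HSd; now split).
    assert (Hm0 : m <> 0).
    { intros E. rewrite E in Hm2. lra. }
    assert (HCm := proj1 (Cmod_gt_0 m) Hm0).
    assert (Hin : forall w, (Cmod w < Cmod m)%R -> (0 < Re (p w))%R).
    { intros w Hw. apply Rnot_le_lt. intros Hc.
      assert (Sw : S w) by (split; [unfold closed_disc in *; lra|easy]).
      specialize (Hmin w Sw). lra. }
    assert (Hd := analytic_on_C_derive unit_disc p m Hp Hmd).
    set (l := C_derive p m) in *.
    assert (Hdr : is_derive (fun t : R => Re (p (0 + t * m))) 1%R (Re (l * m))).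
    { apply is_path_derive_Re.
      apply (is_path_derive_comp p (fun t : R => 0 + t * m)); [|apply is_path_derive_affine].
      now replace (0 + 1%R * m) with m by ring. }
    assert (Ht : forall t : R, (0 < t < 1)%R -> (0 < Re (p (0 + t * m)%C))%R).
    { intros t Ht. apply Hin. rewrite Cplus_0_l, Cmod_mult, Cmod_R, Rabs_right by lra. nra. }
    (* A negative value on the circle would persist, by continuity, at a slightly smaller radius,
       where [Re p] is positive. *)
    assert (Hcirc : forall w, Cmod w = Cmod m -> (0 <= Re (p w))%R).
    { intros w Hw. apply Rnot_lt_le. intros Hneg.
      assert (Hwd : unit_disc w) by (unfold unit_disc; rewrite Hw; exact Hmd).
      destruct (continuous_near _ w (- Re (p w)) (continuous_Re_analytic p w Hp Hwd) ltac:(lra))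
        as [d [Hd0 Hd1]].
      set (e := Rmin (d / 2) (Cmod m / 2)).
      assert (He : (0 < e)%R) by (apply Rmin_case; lra).
      assert (He1 : (e <= Cmod m / 2)%R) by apply Rmin_r.
      assert (He2 : (e <= d / 2)%R) by apply Rmin_l.
      assert (Hem : (0 < e / Cmod m <= / 2)%R).
      { split; [now apply Rdiv_lt_0_compat|]. apply Rle_div_l; lra. }
      set (v := (1 - e / Cmod m)%R * w).
      assert (Hv : (Cmod v < Cmod m)%R).
      { unfold v. rewrite Cmod_mult, Cmod_R, Rabs_right, Hw by lra. nra. }
      specialize (Hin v Hv). specialize (Hd1 v).
      assert (Hdist : (Cmod (v - w) < d)%R).
      { replace (v - w) with (- ((e / Cmod m)%R * w)) by (unfold v; rewrite RtoC_minus; ring).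
        rewrite Cmod_opp, Cmod_mult, Cmod_R, Rabs_right, Hw by lra.
        replace (e / Cmod m * Cmod m)%R with e by (field; lra). lra. }
      specialize (Hd1 Hdist). apply Rabs_def2 in Hd1. lra. }
    assert (Hz0 : Re (p m) = 0%R) by (apply Rle_antisym; [exact Hm2|now apply Hcirc]).
    assert (Ec : circle 1 0 * m = m).
    { rewrite circle_0. ring. }
    apply (Hno m Hmd Hz0).
    (* Along the circle [Re p] is minimal at [m], so its tangential derivative, which is
       [- Im (m p')], vanishes. *)
    + assert (Hda : is_derive (fun t : R => Re (p (circle 1 t * m))) 0%R (Re (l * (Ci * m)))).
      { apply is_path_derive_Re.
        apply (is_path_derive_comp p (fun t : R => circle 1 t * m)); [now rewrite Ec|].
        assert (H1 := is_path_derive_comp (fun w => m * w) (circle 1) 0%R _ _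
          (is_Cderive_scal m _ _ _ (is_Cderive_id _)) (is_path_derive_circle 1 0)).
        refine (is_derive_ext (K := R_AbsRing) (V := C_R_NormedModule) _ _ _ _ _
          (is_path_derive_eq _ _ _ _ H1 _)); [intros; apply Cmult_comm|].
        transitivity (Ci * (circle 1 0 * m)); [ring|now rewrite Ec]. }
      assert (E : Re (l * (Ci * m)) = 0%R).
      { apply (derive_min_zero _ _ _ Hda). intros t. rewrite Ec, Hz0.
        apply Hcirc. rewrite Cmod_mult, Cmod_circle; lra. }
      rewrite re_mult, re_mult, im_mult in E. rewrite im_mult.
      change (Re Ci) with 0%R in E. change (Im Ci) with 1%R in E. fold l. lra.
    (* Along the radius [Re p] is positive before [m] and zero at [m], so the radial derivative is
       not positive. *)
    + rewrite Cmult_comm. apply (derive_left_nonpos _ _ Hdr).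
      intros t Htt. replace (0 + 1%R * m) with m by ring. rewrite Hz0.
      now apply Rlt_le, Ht.
Qed.

(** * Schwarz's lemma and branches of the logarithm *)

Lemma Cmod_1_Re_1 (z : C) : (Cmod z <= 1)%R -> Re z = 1%R -> z = 1.
Proof.
  intros H1 H2. apply Cmod_le_1_sqr in H1.
  assert (Im z = 0%R) by nra.
  destruct z as [x y]; simpl in *; subst. reflexivity.
Qed.

Lemma Re_le_Cmod (z : C) : (Re z <= Cmod z)%R.
Proof. eapply Rle_trans; [apply Rle_abs|apply re_le_Cmod]. Qed.

Lemma Cconj_mult_Cmod (z : C) : Cconj z * z = RtoC (Cmod z * Cmod z).
Proof. rewrite Cmod_sqr. destruct z; unfold Cconj, Cmult, RtoC; simpl. f_equal; ring. Qed.

(** After multiplication by the conjugate of [phi 0] the value at the centre is [1], and [1] minus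
    the product has nonnegative real part vanishing there. *)
Lemma unimodular_center (phi : C -> C) :
  analytic_on unit_disc phi -> (forall z, unit_disc z -> (Cmod (phi z) <= 1)%R) ->
  Cmod (phi 0) = 1%R -> forall z, unit_disc z -> phi z = phi 0.
Proof.
  intros Hp Hle H1 z Hz.
  assert (Hb : forall z, unit_disc z -> (Cmod (Cconj (phi 0) * phi z) <= 1)%R).
  { intros w Hw. rewrite Cmod_mult, Cmod_conj, H1, Rmult_1_l. now apply Hle. }
  assert (E0 : Cconj (phi 0) * phi 0 = 1) by (rewrite Cconj_mult_Cmod, H1, Rmult_1_r; easy).
  assert (E : Re (1 - Cconj (phi 0) * phi z) = 0%R).
  { apply (Re_zero_at_0 (fun z => 1 - Cconj (phi 0) * phi z)).
    - apply analytic_on_minus; [apply analytic_on_const|now apply analytic_on_scal].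
    - intros w Hw. assert (H := Re_le_Cmod (Cconj (phi 0) * phi w)). specialize (Hb w Hw).
      change (0 <= 1 - Re (Cconj (phi 0) * phi w))%R. lra.
    - rewrite E0. simpl. ring.
    - exact Hz. }
  change (1 - Re (Cconj (phi 0) * phi z) = 0)%R in E.
  assert (E1 : Cconj (phi 0) * phi z = 1) by (apply Cmod_1_Re_1; [now apply Hb|lra]).
  transitivity (phi 0 * (Cconj (phi 0) * phi z)).
  - transitivity (Cconj (phi 0) * phi 0 * phi z); [rewrite E0|]; ring.
  - rewrite E1. ring.
Qed.

(* On circles of radius [t -> 1] the automorphism [sigma a] has modulus close to [1], so the
   mean value property of [phi o sigma a] bounds [phi a]. *)
Theorem schwarz (omega : C -> C) :
  analytic_on unit_disc omega -> (forall z, unit_disc z -> (Cmod (omega z) <= 1)%R) ->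
  omega 0 = 0 ->
  exists phi : C -> C, analytic_on unit_disc phi /\
    (forall z, unit_disc z -> omega z = z * phi z) /\
    (forall z, unit_disc z -> (Cmod (phi z) <= 1)%R).
Proof.
  intros Ho Hle H0. destruct (quotient_by_id omega Ho H0) as [phi [Hp E]].
  exists phi. split; [easy|]. split; [easy|]. intros a Ha.
  apply Rnot_lt_le. intros Hgt. unfold unit_disc in Ha.
  set (K := Cmod (phi a)) in *.
  (* Here [1 / K < s < 1], and [t] is such that [1 - t^2 <= u = d^2 (1 - s^2)]. On [|w| = t] one has
     [1 - |sigma a w|^2 = (1 - |a|^2) (1 - t^2) / |1 + conj a w|^2] with denominator at least [d^2].
     Hence [|sigma a w| >= s], and [|phi (sigma a w)| <= 1 / s < K]. *)
  set (s := ((1 + / K) / 2)%R).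
  assert (HK : (0 < / K < 1)%R).
  { split; [apply Rinv_0_lt_compat; lra|]. rewrite <- Rinv_1. apply Rinv_lt_contravar; lra. }
  assert (Hs : (/ K < s < 1)%R) by (unfold s; lra).
  assert (HsK : (/ s < K)%R).
  { rewrite <- (Rinv_inv K). apply Rinv_lt_contravar; [apply Rmult_lt_0_compat|]; lra. }
  set (d := (1 - Cmod a)%R).
  assert (Hd : (0 < d <= 1)%R) by (unfold d; generalize (Cmod_ge_0 a); lra).
  assert (Hdd : (0 < d * d <= 1)%R) by nra.
  assert (Hss : (0 < 1 - s * s < 1)%R) by nra.
  set (u := (d * d * (1 - s * s))%R).
  assert (Hu : (0 < u < 1)%R) by (unfold u; split; [apply Rmult_lt_0_compat|]; nra).
  set (t := (1 - u / 2)%R).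
  assert (Ht : (0 < t < 1)%R) by (unfold t; lra).
  assert (Htt : (1 - t * t <= u)%R) by (unfold t; nra).
  assert (Hg : analytic_on unit_disc (fun z => phi (sigma a z))).
  { apply analytic_on_comp; [easy|now apply analytic_on_sigma|]. intros; now apply sigma_lt_1. }
  assert (HP := PI_RGT_0).
  assert (Hi := mean_value _ t Hg Ht). cbv beta in Hi.
  replace (sigma a 0) with a in Hi by (unfold sigma; rewrite Cmult_0_r, Cplus_0_r, Cplus_0_l; field).
  apply (is_CInt_bound _ 0 (2 * PI) _ (/ s)) in Hi; [|lra|].
  { rewrite Cmod_mult, Cmod_R, Rabs_right in Hi by lra. fold K in Hi.
    assert (K <= / s)%R; [|lra]. apply (Rmult_le_reg_l (2 * PI)); lra. }
  intros x _. set (w := circle t x).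
  assert (Hw : Cmod w = t) by (apply Cmod_circle; lra).
  assert (Hwd : (Cmod w < 1)%R) by lra.
  assert (Hn := sigma_denom a w Ha (Rlt_le _ _ Hwd)).
  assert (Hsig : (s <= Cmod (sigma a w))%R).
  { unfold sigma. rewrite Cmod_div by easy.
    assert (Hm : (d <= Cmod (1 + Cconj a * w))%R).
    { assert (T := Cmod_triangle (1 + Cconj a * w) (- (Cconj a * w))).
      replace (1 + Cconj a * w + - (Cconj a * w)) with (RtoC 1) in T by ring.
      rewrite Cmod_opp, Cmod_1, (Cmod_mult (Cconj a)), Cmod_conj, Hw in T.
      assert (P := Cmod_ge_0 a). unfold d. nra. }
    assert (Q := sigma_mod a w). rewrite <- !Cmod_sqr, Hw in Q.
    set (m := Cmod (1 + Cconj a * w)) in *.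
    apply (proj1 (Rle_div_r s (Cmod (w + a)) m ltac:(lra))).
    apply Rsqr_incr_0_var; [|apply Cmod_ge_0].
    unfold Rsqr. rewrite Q. assert (P := Cmod_ge_0 a).
    assert ((1 - Cmod a * Cmod a) * (1 - t * t) <= m * m * (1 - s * s))%R; [|lra].
    apply Rle_trans with (1 * (1 - t * t))%R; [apply Rmult_le_compat_r; nra|rewrite Rmult_1_l].
    apply (Rle_trans _ _ _ Htt), Rmult_le_compat_r; [lra|nra]. }
  assert (Hb := Hle (sigma a w) (sigma_lt_1 a w Ha Hwd)).
  rewrite E, Cmod_mult in Hb by now apply sigma_lt_1.
  apply (Rmult_le_reg_l s); [lra|]. rewrite Rinv_r by lra.
  eapply Rle_trans; [|exact Hb]. apply Rmult_le_compat_r; [apply Cmod_ge_0|easy].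
Qed.

(** * The complex exponential and branches of the logarithm *)

Lemma Cexp_0 : Cexp 0 = 1.
Proof. unfold Cexp; simpl. rewrite exp_0, cos_0, sin_0. unfold RtoC. f_equal; ring. Qed.

Lemma Cexp_plus (z w : C) : Cexp (z + w) = Cexp z * Cexp w.
Proof.
  destruct z as [x y], w as [u v]. unfold Cexp, Cmult; simpl.
  rewrite exp_plus, cos_plus, sin_plus. f_equal; ring.
Qed.

Lemma Cexp_neq_0 (z : C) : Cexp z <> 0.
Proof.
  intros E. apply C1_nz. rewrite <- Cexp_0. replace (RtoC 0) with (z + - z) by ring.
  rewrite Cexp_plus, E. ring.
Qed.

Lemma derive_bound_0 (f : R -> R) (l : R) (eps : R) :
  is_derive f 0%R l -> (0 < eps)%R ->
  exists d : R, (0 < d)%R /\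
    forall x, (Rabs x < d)%R -> (Rabs (f x - f 0 - l * x) <= eps * Rabs x)%R.
Proof.
  intros H He. apply is_derive_Reals in H. destruct (H eps He) as [d Hd].
  exists d. split; [apply cond_pos|]. intros x Hx.
  destruct (Req_dec x 0) as [->|Hx0].
  - replace (f 0 - f 0 - l * 0)%R with 0%R by ring. rewrite Rabs_R0. lra.
  - specialize (Hd x Hx0 Hx). rewrite Rplus_0_l in Hd.
    replace (f x - f 0 - l * x)%R with (((f x - f 0) / x - l) * x)%R by (field; easy).
    rewrite Rabs_mult. apply Rmult_le_compat_r; [apply Rabs_pos|]. lra.
Qed.

(** At [0] the first order expansions of [exp], [cos] and [sin] are combined; the addition formula
    transports the result to [z]. *)
Lemma is_Cderive_Cexp (z : C) : is_Cderive Cexp z (Cexp z).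
Proof.
  assert (H0 : is_Cderive Cexp (RtoC 0) (RtoC 1)).
  { apply is_Cderive_iff. intros eps0 He0.
    (* The two components have errors at most [4 eps m] and [5 eps m], and [9 / 12 < 1]. The cap [1]
       on [eps0] serves the bound [2 m] for [exp x - 1]. *)
    set (eps := (Rmin 1 eps0 / 12)%R).
    assert (He : (0 < eps <= / 12 /\ eps <= eps0 / 12)%R).
    { unfold eps. generalize (Rmin_l 1 eps0) (Rmin_r 1 eps0). intros.
      assert (0 < Rmin 1 eps0)%R by (apply Rmin_case; lra). lra. }
    destruct He as [[He1 He2] He3].
    destruct (derive_bound_0 exp 1%R eps) as [d1 [Hd1 H1]].
    { generalize (is_derive_exp 0). now rewrite exp_0. } { easy. }
    destruct (derive_bound_0 cos 0%R eps) as [d2 [Hd2 H2]].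
    { generalize (is_derive_cos 0). now rewrite sin_0, Ropp_0. } { easy. }
    destruct (derive_bound_0 sin 1%R eps) as [d3 [Hd3 H3]].
    { generalize (is_derive_sin 0). now rewrite cos_0. } { easy. }
    set (d := Rmin (Rmin 1 eps) (Rmin d1 (Rmin d2 d3))).
    exists d. split; [unfold d; repeat apply Rmin_case; lra|].
    intros [x y] Hh.
    destruct (Cmod_components (x, y)) as [Cx Cy]. simpl in Cx, Cy.
    unfold d in Hh. apply Rmin_Rgt_l in Hh. destruct Hh as [Hh Hh'].
    apply Rmin_Rgt_l in Hh. destruct Hh as [Hh1 Hhe].
    apply Rmin_Rgt_l in Hh'. destruct Hh' as [Hhd1 Hh'].
    apply Rmin_Rgt_l in Hh'. destruct Hh' as [Hhd2 Hhd3].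
    set (m := Cmod (x, y)) in *.
    specialize (H1 x ltac:(lra)). specialize (H2 y ltac:(lra)). specialize (H3 y ltac:(lra)).
    rewrite exp_0 in H1. rewrite cos_0 in H2. rewrite sin_0 in H3.
    rewrite Cexp_0, Cplus_0_l. assert (Py := Rabs_pos y).
    assert (X1 : (Rabs (exp x - 1 - 1 * x) <= eps * m)%R)
      by (eapply Rle_trans; [exact H1|]; apply Rmult_le_compat_l; lra).
    assert (X2 : (Rabs (cos y - 1 - 0 * y) <= eps * m)%R)
      by (eapply Rle_trans; [exact H2|]; apply Rmult_le_compat_l; lra).
    assert (X3 : (Rabs (sin y - 0 - 1 * y) <= eps * m)%R)
      by (eapply Rle_trans; [exact H3|]; apply Rmult_le_compat_l; lra).
    assert (Y1 : (Rabs (exp x - 1) <= 2 * m)%R).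
    { replace (exp x - 1)%R with ((exp x - 1 - 1 * x) + x)%R by ring.
      eapply Rle_trans; [apply Rabs_triang|]. nra. }
    assert (Y2 : (Rabs (exp x) <= 3)%R).
    { replace (exp x) with ((exp x - 1) + 1)%R by ring.
      eapply Rle_trans; [apply Rabs_triang|]. rewrite (Rabs_right 1) by lra. lra. }
    eapply Rle_trans; [apply Cmod_le_Rabs|]. simpl.
    assert (Z1 : (Rabs (exp x * cos y - 1 - x) <= 4 * eps * m)%R).
    { replace (exp x * cos y - 1 - x)%R
        with ((exp x - 1 - 1 * x) + exp x * (cos y - 1 - 0 * y))%R by ring.
      eapply Rle_trans; [apply Rabs_triang|]. rewrite Rabs_mult.
      assert (Rabs (exp x) * Rabs (cos y - 1 - 0 * y) <= 3 * (eps * m))%R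
        by (apply Rmult_le_compat; auto using Rabs_pos). lra. }
    assert (Z2 : (Rabs (exp x * sin y - y) <= 5 * eps * m)%R).
    { replace (exp x * sin y - y)%R
        with (exp x * (sin y - 0 - 1 * y) + (exp x - 1) * y)%R by ring.
      eapply Rle_trans; [apply Rabs_triang|]. rewrite !Rabs_mult.
      assert (Rabs (exp x) * Rabs (sin y - 0 - 1 * y) <= 3 * (eps * m))%R
        by (apply Rmult_le_compat; auto using Rabs_pos).
      assert (Rabs (exp x - 1) * Rabs y <= 2 * m * eps)%R
        by (apply Rmult_le_compat; auto using Rabs_pos; lra). lra. }
    replace (exp x * cos y + - (1) + - (1 * x - 0 * y))%R with (exp x * cos y - 1 - x)%R by ring.
    replace (exp x * sin y + - 0 + - (1 * y + 0 * x))%R with (exp x * sin y - y)%R by ring.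
    assert (eps * m <= eps0 / 12 * m)%R by (apply Rmult_le_compat_r; lra).
    assert (0 <= eps0 * m)%R by (apply Rmult_le_pos; lra). lra. }
  assert (Hs : is_Cderive (fun w => - z + 1 * w) z (RtoC 1)) by apply is_Cderive_affine.
  assert (H : is_Cderive Cexp (- z + 1 * z) (RtoC 1))
    by (replace (- z + 1 * z) with (RtoC 0) by ring; exact H0).
  assert (Hc := is_Cderive_scal (Cexp z) _ _ _ (is_Cderive_comp Cexp (fun w => - z + 1 * w) _ _ _ H Hs)).
  apply (is_Cderive_eq _ _ (Cexp z * (1 * 1))); [|ring].
  revert Hc. apply is_derive_ext. intros t.
  change (Cexp z * Cexp (- z + 1 * t) = Cexp t). rewrite <- Cexp_plus. f_equal. ring.
Qed.

Lemma is_Cderive_Cexp_comp (f : C -> C) (z l : C) :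
  is_Cderive f z l -> is_Cderive (fun w => Cexp (f w)) z (Cexp (f z) * l).
Proof. intros H. apply (is_Cderive_comp Cexp f); [apply is_Cderive_Cexp|exact H]. Qed.

Lemma Cint_0 (f : C -> C) : Cint f 0 = 0.
Proof.
  unfold Cint. apply is_CInt_CInt.
  apply (is_CInt_ext (fun _ => 0)); [lra|intros; ring|].
  assert (H := is_RInt_const (V := C_R_NormedModule) 0 1 (RtoC 0)).
  assert (E : scal (V := C_R_NormedModule) (1 - 0)%R (RtoC 0) = RtoC 0)
    by apply (scal_zero_r (V := C_R_NormedModule)).
  exact (eq_ind _ (is_CInt (fun _ => RtoC 0) 0 1) H _ E).
Qed.

Lemma Cint_ext (f g : C -> C) (z : C) :
  unit_disc z -> (forall w, unit_disc w -> w <> 0 -> f w = g w) -> Cint f z = Cint g z.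
Proof.
  intros Hz H. apply CInt_ext; [lra|]. intros t Ht.
  destruct (Ceq_dec z 0) as [->|Hz0]; [rewrite !Cmult_0_l; easy|].
  rewrite H; [easy| |].
  - apply unit_disc_scale; [easy|lra].
  - apply Cmult_neq_0; [apply RtoC_neq_0; lra|easy].
Qed.

Lemma Cint_unique (f df : C -> C) (z : C) :
  (forall w, unit_disc w -> is_Cderive f w (df w)) -> analytic_on unit_disc df ->
  f 0 = 0 -> unit_disc z -> f z = Cint df z.
Proof.
  intros Hf Hdf H0 Hz. apply (derive_eq_disc f (Cint df) df); try easy.
  - intros w Hw. now apply is_Cderive_Cint.
  - now rewrite H0, Cint_0.
Qed.

Lemma analytic_on_Cint (f : C -> C) : analytic_on unit_disc f -> analytic_on unit_disc (Cint f).
Proof. intros Hf z Hz. eexists. now apply is_Cderive_Cint. Qed.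

(** Differentiating [Cexp L = Cexp M] and cancelling the exponential gives equal derivatives; both
    branches vanish at [0]. *)
Lemma is_log_branch_unique (h L M : C -> C) (z : C) :
  is_log_branch h L -> is_log_branch h M -> unit_disc z -> L z = M z.
Proof.
  intros [HL [L0 EL]] [HM [M0 EM]] Hz.
  apply (derive_eq_disc L M (C_derive L)); [| |now rewrite L0, M0|easy].
  - intros w Hw. now apply (analytic_on_C_derive unit_disc).
  - intros w Hw.
    assert (dL := analytic_on_C_derive _ _ _ HL Hw).
    assert (dM := analytic_on_C_derive _ _ _ HM Hw).
    replace (C_derive L w) with (C_derive M w); [exact dM|].
    assert (E : Cexp (M w) * C_derive M w = Cexp (L w) * C_derive L w).
    { apply (is_Cderive_unique (fun w => Cexp (L w)) w).
      - apply (is_Cderive_ext_disc (fun w => Cexp (M w))); [|easy|now apply is_Cderive_Cexp_comp].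
        intros v Hv. now rewrite EL, EM.
      - now apply is_Cderive_Cexp_comp. }
    rewrite EL, <- EM in E by easy.
    assert (N := Cexp_neq_0 (M w)).
    transitivity (/ Cexp (M w) * (Cexp (M w) * C_derive M w)); [field; easy|].
    rewrite E. field. easy.
Qed.

Lemma log_branch_eq (h L : C -> C) (z : C) :
  is_log_branch h L -> unit_disc z -> log_branch h z = L z.
Proof.
  intros HL. apply (is_log_branch_unique h); [|exact HL].
  apply (epsilon_spec (inhabits (fun _ : C => RtoC 0)) (is_log_branch h)). now exists L.
Qed.

(** The product [h exp (- L)] has derivative zero and equals [1] at the origin. *)
Lemma is_log_branch_Cint (h : C -> C) :
  analytic_on unit_disc h -> h 0 = 1 -> (forall z, unit_disc z -> h z <> 0) ->
  is_log_branch h (Cint (fun z => C_derive h z / h z)).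
Proof.
  intros Hh H0 Hn.
  assert (Hq : analytic_on unit_disc (fun z => C_derive h z / h z))
    by (apply analytic_on_div; [now apply analytic_on_derive|easy|easy]).
  set (L := Cint (fun z => C_derive h z / h z)).
  split; [now apply analytic_on_Cint|]. split; [apply Cint_0|].
  intros z Hz.
  assert (E : h z * Cexp (- (1) * L z) = 1).
  { apply (derive_eq_disc (fun w => h w * Cexp (- (1) * L w)) (fun _ => 1) (fun _ => 0)); try easy.
    - intros w Hw.
      assert (dh := analytic_on_C_derive _ _ _ Hh Hw).
      assert (dL := is_Cderive_Cint _ w Hq Hw). fold L in dL.
      eapply is_Cderive_eq.
      + apply is_Cderive_mult; [exact dh|]. apply is_Cderive_Cexp_comp, is_Cderive_scal, dL.
      + cbv beta. field. now apply Hn.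
    - intros w _. apply is_Cderive_const.
    - unfold L. rewrite Cint_0, H0, Cmult_0_r, Cexp_0. ring. }
  assert (E2 : Cexp (- (1) * L z) * Cexp (L z) = 1).
  { rewrite <- Cexp_plus. replace (- (1) * L z + L z) with (RtoC 0) by ring. apply Cexp_0. }
  transitivity (h z * Cexp (- (1) * L z) * Cexp (L z)); [rewrite E; ring|].
  rewrite <- Cmult_assoc, E2. ring.
Qed.

(** * Euler's differential equation *)

Lemma analytic_on_pow (S : C -> Prop) (k : nat) : analytic_on S (fun z => z ^ k).
Proof.
  induction k as [|k IH]; [exact (analytic_on_const S 1)|].
  apply (analytic_on_mult S (fun z => z)); [apply analytic_on_id|exact IH].
Qed.

(** The functions [z f] and [z g] agree on the whole disc, and their derivatives at [0] are [f 0]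
    and [g 0]. *)
Lemma analytic_eq_at_0 (f g : C -> C) :
  analytic_on unit_disc f -> analytic_on unit_disc g ->
  (forall z, unit_disc z -> z <> 0 -> f z = g z) -> f 0 = g 0.
Proof.
  intros Hf Hg H.
  assert (D : forall u, analytic_on unit_disc u -> is_Cderive (fun z => z * u z) (RtoC 0) (u 0)).
  { intros u Hu. eapply is_Cderive_eq.
    - exact (is_Cderive_mult _ _ _ _ _ (is_Cderive_id (RtoC 0))
        (analytic_on_C_derive _ _ _ Hu unit_disc_0)).
    - cbv beta. ring. }
  apply (is_Cderive_unique (fun z => z * f z) (RtoC 0)); [now apply D|].
  apply (is_Cderive_ext_disc (fun z => z * g z)); [|apply unit_disc_0|now apply D].
  intros w Hw. destruct (Ceq_dec w 0) as [->|Hw0]; [ring|]. now rewrite H.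
Qed.

(** [N] is the primitive of [w ^ k g] divided by [z ^ (k + 1)], and the equation is the derivative
    of this relation divided by [z ^ k]. The induction removes one factor [z] at a time: the
    solution [N1] for the right-hand side [w g] vanishes at [0], and [N = N1 / z]. *)
Lemma euler_equation (k : nat) (g : C -> C) :
  analytic_on unit_disc g ->
  exists N : C -> C, analytic_on unit_disc N /\
    (forall z, unit_disc z -> INR (S k) * N z + z * C_derive N z = g z) /\
    (forall z, unit_disc z -> Cint (fun w => w ^ k * g w) z = z ^ S k * N z).
Proof.
  revert g. induction k as [|k IH]; intros g Hg.
  - assert (H1 : analytic_on unit_disc (fun w => w ^ 0 * g w))
      by (apply analytic_on_mult; [apply analytic_on_pow|easy]).
    destruct (quotient_by_id (Cint (fun w => w ^ 0 * g w))) as [N [HN E]].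
    { now apply analytic_on_Cint. } { apply Cint_0. }
    exists N. split; [easy|]. split.
    + intros z Hz. apply (is_Cderive_unique (fun w => w * N w) z).
      * eapply is_Cderive_eq; [exact (is_Cderive_mult _ _ _ _ _ (is_Cderive_id z)
          (analytic_on_C_derive _ _ _ HN Hz))|]. simpl. ring.
      * apply (is_Cderive_ext_disc (Cint (fun w => w ^ 0 * g w)) (fun w => w * N w));
          [exact E|easy|].
        apply (is_Cderive_eq _ _ (z ^ 0 * g z)); [|simpl; ring].
        exact (is_Cderive_Cint _ z H1 Hz).
    + intros z Hz. rewrite E by easy. simpl. ring.
  - destruct (IH (fun w => w * g w)) as [N1 [HN1 [E1 I1]]].
    { apply analytic_on_mult; [apply analytic_on_id|easy]. }
    assert (Hk : RtoC (INR (S k)) <> 0) by (apply RtoC_neq_0, not_0_INR; lia).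
    assert (H0 : N1 0 = 0).
    { assert (E := E1 0 unit_disc_0). rewrite !Cmult_0_l, Cplus_0_r in E.
      transitivity (/ INR (S k) * (INR (S k) * N1 0)); [field; easy|rewrite E; ring]. }
    destruct (quotient_by_id N1 HN1 H0) as [N [HN E]].
    exists N. split; [easy|]. split.
    + assert (dN : forall z, unit_disc z -> C_derive N1 z = N z + z * C_derive N z).
      { intros z Hz. apply is_C_derive_unique.
        apply (is_Cderive_ext_disc (fun w => w * N w)); [intros; now rewrite E|easy|].
        eapply is_Cderive_eq; [exact (is_Cderive_mult _ _ _ _ _ (is_Cderive_id z)
          (analytic_on_C_derive _ _ _ HN Hz))|]. cbv beta. ring. }
      assert (Hne : forall z, unit_disc z -> z <> 0 ->
                INR (S (S k)) * N z + z * C_derive N z = g z).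
      { intros z Hz Hz0. specialize (E1 z Hz). rewrite dN, E in E1 by easy.
        rewrite (S_INR (S k)), RtoC_plus.
        transitivity (/ z * (z * g z)); [rewrite <- E1|]; field; easy. }
      intros z Hz. destruct (Ceq_dec z 0) as [->|Hz0]; [|now apply Hne].
      apply (analytic_eq_at_0 (fun z => INR (S (S k)) * N z + z * C_derive N z) g); try easy.
      apply analytic_on_plus; [now apply analytic_on_scal|].
      apply (analytic_on_mult unit_disc (fun z => z)); [apply analytic_on_id|].
      now apply analytic_on_derive.
    + intros z Hz. transitivity (Cint (fun w => w ^ k * (w * g w)) z).
      * apply Cint_ext; [easy|]. intros; simpl; ring.
      * rewrite I1, E by easy. simpl. ring.
Qed.

(** The real part of [p' b] vanishes for every direction [b]; the directions [1] and [i] annihilate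
    both components of [p']. *)
Lemma Re_zero_derive (p : C -> C) (z : C) :
  analytic_on unit_disc p -> (forall w, unit_disc w -> Re (p w) = 0%R) -> unit_disc z ->
  C_derive p z = 0.
Proof.
  intros Hp H0 Hz. assert (D := analytic_on_C_derive _ _ _ Hp Hz).
  destruct (unit_disc_near z Hz) as [d [Hd Hnear]].
  assert (Hdir : forall b, Cmod b = 1%R -> Re (C_derive p z * b) = 0%R).
  { intros b Hb.
    assert (Dr : is_derive (fun t : R => Re (p (z + t * b))) 0%R (Re (C_derive p z * b))).
    { apply is_path_derive_Re, (is_path_derive_comp p (fun t : R => z + t * b));
        [|apply is_path_derive_affine].
      now replace (z + 0%R * b) with z by ring. }
    rewrite <- (is_derive_unique _ _ _ Dr).
    apply is_derive_unique.
    apply (is_derive_ext_loc (fun _ => 0%R));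
      [|apply (is_derive_const (K := R_AbsRing) (V := R_NormedModule))].
    exists (mkposreal d Hd). intros t Ht. symmetry. apply H0, Hnear.
    replace (z + t * b - z) with (t * b) by ring.
    rewrite Cmod_mult, Hb, Rmult_1_r, Cmod_R.
    change (Rabs (t - 0) < d)%R in Ht. now rewrite Rminus_0_r in Ht. }
  assert (H1 := Hdir 1 Cmod_1). assert (H2 := Hdir Ci Cmod_Ci).
  rewrite Cmult_1_r in H1. rewrite re_mult_Ci in H2.
  destruct (C_derive p z) as [x y]. simpl in H1, H2. subst x.
  replace y with 0%R by lra. reflexivity.
Qed.

Section Euler.

Variables (k : nat) (W N : C -> C).
Hypothesis HW : analytic_on unit_disc W.
Hypothesis HW0 : forall z, unit_disc z -> W z <> 0.
Hypothesis Hstar : forall z, unit_disc z -> (0 < Re (INR (S k) + z * C_derive W z / W z))%R.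
Hypothesis HN : analytic_on unit_disc N.
Hypothesis EN : forall z, unit_disc z -> INR (S k) * N z + z * C_derive N z = W z.

Let INR_pos : (0 < INR (S k))%R.
Proof. apply lt_0_INR. lia. Qed.

Let INR_neq_0 : RtoC (INR (S k)) <> 0.
Proof. now apply RtoC_neq_0, Rgt_not_eq. Qed.

(* [s = N / W] solves [z s' + s h = 1] with [h = k + 1 + z W' / W]; at a first zero of [Re s]
   the imaginary part forces [s = 0], and then [z s' = 1 > 0]. *)
Lemma euler_starlike (z : C) : unit_disc z -> (0 < Re (N z / W z))%R.
Proof.
  apply (jack (fun z => N z / W z)).
  - now apply analytic_on_div.
  - assert (E := EN 0 unit_disc_0). rewrite Cmult_0_l, Cplus_0_r in E. rewrite <- E.
    replace (N 0 / (INR (S k) * N 0)) with (RtoC (/ INR (S k))).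
    + simpl. now apply Rinv_0_lt_compat.
    + rewrite RtoC_inv by lra. field. split; [|easy].
      intros E0. apply (HW0 0 unit_disc_0). rewrite <- E, E0. ring.
  - clear z. intros z Hz Hre Him Hneg.
    assert (dN := analytic_on_C_derive _ _ _ HN Hz).
    assert (dW := analytic_on_C_derive _ _ _ HW Hz).
    assert (W0 := HW0 z Hz).
    assert (D : C_derive (fun z => N z / W z) z
                = (C_derive N z * W z - N z * C_derive W z) / (W z * W z))
      by exact (is_C_derive_unique _ _ _ (is_Cderive_div _ _ _ _ _ dN dW W0)).
    rewrite D in Him, Hneg.
    set (s := N z / W z) in *.
    set (h := INR (S k) + z * C_derive W z / W z).
    set (d := z * ((C_derive N z * W z - N z * C_derive W z) / (W z * W z))) in *.
    assert (E : d + s * h = 1).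
    { transitivity ((INR (S k) * N z + z * C_derive N z) / W z).
      - unfold d, s, h. field. easy.
      - rewrite EN by easy. field. easy. }
    assert (Hh := Hstar z Hz). fold h in Hh.
    assert (ER := f_equal Re E). assert (EI := f_equal Im E).
    rewrite re_plus, re_mult, Hre in ER. rewrite im_plus, im_mult, Hre, Him in EI.
    change (Re 1) with 1%R in ER. change (Im 1) with 0%R in EI.
    assert (Hs : Im s = 0%R) by nra.
    rewrite Hs in ER. lra.
Qed.

Lemma euler_neq_0 (z : C) : unit_disc z -> N z <> 0.
Proof.
  intros Hz E. assert (H := euler_starlike z Hz). rewrite E in H.
  replace (0 / W z) with (RtoC 0) in H by (unfold Cdiv; ring). simpl in H. lra.
Qed.

Variables q P : C -> C.
Hypothesis Hq : analytic_on unit_disc q.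
Hypothesis Hqpos : forall z, unit_disc z -> (0 <= Re (q z))%R.
Hypothesis HP : analytic_on unit_disc P.
Hypothesis EP : forall z, unit_disc z -> INR (S k) * P z + z * C_derive P z = W z * q z.

Let analytic_PN : analytic_on unit_disc (fun z => P z / N z).
Proof. apply analytic_on_div; try easy. exact euler_neq_0. Qed.

(** For [D = z ^ (k + 1) P] and [E = z ^ (k + 1) N] this is [D / E + (E / E') (D / E)' = D' / E'],
    the derivative of [D = E (D / E)] divided by [E']. *)
Let quotient_equation (z : C) : unit_disc z ->
  P z / N z + N z / W z * (z * C_derive (fun z => P z / N z) z) = q z.
Proof.
  intros Hz.
  assert (dN := analytic_on_C_derive _ _ _ HN Hz).
  assert (dP := analytic_on_C_derive _ _ _ HP Hz).
  assert (N0 := euler_neq_0 z Hz). assert (W0 := HW0 z Hz).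
  assert (D : C_derive (fun z => P z / N z) z
              = (C_derive P z * N z - P z * C_derive N z) / (N z * N z))
    by exact (is_C_derive_unique _ _ _ (is_Cderive_div _ _ _ _ _ dP dN N0)).
  rewrite D.
  transitivity (P z / N z + ((INR (S k) * P z + z * C_derive P z) * N z
      - P z * (INR (S k) * N z + z * C_derive N z)) / (N z * W z)).
  - field. easy.
  - rewrite EN, EP by easy. field. easy.
Qed.

(** Where [Re (P / N)] first reaches a level [- dl < 0], Jack's lemma makes [z (P / N)'] real and
    not positive. As [Re (N / W) > 0], the quotient equation then gives [Re q <= - dl], a
    contradiction. *)
Lemma euler_quotient_nonneg (z : C) : unit_disc z -> (0 <= Re (P z / N z))%R.
Proof.
  intros Hz. apply Rnot_lt_le. intros Hlt.
  (* The shift makes the real part at [0] strictly positive, as Jack's lemma requires; half of the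
     negative value leaves the shifted function negative at [z]. *)
  set (dl := (- Re (P z / N z) / 2)%R).
  assert (Hdl : (0 < dl)%R) by (unfold dl; lra).
  assert (H : forall z, unit_disc z -> (0 < Re (P z / N z + dl))%R).
  { apply (jack (fun z => P z / N z + dl)).
    - apply analytic_on_plus; [easy|apply analytic_on_const].
    - assert (E := quotient_equation 0 unit_disc_0).
      rewrite Cmult_0_l, Cmult_0_r, Cplus_0_r in E. rewrite E.
      assert (H0 := Hqpos 0 unit_disc_0). rewrite re_plus, re_RtoC. lra.
    - intros w Hw Hre Him Hneg.
      assert (D : C_derive (fun z => P z / N z + dl) w = C_derive (fun z => P z / N z) w).
      { apply is_C_derive_unique. eapply is_Cderive_eq.
        - exact (is_Cderive_plus _ _ _ _ _ (analytic_on_C_derive _ _ _ analytic_PN Hw)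
            (is_Cderive_const dl w)).
        - apply Cplus_0_r. }
      rewrite D in Him, Hneg.
      assert (E := f_equal Re (quotient_equation w Hw)).
      rewrite re_plus, re_mult, Him in E. rewrite re_plus, re_RtoC in Hre.
      assert (Hs := euler_starlike w Hw). assert (Hqw := Hqpos w Hw).
      assert (Re (N w / W w) * Re (w * C_derive (fun z => P z / N z)%C w) <= 0)%R by nra.
      lra. }
  specialize (H z Hz). rewrite re_plus, re_RtoC in H. unfold dl in H. lra.
Qed.

(** By the maximum principle [Re (P / N)] vanishes identically, so [P / N] has derivative zero and
    the quotient equation reads [q = P / N]. *)
Lemma euler_quotient_zero (a z : C) :
  unit_disc a -> Re (P a / N a) = 0%R -> unit_disc z -> Re (q z) = 0%R.
Proof.
  intros Ha E Hz.
  assert (H0 := Re_zero_principle (fun z => P z / N z) a analytic_PN euler_quotient_nonneg Ha E).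
  rewrite <- (quotient_equation z Hz).
  rewrite (Re_zero_derive (fun z => P z / N z) z analytic_PN H0 Hz).
  rewrite !Cmult_0_r, Cplus_0_r. now apply H0.
Qed.

End Euler.

(** * Images of discs and supporting half-planes *)

Lemma extreme_value_dist (S : C -> Prop) (H : C -> C) (w : C) (r : R) :
  closed_set S -> (forall z, S z -> closed_disc r z) -> (exists z, S z) ->
  (forall z, S z -> Ccontinuous_at H z) ->
  exists m, S m /\ forall z, S z -> (Cmod (H m - w) <= Cmod (H z - w))%R.
Proof.
  intros Hcl Hb Hne Hc.
  destruct (extreme_value S (fun z => - Cmod (H z - w))%R r Hcl Hb Hne) as [m [Hm Hmax]].
  - intros z Hz. apply (continuous_opp (V := R_NormedModule)).
    apply (continuous_Cmod (T := C_UniformSpace) (fun z => H z - w)).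
    apply Ccontinuous_minus; [now apply Hc|apply continuous_const].
  - exists m. split; [easy|]. intros z Hz. specialize (Hmax z Hz). lra.
Qed.

Lemma Cmod_conj_Re (u v : C) : (Re (Cconj u * v) = Re u * Re v + Im u * Im v)%R.
Proof. destruct u, v. simpl. ring. Qed.

(* Up to a factor 2, the right-hand side is the derivative of [|H - w|^2] at [m] along [v]. *)
Lemma no_descent (H : C -> C) (w m l v : C) :
  is_Cderive H m l ->
  (forall t : R, (0 < t < 1)%R -> (Cmod (H m - w) <= Cmod (H (m + t * v)%C - w))%R) ->
  (0 <= Re (Cconj (H m - w) * (l * v)))%R.
Proof.
  intros Hd Hmin.
  (* The path runs backwards, reaching [m] at [t = 1], the end point treated by
     [derive_left_nonpos]. *)
  set (X := fun t : R => H ((m + v) + t * (- v))%C - w).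
  assert (E1 : (m + v) + 1%R * (- v) = m) by ring.
  assert (HX : is_path_derive X 1%R (l * (- v))).
  { unfold X.
    assert (D : is_path_derive (fun t : R => H ((m + v) + t * (- v))) 1%R (l * (- v))).
    { apply (is_path_derive_comp H (fun t : R => (m + v) + t * (- v)));
        [now rewrite E1|apply is_path_derive_affine]. }
    assert (K := is_derive_minus (K := R_AbsRing) (V := C_R_NormedModule) _ _ _ _ _ D
       (is_derive_const (K := R_AbsRing) (V := C_R_NormedModule) w 1%R)).
    refine (is_path_derive_eq _ _ _ _ K _).
    change (l * - v - 0 = l * - v). ring. }
  assert (DR := is_path_derive_Re _ _ _ HX). assert (DI := is_path_derive_Im _ _ _ HX).
  set (h := fun t => (Re (X t) * Re (X t) + Im (X t) * Im (X t))%R).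
  assert (Dh : is_derive h 1%R (2 * (Re (X 1%R) * Re (l * - v) + Im (X 1%R) * Im (l * - v)))%R).
  { unfold h.
    replace (2 * (Re (X 1%R) * Re (l * - v) + Im (X 1%R) * Im (l * - v)))%R with
      ((Re (l * - v) * Re (X 1%R) + Re (X 1%R) * Re (l * - v)) +
       (Im (l * - v) * Im (X 1%R) + Im (X 1%R) * Im (l * - v)))%R by ring.
    apply (is_derive_plus (K := R_AbsRing) (V := R_NormedModule));
      apply (is_derive_mult (K := R_AbsRing)); try easy; apply Rmult_comm. }
  assert (Hle := derive_left_nonpos h _ Dh).
  assert (X1 : X 1%R = H m - w) by (unfold X; now rewrite E1).
  rewrite X1, <- Cmod_conj_Re in Hle.
  replace (Cconj (H m - w) * (l * - v)) with (- (Cconj (H m - w) * (l * v))) in Hle by ring.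
  rewrite re_opp in Hle.
  assert (Hh : (forall t : R, (0 < t < 1)%R -> (h 1 <= h t)%R)).
  { intros t Ht. unfold h. rewrite <- !Cmod_sqr, X1. unfold X.
    specialize (Hmin (1 - t)%R ltac:(lra)).
    replace (m + (1 - t)%R * v) with (m + v + t * - v) in Hmin by (rewrite RtoC_minus; ring).
    assert (P := Cmod_ge_0 (H m - w)). apply Rmult_le_compat; lra. }
  specialize (Hle Hh). lra.
Qed.

Section Image.

Variables (H dH : C -> C) (rho : R).
Hypothesis Hrho : (0 < rho)%R.
Hypothesis HdH : forall x, closed_disc rho x -> is_Cderive H x (dH x).
Hypothesis HdH0 : forall x, closed_disc rho x -> dH x <> 0.

Let continuous_H (x : C) : closed_disc rho x ->
  Ccontinuous_at H x.
Proof. intros Hx. exact (is_Cderive_continuous _ _ _ (HdH x Hx)). Qed.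

(** As [H' m] is not zero, a move along [- (H m - w) / H' m] would push [H] straight towards [w]. *)
Lemma interior_minimum (w m : C) :
  (Cmod m < rho)%R -> (forall x, closed_disc rho x -> (Cmod (H m - w) <= Cmod (H x - w))%R) ->
  H m = w.
Proof.
  intros Hm Hmin. apply NNPP. intros Hne.
  assert (Hmd : closed_disc rho m) by now left.
  set (u := H m - w).
  assert (Hu : u <> 0) by exact (Cminus_eq_contra _ _ Hne).
  assert (Hl := HdH0 m Hmd).
  assert (Hmu := proj1 (Cmod_gt_0 u) Hu).
  set (g := u / dH m).
  assert (Hg : g <> 0).
  { intros E. apply Hu. transitivity (g * dH m); [unfold g; field; easy|rewrite E; ring]. }
  assert (Hmg := proj1 (Cmod_gt_0 g) Hg).
  (* The full displacement [s g] has length [rho - |m|], so the path stays in the disc. *)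
  set (s := ((rho - Cmod m) / Cmod g)%R).
  assert (Hs : (0 < s)%R) by (apply Rdiv_lt_0_compat; lra).
  assert (D := no_descent H w m (dH m) (- (s * g)) (HdH m Hmd)). fold u in D.
  assert (E : (Re (Cconj u * (dH m * - (s * g))) = - (s * (Cmod u * Cmod u)))%R).
  { replace (dH m * - (s * g)) with (- (s * u)) by (unfold g; field; easy).
    replace (Cconj u * - (s * u)) with (- (s * (Cconj u * u))) by ring.
    rewrite Cconj_mult_Cmod, re_opp, re_scal_l, re_RtoC. easy. }
  rewrite E in D.
  assert (0 < s * (Cmod u * Cmod u))%R by (apply Rmult_lt_0_compat; [easy|now apply Rmult_lt_0_compat]).
  enough (0 <= - (s * (Cmod u * Cmod u)))%R by lra.
  apply D. intros t Ht. apply Hmin. unfold closed_disc.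
  eapply Rle_trans; [apply Cmod_triangle|].
  rewrite Cmod_mult, Cmod_opp, Cmod_mult, !Cmod_R, !Rabs_right by lra.
  replace (s * Cmod g)%R with (rho - Cmod m)%R by (unfold s; field; lra). nra.
Qed.

Lemma minimum_exists (w : C) :
  exists m, closed_disc rho m /\
    forall x, closed_disc rho x -> (Cmod (H m - w) <= Cmod (H x - w))%R.
Proof.
  apply (extreme_value_dist _ H w rho); try easy.
  - apply closed_set_closed_disc.
  - exists 0. unfold closed_disc. rewrite Cmod_0. lra.
Qed.

(* At a boundary point of [H (closed_disc rho)] nearest to [w], [H eps - w] would be a negative
   multiple of the outward normal [eps * dH eps]. *)
Lemma support_image (w : C) :
  (forall eps, Cmod eps = rho -> (0 <= Re ((H eps - w) / (eps * dH eps)))%R) ->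
  image (closed_disc rho) H w.
Proof.
  intros Hsup. destruct (minimum_exists w) as [m [Hm Hmin]].
  exists m. split; [exact Hm|]. destruct Hm as [Hlt|Heq].
  { now apply interior_minimum. }
  assert (Hmd : closed_disc rho m) by now right.
  apply NNPP. intros Hne. specialize (Hsup m Heq).
  assert (Hl := HdH0 m Hmd).
  assert (Hm0 : m <> 0) by (apply Cmod_gt_0; lra).
  set (u := H m - w) in *.
  assert (Hu : u <> 0) by exact (Cminus_eq_contra _ _ Hne).
  set (p := u / (m * dH m)) in *.
  assert (Hn : m * dH m <> 0) by now apply Cmult_neq_0.
  assert (Hp : p <> 0).
  { intros E. apply Hu. transitivity (p * (m * dH m)); [unfold p; field; easy|rewrite E; ring]. }
  assert (Hmp := proj1 (Cmod_gt_0 p) Hp).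
  (* The direction [- m p] may be tangent to the circle and lead out of the disc. Adding [|p|] gives
     [Re p' > 0], so that [- m p'] points inwards, while [Re (conj p p') = |p|^2 + |p| Re p] stays
     positive, so the distance still decreases. *)
  set (p' := p + Cmod p).
  assert (Hp'R : (0 < Re p')%R) by (unfold p'; rewrite re_plus, re_RtoC; lra).
  (* With this scale [|1 - t s p'|^2 = 1 - (2 - t) t s Re p'], which is below [1] for
     [0 < t < 1]. *)
  set (s := (Re p' / (Cmod p' * Cmod p'))%R).
  assert (Hp'0 : (0 < Cmod p')%R) by (generalize (Re_le_Cmod p'); lra).
  assert (Hs : (0 < s)%R).
  { apply Rdiv_lt_0_compat; [easy|]. now apply Rmult_lt_0_compat. }
  assert (D := no_descent H w m (dH m) (- (s * (m * p'))) (HdH m Hmd)). fold u in D.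
  set (n := m * dH m) in *.
  assert (Hmn := proj1 (Cmod_gt_0 n) Hn).
  assert (E : (Re (Cconj u * (dH m * - (s * (m * p')))) =
     - (s * ((Cmod n * Cmod n) * (Cmod p * Cmod p + Cmod p * Re p))))%R).
  { replace (Cconj u * (dH m * - (s * (m * p')))) with
      (- (s * ((Cconj n * n) * (Cconj p * p')))).
    - rewrite re_opp, re_scal_l, Cconj_mult_Cmod, re_scal_l. unfold p'.
      rewrite Cmult_plus_distr_l, Cconj_mult_Cmod, re_plus, re_RtoC, re_scal_r, re_conj. ring.
    - replace u with (p * n) by (unfold p; field; easy).
      rewrite Cmult_conj. unfold n. ring. }
  rewrite E in D.
  assert (Hpos : (0 < s * ((Cmod n * Cmod n) * (Cmod p * Cmod p + Cmod p * Re p)))%R).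
  { apply Rmult_lt_0_compat; [easy|]. apply Rmult_lt_0_compat; [now apply Rmult_lt_0_compat|]. nra. }
  enough (0 <= - (s * ((Cmod n * Cmod n) * (Cmod p * Cmod p + Cmod p * Re p))))%R by lra.
  apply D. intros t Ht. apply Hmin. unfold closed_disc.
  replace (m + t * - (s * (m * p'))) with (m * (1 - (t * s)%R * p')) by (rewrite RtoC_mult; ring).
  rewrite Cmod_mult, Heq. rewrite <- (Rmult_1_r rho) at 2.
  apply Rmult_le_compat_l; [lra|].
  apply Cmod_le_1_sqr.
  assert (Es : (s * (Cmod p' * Cmod p') = Re p')%R) by (unfold s; field; lra).
  rewrite Cmod_sqr in Es.
  assert (ER : Re (1 - (t * s)%R * p') = (1 - t * s * Re p')%R) by (destruct p'; simpl; ring).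
  assert (EI : Im (1 - (t * s)%R * p') = (- (t * s * Im p'))%R) by (destruct p'; simpl; ring).
  rewrite ER, EI.
  replace ((1 - t * s * Re p') * (1 - t * s * Re p') + - (t * s * Im p') * - (t * s * Im p'))%R
    with (1 - 2 * (t * s) * Re p' + t * (t * s) * (s * (Re p' * Re p' + Im p' * Im p')))%R by ring.
  rewrite Es.
  assert (0 < t * s * Re p')%R by (apply Rmult_lt_0_compat; [apply Rmult_lt_0_compat|]; lra).
  nra.
Qed.

(** By [support_image] the image is an intersection of half-planes. *)
Lemma image_closed_disc_convex :
  (forall eps x, Cmod eps = rho -> closed_disc rho x ->
     (0 <= Re ((H eps - H x) / (eps * dH eps)))%R) ->
  convex_set (image (closed_disc rho) H).
Proof.
  intros Hsup u v t [x [Hx Ex]] [y [Hy Ey]] Ht. apply support_image. intros eps He.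
  assert (S1 := Hsup eps x He Hx). assert (S2 := Hsup eps y He Hy).
  replace ((H eps - ((1 - t) * u + t * v)) / (eps * dH eps)) with
    ((1 - t)%R * ((H eps - H x) / (eps * dH eps)) + t * ((H eps - H y) / (eps * dH eps))).
  - rewrite re_plus, !re_scal_l.
    apply Rplus_le_le_0_compat; apply Rmult_le_pos; lra.
  - rewrite Ex, Ey, RtoC_minus. unfold Cdiv. ring.
Qed.

Hypothesis Hinj : injective_on (closed_disc rho) H.

(** By injectivity [H x0] has positive distance [mu] from the image of the circle. For [w] within
    [mu / 2] of [H x0] the point of the image nearest to [w] comes from the open disc, and
    [interior_minimum] identifies it with [w]. *)
Lemma image_disc_open (x0 : C) :
  (Cmod x0 < rho)%R ->
  exists d : R, (0 < d)%R /\ forall w, (Cmod (w - H x0) < d)%R ->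
    image (fun x => Cmod x < rho)%R H w.
Proof.
  intros Hx0.
  assert (Hx0d : closed_disc rho x0) by now left.
  assert (Hsub : forall z, Cmod z = rho -> closed_disc rho z) by (intros z Hz; now right).
  destruct (extreme_value_dist (fun z => Cmod z = rho) H (H x0) rho) as [b [Hb Hmin]]; try easy.
  - intros z Hz. destruct (Rle_lt_dec (Cmod z) rho) as [Hle|Hgt].
    + exists (rho - Cmod z)%R. split; [destruct Hle; [lra|easy]|].
      intros w Hw E. assert (T := Cmod_triangle z (w - z)). rewrite Cplus_minus in T. lra.
    + destruct (closed_set_closed_disc rho z) as [d [Hd Hdd]]; [unfold closed_disc; lra|].
      exists d. split; [easy|]. intros w Hw E. now apply (Hdd w Hw), Hsub.
  - exists rho. rewrite Cmod_R. apply Rabs_right. lra.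
  - intros z Hz. now apply continuous_H, Hsub.
  - set (mu := Cmod (H b - H x0)) in *.
    assert (Hmu : (0 < mu)%R).
    { apply Cmod_gt_0. intros E. apply Ceq_minus in E. apply Hinj in E; auto.
      rewrite E in Hb. lra. }
    exists (mu / 2)%R. split; [lra|]. intros w Hw.
    destruct (minimum_exists w) as [m [Hm Hmm]].
    exists m. assert (Hlt : (Cmod m < rho)%R).
    { destruct Hm as [Hm|Hm]; [exact Hm|exfalso].
      specialize (Hmin m Hm). specialize (Hmm x0 Hx0d).
      assert (T := Cmod_triangle (H m - w) (w - H x0)).
      replace (H m - w + (w - H x0)) with (H m - H x0) in T by ring.
      replace (H x0 - w) with (- (w - H x0)) in Hmm by ring. rewrite Cmod_opp in Hmm. lra. }
    split; [exact Hlt|]. now apply interior_minimum.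
Qed.

End Image.

(** * Connectedness, parametrization of the circle, and closed Jordan domains *)

Lemma open_iff (U : C -> Prop) :
  open (T := C_UniformSpace) U <->
  forall z, U z -> exists d : R, (0 < d)%R /\ forall w, (Cmod (w - z) < d)%R -> U w.
Proof.
  split.
  - intros HU z Hz. apply locally_Cmod. now apply HU.
  - intros HU z Hz. apply locally_Cmod. now apply HU.
Qed.

(** A supremum argument on the segment from a point of [U] to a point of [V]. *)
Lemma convex_connected (S : C -> Prop) : convex_set S -> connected S.
Proof.
  intros HS U V HU HV Hcov [x [Sx Ux]] [y [Sy Vy]].
  apply NNPP. intros Hno.
  assert (Hdis : forall z, S z -> U z -> V z -> False).
  { intros z Sz Uz Vz. apply Hno. now exists z. }
  set (g := fun t : R => (1 - t) * x + t * y).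
  assert (Sg : forall t, (0 <= t <= 1)%R -> S (g t)) by (intros; now apply HS).
  assert (Hg : forall s t : R, (Cmod (g s - g t) <= Rabs (s - t) * Cmod (y - x))%R).
  { intros s t. replace (g s - g t) with ((s - t)%R * (y - x)) by (unfold g; rewrite RtoC_minus; ring).
    rewrite Cmod_mult, Cmod_R. lra. }
  assert (Hopen : forall (W : C -> Prop) t, open (T := C_UniformSpace) W -> W (g t) ->
            exists e : R, (0 < e)%R /\ forall s, (Rabs (s - t) < e)%R -> W (g s)).
  { intros W t HW Wt. destruct (proj1 (open_iff W) HW _ Wt) as [d [Hd H]].
    assert (Hn := Cmod_ge_0 (y - x)).
    exists (d / (Cmod (y - x) + 1))%R. split; [apply Rdiv_lt_0_compat; lra|].
    intros s Hs. apply H. eapply Rle_lt_trans; [apply Hg|].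
    apply (Rmult_lt_compat_r (Cmod (y - x) + 1)) in Hs; [|lra].
    replace (d / (Cmod (y - x) + 1) * (Cmod (y - x) + 1))%R with d in Hs by (field; lra). nra. }
  assert (g0 : g 0%R = x) by (unfold g; ring). assert (g1 : g 1%R = y) by (unfold g; ring).
  destruct (completeness (fun t => (0 <= t <= 1)%R /\ U (g t))) as [m [Hm1 Hm2]].
  { exists 1%R. intros t [Ht _]. lra. }
  { exists 0%R. split; [lra|]. now rewrite g0. }
  assert (Hm : (0 <= m <= 1)%R).
  { split.
    - apply Hm1. split; [lra|]. now rewrite g0.
    - apply Hm2. intros t [Ht _]. lra. }
  destruct (Hcov _ (Sg m Hm)) as [Um|Vm].
  - destruct (Hopen U m HU Um) as [e [He H]].
    assert (m <> 1%R).
    { intros E. rewrite E, g1 in Um. now apply (Hdis y). }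
    set (s := Rmin (m + e / 2) 1).
    assert (Hs : (m < s <= 1)%R).
    { split; [apply Rmin_case; lra|apply Rmin_r]. }
    assert (s <= m)%R; [|lra]. apply Hm1. split; [lra|]. apply H.
    assert (s <= m + e / 2)%R by apply Rmin_l. rewrite Rabs_right; lra.
  - destruct (Hopen V m HV Vm) as [e [He H]].
    assert (Hub : (m <= m - e)%R); [|lra].
    apply Hm2. intros t [Ht Ut]. apply Rnot_lt_le. intros Hlt.
    apply (Hdis (g t)); [now apply Sg|easy|]. apply H.
    assert (t <= m)%R by now apply Hm1.
    rewrite Rabs_left1; lra.
Qed.

Lemma polar (r : R) (z : C) :
  Cmod z = r -> (0 < r)%R -> exists t : R, (0 <= t <= 1)%R /\ circle r (2 * PI * t) = z.
Proof.
  intros Hz Hr. assert (HP := PI_RGT_0).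
  destruct z as [x y].
  assert (E : (x * x + y * y = r * r)%R) by (rewrite <- Hz; symmetry; apply Cmod_sqr).
  set (u := (x / r)%R). set (v := (y / r)%R).
  assert (E1 : (u * u + v * v = 1)%R).
  { unfold u, v. replace (x / r * (x / r) + y / r * (y / r))%R with ((x * x + y * y) / (r * r))%R
      by (field; lra). rewrite E. field. lra. }
  assert (Hu : (-1 <= u <= 1)%R) by nra.
  assert (Ex : x = (r * u)%R) by (unfold u; field; lra).
  assert (Ey : y = (r * v)%R) by (unfold v; field; lra).
  assert (Hac := acos_bound u). assert (Hcos := cos_acos u Hu).
  assert (Hsin := sin_acos u Hu).
  assert (Hsq : sqrt (1 - u²) = Rabs v).
  { rewrite <- sqrt_Rsqr_abs. f_equal. unfold Rsqr. lra. }
  unfold circle.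
  destruct (Rle_lt_dec 0 v) as [Hv|Hv].
  - exists (acos u / (2 * PI))%R. split.
    + split; [apply Rdiv_le_0_compat; lra|]. apply Rle_div_l; lra.
    + replace (2 * PI * (acos u / (2 * PI)))%R with (acos u) by (field; lra).
      rewrite Hcos, Hsin, Hsq, Rabs_right by lra.
      unfold Cmult, RtoC; simpl. rewrite Ex, Ey. f_equal; ring.
  - exists ((2 * PI - acos u) / (2 * PI))%R. split.
    + split; [apply Rdiv_le_0_compat; lra|]. apply Rle_div_l; lra.
    + replace (2 * PI * ((2 * PI - acos u) / (2 * PI)))%R with (- acos u + 2 * PI)%R by (field; lra).
      rewrite cos_plus, sin_plus, cos_2PI, sin_2PI, cos_neg, sin_neg.
      rewrite Hcos, Hsin, Hsq, Rabs_left by lra.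
      unfold Cmult, RtoC; simpl. rewrite Ex, Ey. f_equal; ring.
Qed.

Lemma cos_eq_1 (x : R) : (- (2 * PI) < x < 2 * PI)%R -> cos x = 1%R -> x = 0%R.
Proof.
  intros Hx E.
  assert (Hs : sin (x / 2) = 0%R).
  { replace x with (2 * (x / 2))%R in E by field. rewrite cos_2a_sin in E. nra. }
  destruct (Rtotal_order x 0) as [H|[H|H]]; [|easy|].
  - assert (0 < sin (- (x / 2)))%R by (apply sin_gt_0; lra). rewrite sin_neg in *. lra.
  - assert (0 < sin (x / 2))%R by (apply sin_gt_0; lra). lra.
Qed.

Lemma circle_inj (r s t : R) :
  (0 < r)%R -> (0 <= s < 1)%R -> (0 <= t < 1)%R ->
  circle r (2 * PI * s) = circle r (2 * PI * t) -> s = t.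
Proof.
  intros Hr Hs Ht E. assert (HP := PI_RGT_0).
  unfold circle in E.
  assert (E1 : (cos (2 * PI * s), sin (2 * PI * s)) = (cos (2 * PI * t), sin (2 * PI * t))).
  { assert (Hr' : RtoC r <> 0) by (apply RtoC_neq_0; lra).
    transitivity (/ r * (r * (cos (2 * PI * s), sin (2 * PI * s)))).
    - rewrite Cmult_assoc, Cinv_l, Cmult_1_l by easy. easy.
    - rewrite E, Cmult_assoc, Cinv_l, Cmult_1_l by easy. easy. }
  injection E1 as Ec Es.
  assert (H : (2 * PI * s - 2 * PI * t = 0)%R).
  { apply cos_eq_1; [nra|]. rewrite cos_minus, Ec, Es.
    generalize (sin2_cos2 (2 * PI * t)). unfold Rsqr. lra. }
  nra.
Qed.

(** A connected set that avoids the curve and meets the image of the open disc stays in that image,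
    since this image and the complement of [S] are disjoint open sets covering it. From a point
    outside [S] the ray leading away from [p = H 0] avoids the convex set [S], so its component is
    unbounded. *)
Theorem image_closed_jordan_domain (H dH : C -> C) (rho : R) :
  (0 < rho)%R ->
  (forall x, closed_disc rho x -> is_Cderive H x (dH x)) ->
  (forall x, closed_disc rho x -> dH x <> 0) ->
  injective_on (closed_disc rho) H ->
  convex_set (image (closed_disc rho) H) ->
  closed_jordan_domain (image (closed_disc rho) H).
Proof.
  intros Hrho HdH HdH0 Hinj Hconv.
  assert (Hcont : forall x, closed_disc rho x ->
            Ccontinuous_at H x).
  { intros x Hx. exact (is_Cderive_continuous _ _ _ (HdH x Hx)). }
  assert (Hcirc : forall t, closed_disc rho (circle rho t)).
  { intros t. right. apply Cmod_circle. lra. }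
  assert (HP := PI_RGT_0).
  set (c := fun t : R => H (circle rho (2 * PI * t))).
  set (J := fun w => exists t : R, (0 <= t <= 1)%R /\ c t = w).
  assert (HJ : forall w, J w <-> exists x, Cmod x = rho /\ H x = w).
  { intros w. split.
    - intros [t [_ E]]. exists (circle rho (2 * PI * t)). split; [apply Cmod_circle; lra|exact E].
    - intros [x [Hx E]]. destruct (polar rho x Hx Hrho) as [t [Ht Et]].
      exists t. split; [easy|]. unfold c. now rewrite Et. }
  exists J. split.
  { exists c. split; [|split; [|split]].
    - intros t _. apply (filterlim_filter_le_1 _ (filter_le_within (F := locally t) _)).
      apply (Ccontinuous_comp H (fun t : R => circle rho (2 * PI * t))); [|now apply Hcont].
      apply (continuous_comp (fun t : R => (2 * PI * t)%R) (circle rho)); [|apply Ccontinuous_circle].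
      apply (continuous_mult (K := R_AbsRing)); [apply continuous_const|apply continuous_id].
    - unfold c. now rewrite Rmult_0_r, Rmult_1_r, circle_2PI.
    - intros s t Hs Ht E. apply (circle_inj rho s t Hrho Hs Ht). now apply Hinj.
    - easy. }
  set (S := image (closed_disc rho) H) in *.
  assert (HJS : forall w, J w -> S w).
  { intros w Hw. apply HJ in Hw. destruct Hw as [x [Hx E]]. exists x. split; [now right|easy]. }
  set (U := image (fun x => Cmod x < rho)%R H).
  assert (HU : open (T := C_UniformSpace) U).
  { apply open_iff. intros z [x [Hx <-]].
    now apply (image_disc_open H dH rho Hrho HdH HdH0 Hinj). }
  assert (HUS : forall w, U w -> S w).
  { intros w [x [Hx E]]. exists x. split; [now left|easy]. }
  assert (HV : open (T := C_UniformSpace) (fun w => ~ S w)).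
  { apply open_iff. intros z Hz.
    destruct (minimum_exists H dH rho Hrho HdH z) as [m [Hm Hmin]].
    assert (Hpos : (0 < Cmod (H m - z))%R).
    { apply Cmod_gt_0. apply Cminus_eq_contra. intros E. apply Hz. now exists m. }
    exists (Cmod (H m - z)). split; [easy|]. intros w Hw [x [Hx <-]].
    specialize (Hmin x Hx). lra. }
  assert (HB : exists M, forall x, closed_disc rho x -> (Cmod (H x) <= M)%R).
  { destruct (extreme_value (closed_disc rho) (fun x => Cmod (H x)) rho) as [m [_ Hm]].
    - apply closed_set_closed_disc.
    - easy.
    - exists 0. unfold closed_disc. rewrite Cmod_0. lra.
    - intros x Hx. apply (continuous_Cmod (T := C_UniformSpace) H). now apply Hcont.
    - now exists (Cmod (H m)). }
  intros w. split.
  - intros [x [[Hx|Hx] E]]; [right|left; apply HJ; now exists x].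
    split.
    + intros Hw. apply HJ in Hw. destruct Hw as [y [Hy Ey]].
      assert (Exy : x = y) by (apply Hinj; [now left|now right|now rewrite E, Ey]).
      rewrite Exy in Hx. lra.
    + destruct HB as [M HM]. exists M. intros z [T [HTc [HTJ [HTw HTz]]]].
      assert (HzU : U z).
      { apply NNPP. intros Hz.
        assert (Hcov : forall v, T v -> U v \/ ~ S v).
        { intros v Hv. destruct (classic (S v)) as [[y [[Hy|Hy] Ey]]|Hn]; [| |now right].
          - left. now exists y.
          - exfalso. apply (HTJ v Hv), HJ. now exists y. }
        destruct (HTc U (fun w => ~ S w) HU HV Hcov) as [v [Hv [Uv NSv]]].
        - exists w. split; [easy|]. now exists x.
        - exists z. split; [easy|]. destruct (Hcov z HTz); [contradiction|easy].
        - now apply NSv, HUS. }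
      destruct HzU as [y [Hy <-]]. apply HM. now left.
  - intros [Hw|[HnJ [M HM]]]; [now apply HJS|].
    apply NNPP. intros HnS.
    set (p := H 0).
    assert (Sp : S p). { exists 0. split; [unfold closed_disc; rewrite Cmod_0; lra|easy]. }
    assert (Hwp : w - p <> 0).
    { apply Cminus_eq_contra. intros E. apply HnS. now rewrite E. }
    assert (Hm := proj1 (Cmod_gt_0 _) Hwp).
    (* The point [w] is the convex combination of [p] and the ray point in which the latter has
       weight [1 / (1 + t)]. *)
    assert (Hray : forall t, (0 <= t)%R -> ~ S (w + t * (w - p))).
    { intros t Ht St. apply HnS.
      assert (Ht1 : RtoC (1 + t) <> 0) by (apply RtoC_neq_0; lra).
      replace w with ((1 - (/ (1 + t))%R) * p + (/ (1 + t))%R * (w + t * (w - p))).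
      - apply Hconv; try easy. split; [apply Rlt_le, Rinv_0_lt_compat; lra|].
        rewrite <- Rinv_1. apply Rinv_le_contravar; lra.
      - rewrite RtoC_inv, RtoC_plus in * by lra. field. easy. }
    (* The end of the segment is at distance [|M| + |w| + 1] from [w], hence has modulus greater
       than [M]. *)
    set (L := ((Rabs M + Cmod w + 1) / Cmod (w - p))%R).
    assert (HMw : (0 < Rabs M + Cmod w + 1)%R)
      by (generalize (Rabs_pos M) (Cmod_ge_0 w); lra).
    assert (HL : (0 < L)%R) by now apply Rdiv_lt_0_compat.
    set (T := fun z => exists t : R, (0 <= t <= L)%R /\ z = w + t * (w - p)).
    assert (HT : component (fun v => ~ J v) w (w + L * (w - p))).
    { exists T. split; [|split; [|split]].
      - apply convex_connected. intros x y t [a [Ha ->]] [b [Hb ->]] Ht.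
        exists ((1 - t) * a + t * b)%R. split; [nra|].
        rewrite RtoC_plus, !RtoC_mult, RtoC_minus. ring.
      - intros z [t [Ht ->]] Jz. apply (Hray t); [lra|]. now apply HJS.
      - exists 0%R. split; [lra|ring].
      - exists L. split; [lra|easy]. }
    apply HM in HT.
    assert (Tr := Cmod_triangle (w + L * (w - p)) (- w)).
    replace (w + L * (w - p) + - w) with (L * (w - p)) in Tr by ring.
    rewrite Cmod_opp, Cmod_mult, Cmod_R, Rabs_right in Tr by lra.
    replace (L * Cmod (w - p))%R with (Rabs M + Cmod w + 1)%R in Tr by (unfold L; field; lra).
    generalize (Rle_abs M). lra.
Qed.

(** * Integrals of analytic families of Moebius maps *)

Lemma Re_div (u v : C) :
  v <> 0 -> Re (u / v) = ((Re u * Re v + Im u * Im v) / (Cmod v * Cmod v))%R.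
Proof.
  intros Hv. assert (H := proj1 (Cmod_gt_0 v) Hv).
  assert (E := Cmod_sqr v). rewrite E.
  assert (E0 : (Re v * Re v + Im v * Im v <> 0)%R) by nra.
  destruct u as [a b], v as [x y]. simpl in *. field.
  intros E1. apply E0. lra.
Qed.

(** Twice the real part of the numerator times the conjugate denominator is [(1 - |y|^2) |1 - x|^2 +
    (1 - |x|^2) |1 + y|^2]; as [|y| < 1], it vanishes only for [x = 1]. *)
Lemma mobius_halfplane (x y : C) :
  (Cmod x <= 1)%R -> (Cmod y < 1)%R ->
  (0 <= Re ((1 - x) * (1 + y) / (1 + y * x)))%R /\
  (Re ((1 - x) * (1 + y) / (1 + y * x)) = 0%R -> x = 1).
Proof.
  intros Hx Hy.
  assert (Hn : 1 + y * x <> 0).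
  { apply one_plus_neq_0. rewrite Cmod_mult. assert (P2 := Cmod_ge_0 y). nra. }
  rewrite Re_div by easy.
  assert (Hm := proj1 (Cmod_gt_0 _) Hn).
  apply Cmod_le_1_sqr in Hx. apply Cmod_lt_1_sqr in Hy.
  set (m := Cmod (1 + y * x)) in *.
  match goal with |- context [(?n / (m * m))%R] => set (num := n) end.
  assert (E : (num = ((1 - (Re y * Re y + Im y * Im y)) * ((1 - Re x) * (1 - Re x) + Im x * Im x)
     + (1 - (Re x * Re x + Im x * Im x)) * ((1 + Re y) * (1 + Re y) + Im y * Im y)) / 2)%R).
  { unfold num. destruct x, y. simpl. field. }
  assert (P1 : (0 <= (1 - (Re x * Re x + Im x * Im x)) * ((1 + Re y) * (1 + Re y) + Im y * Im y))%R)
    by (apply Rmult_le_pos; nra).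
  assert (P2 : (0 <= (1 - Re x) * (1 - Re x) + Im x * Im x)%R) by nra.
  assert (Hmm : (0 < m * m)%R) by nra.
  split.
  - apply Rle_div_r; [easy|]. rewrite Rmult_0_l, E. nra.
  - intros H0.
    assert (N0 : num = 0%R).
    { apply (f_equal (fun t => (t * (m * m))%R)) in H0. field_simplify in H0; lra. }
    rewrite E in N0.
    assert (Q : ((1 - Re x) * (1 - Re x) + Im x * Im x = 0)%R) by nra.
    assert (Q1 : Re x = 1%R) by nra. assert (Q2 : Im x = 0%R) by nra.
    destruct x as [u v]. simpl in Q1, Q2. now subst.
Qed.

Lemma Cint_minus (f g : C -> C) (z : C) :
  analytic_on unit_disc f -> analytic_on unit_disc g -> unit_disc z ->
  Cint f z - Cint g z = Cint (fun w => f w - g w) z.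
Proof.
  intros Hf Hg Hz.
  apply (Cint_unique (fun z => Cint f z - Cint g z) (fun w => f w - g w)).
  - intros w Hw. apply is_Cderive_minus; now apply is_Cderive_Cint.
  - now apply analytic_on_minus.
  - rewrite !Cint_0. ring.
  - exact Hz.
Qed.

Lemma Cint_scal (k : C) (f : C -> C) (z : C) :
  analytic_on unit_disc f -> unit_disc z -> k * Cint f z = Cint (fun w => k * f w) z.
Proof.
  intros Hf Hz.
  apply (Cint_unique (fun z => k * Cint f z) (fun w => k * f w)).
  - intros w Hw. apply is_Cderive_scal. now apply is_Cderive_Cint.
  - now apply analytic_on_scal.
  - rewrite Cint_0. ring.
  - exact Hz.
Qed.

Lemma Ccontinuous_ray (z : C) (t : R) : Ccontinuous (fun s : R => s * z) t.
Proof.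
  apply (Ccontinuous_mult (fun s : R => RtoC s)); [|apply continuous_const].
  apply (Ccontinuous_RtoC (fun s : R => s)), continuous_id.
Qed.

Definition mob_den (c e : C -> C) (x z : C) : C := c z + z * e z * x.

Definition mob (a b c e : C -> C) (x z : C) : C := (a z + b z * x) / mob_den c e x z.

Lemma mob_den_bound (c e : C -> C) (x z : C) (rho : R) :
  (Cmod (e z) <= Cmod (c z))%R -> (Cmod z * Cmod x <= rho)%R ->
  ((1 - rho) * Cmod (c z) <= Cmod (mob_den c e x z))%R.
Proof.
  intros H H1. unfold mob_den.
  assert (T := Cmod_triangle (c z + z * e z * x) (- (z * e z * x))).
  replace (c z + z * e z * x + - (z * e z * x)) with (c z) in T by ring.
  rewrite Cmod_opp, !Cmod_mult in T.
  assert (P0 := Cmod_ge_0 (e z)).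
  assert (P1 := Cmod_ge_0 z). assert (P2 := Cmod_ge_0 x).
  assert (Cmod z * Cmod x * Cmod (e z) <= rho * Cmod (c z))%R
    by (apply Rmult_le_compat; try easy; now apply Rmult_le_pos).
  lra.
Qed.

Lemma mob_den_neq_0 (c e : C -> C) (x z : C) :
  c z <> 0 -> (Cmod (e z) <= Cmod (c z))%R -> (Cmod z * Cmod x < 1)%R -> mob_den c e x z <> 0.
Proof.
  intros Hc He H. apply Cmod_gt_0.
  eapply Rlt_le_trans; [|apply (mob_den_bound c e x z _ He (Rle_refl _))].
  apply Rmult_lt_0_compat; [lra|]. now apply Cmod_gt_0.
Qed.

Lemma unit_disc_mult_lt (x z : C) :
  unit_disc z -> (Cmod x <= 1)%R -> (Cmod z * Cmod x < 1)%R.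
Proof.
  unfold unit_disc. intros Hz Hx. assert (P1 := Cmod_ge_0 z). nra.
Qed.

(* Moebius maps [x |-> (a + b x) / (c + z e x)] depending analytically on [z], of determinant
   [kappa z ^ k] and with poles outside the disc of radius [1 / |z|]. In the last condition,
   the quantity with positive real part is [1 + z E'' / E'] for
   [E' = z ^ k / (c + z e x) ^ 2]. *)
Record mobius_family (k : nat) (kappa : C) (a b c e : C -> C) : Prop := {
  mf_kappa : kappa <> 0;
  mf_a : analytic_on unit_disc a;
  mf_b : analytic_on unit_disc b;
  mf_c : analytic_on unit_disc c;
  mf_e : analytic_on unit_disc e;
  mf_c_neq_0 : forall z, unit_disc z -> c z <> 0;
  mf_e_le_c : forall z, unit_disc z -> (Cmod (e z) <= Cmod (c z))%R;
  mf_det : forall z, unit_disc z -> b z * c z - a z * (z * e z) = kappa * z ^ k;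
  mf_starlike : forall x z, (Cmod x <= 1)%R -> unit_disc z ->
    (0 < Re (INR (S k) - 2 * (z * C_derive (mob_den c e x) z / mob_den c e x z)))%R
}.

Section MobiusFamily.

Variables (k : nat) (kappa z0 : C) (a b c e : C -> C).
Hypothesis HM : mobius_family k kappa a b c e.
Hypothesis Hz0 : unit_disc z0.
Hypothesis Hz00 : z0 <> 0.

Let Hkappa := mf_kappa _ _ _ _ _ _ HM.
Let Ha := mf_a _ _ _ _ _ _ HM.
Let Hb := mf_b _ _ _ _ _ _ HM.
Let Hc := mf_c _ _ _ _ _ _ HM.
Let He := mf_e _ _ _ _ _ _ HM.
Let Hc0 := mf_c_neq_0 _ _ _ _ _ _ HM.
Let Hec := mf_e_le_c _ _ _ _ _ _ HM.
Let Hdet := mf_det _ _ _ _ _ _ HM.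
Let Hstar := mf_starlike _ _ _ _ _ _ HM.

Local Notation mob_den := (mob_den c e).
Local Notation mob := (mob a b c e).

Let Hden_neq_0 (x z : C) : unit_disc z -> (Cmod z * Cmod x < 1)%R -> mob_den x z <> 0.
Proof. intros Hz. apply mob_den_neq_0; auto. Qed.

Lemma analytic_on_mob_den (chi : C -> C) :
  analytic_on unit_disc chi -> analytic_on unit_disc (fun z => mob_den (chi z) z).
Proof.
  intros Hchi. apply analytic_on_plus; [easy|].
  apply analytic_on_mult; [|easy]. apply analytic_on_mult; [apply analytic_on_id|easy].
Qed.

Lemma analytic_on_mob (chi : C -> C) :
  analytic_on unit_disc chi -> (forall z, unit_disc z -> (Cmod (chi z) <= 1)%R) ->
  analytic_on unit_disc (fun z => mob (chi z) z).
Proof.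
  intros Hchi H. apply analytic_on_div.
  - apply analytic_on_plus; [easy|]. now apply analytic_on_mult.
  - now apply analytic_on_mob_den.
  - intros z Hz. apply Hden_neq_0; [easy|]. now apply unit_disc_mult_lt; [|apply H].
Qed.

Definition mobint (x : C) : C := Cint (mob x) z0.
(** The derivative of a Moebius map is its determinant, here [kappa z ^ k], over the square of its
    denominator. *)
Definition dmobint (x : C) : C :=
  Cint (fun z => z ^ k * (kappa / (mob_den x z * mob_den x z))) z0.

Lemma mob_remainder (x h z : C) :
  unit_disc z -> mob_den x z <> 0 -> mob_den (x + h) z <> 0 ->
  mob (x + h) z - mob x z - z ^ k * (kappa / (mob_den x z * mob_den x z)) * h =
  - (kappa * z ^ k * (z * e z / mob_den x z) * (/ mob_den x z) * (/ mob_den (x + h) z) * (h * h)).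
Proof.
  intros Hz H1 H2.
  replace (z ^ k * (kappa / (mob_den x z * mob_den x z))) with
    ((b z * c z - a z * (z * e z)) / (mob_den x z * mob_den x z))
    by (rewrite Hdet by easy; field; easy).
  rewrite <- Hdet by easy.
  unfold mob, mob_den in *. field. easy.
Qed.

(** The range [|x| < 1 / |z0|] reaches beyond the closed unit disc, which gives analyticity in a
    neighbourhood of it. The exact remainder of [mob_remainder] is bounded uniformly on the segment
    from [0] to [z0]. *)
Lemma is_Cderive_mobint (x : C) :
  (Cmod z0 * Cmod x < 1)%R -> is_Cderive mobint x (dmobint x).
Proof.
  intros Hx.
  assert (Hm0 := proj1 (Cmod_gt_0 z0) Hz00).
  (* [rho] is the midpoint of [|z0| |x|] and [1], and [d] solves [|z0| (|x| + d) = rho]; all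
     denominators are then at least [(1 - rho) |c|] in modulus. *)
  set (rho := ((1 + Cmod z0 * Cmod x) / 2)%R).
  set (d := ((1 - Cmod z0 * Cmod x) / (2 * Cmod z0))%R).
  assert (Hrho : (Cmod z0 * Cmod x < rho < 1)%R) by (unfold rho; lra).
  assert (Hd : (0 < d)%R) by (apply Rdiv_lt_0_compat; lra).
  assert (Hxh : forall h, (Cmod h < d)%R -> (Cmod z0 * Cmod (x + h) <= rho)%R).
  { intros h Hh. apply Rle_trans with (Cmod z0 * (Cmod x + d))%R.
    - apply Rmult_le_compat_l; [lra|]. assert (T := Cmod_triangle x h). lra.
    - apply Req_le. unfold d, rho. field. lra. }
  assert (Hseg : forall t : R, (0 <= t <= 1)%R -> unit_disc (t * z0) /\ (Cmod (t * z0) <= Cmod z0)%R).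
  { intros t Ht. split; [now apply unit_disc_scale|].
    rewrite Cmod_mult, Cmod_R, Rabs_right by lra. nra. }
  assert (Hseg2 : forall y (t : R), (0 <= t <= 1)%R -> (Cmod z0 * Cmod y <= rho)%R ->
            (Cmod (t * z0) * Cmod y <= rho)%R).
  { intros y t Ht Hy. eapply Rle_trans; [|exact Hy].
    apply Rmult_le_compat_r; [apply Cmod_ge_0|]. now apply Hseg. }
  assert (Hden : forall y (t : R), (0 <= t <= 1)%R -> (Cmod z0 * Cmod y <= rho)%R ->
            mob_den y (t * z0) <> 0).
  { intros y t Ht Hy. apply Hden_neq_0; [now apply Hseg|].
    eapply Rle_lt_trans; [now apply Hseg2|]. lra. }
  assert (Hcont : forall (f : C -> C) (t : R), (0 <= t <= 1)%R -> analytic_on unit_disc f ->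
            Ccontinuous (fun t : R => f (t * z0)) t).
  { intros f t Ht Hf. apply (Ccontinuous_comp f (fun t : R => t * z0)); [apply Ccontinuous_ray|].
    apply (analytic_on_continuous unit_disc); [easy|now apply Hseg]. }
  assert (Hdc : forall y (t : R), (0 <= t <= 1)%R ->
            Ccontinuous (fun t : R => mob_den y (t * z0)) t).
  { intros y t Ht. apply (Hcont (mob_den y)); [easy|].
    apply (analytic_on_mob_den (fun _ => y)), analytic_on_const. }
  destruct (Ccontinuous_bounded (fun t : R => / c (t * z0)) 0 1 ltac:(lra)) as [Bc [HBc0 HBc]].
  { intros t Ht. apply Ccontinuous_inv; [now apply Hcont|]. now apply Hc0, Hseg. }
  assert (Hinv : forall y (t : R), (0 <= t <= 1)%R -> (Cmod z0 * Cmod y <= rho)%R ->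
            (Cmod (/ mob_den y (t * z0)) <= / (1 - rho) * Bc)%R).
  { intros y t Ht Hy. rewrite Cmod_inv by now apply Hden.
    assert (Hcp : (0 < Cmod (c (t * z0)%C))%R) by now apply Cmod_gt_0, Hc0, Hseg.
    apply Rle_trans with (/ ((1 - rho) * Cmod (c (t * z0)%C)))%R.
    - apply Rinv_le_contravar; [apply Rmult_lt_0_compat; lra|].
      apply mob_den_bound; [now apply Hec, Hseg|now apply Hseg2].
    - rewrite Rinv_mult. apply Rmult_le_compat_l; [apply Rlt_le, Rinv_0_lt_compat; lra|].
      rewrite <- Cmod_inv by now apply Hc0, Hseg. now apply HBc. }
  assert (Hq : forall (t : R), (0 <= t <= 1)%R ->
            (Cmod (t * z0 * e (t * z0)%C / mob_den x (t * z0)) <= / (1 - rho))%R).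
  { intros t Ht. rewrite Cmod_div by (apply Hden; [easy|lra]).
    assert (Hdx := mob_den_bound c e x (t * z0) rho (Hec _ (proj1 (Hseg t Ht))) (Hseg2 x t Ht ltac:(lra))).
    assert (Hcp : (0 < Cmod (c (t * z0)%C))%R) by now apply Cmod_gt_0, Hc0, Hseg.
    assert (Hdp : (0 < (1 - rho) * Cmod (c (t * z0)%C))%R) by (apply Rmult_lt_0_compat; lra).
    apply Rle_div_l; [lra|].
    apply Rle_trans with (Cmod (c (t * z0)%C)).
    - rewrite Cmod_mult. assert (H := Hec _ (proj1 (Hseg t Ht))).
      destruct (Hseg t Ht) as [S1 _]. unfold unit_disc in S1. assert (P' := Cmod_ge_0 (t * z0)). nra.
    - apply (Rmult_le_reg_l (1 - rho)); [lra|].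
      rewrite <- Rmult_assoc, Rinv_r, Rmult_1_l by lra. exact Hdx. }
  (* The product follows the factors of [mob_remainder]: [|z ^ k| <= 1], the quotient
     [z e / mob_den] is at most [1 / (1 - rho)], and each inverse denominator at most
     [Bc / (1 - rho)]. *)
  set (M := (Cmod z0 * (Cmod kappa * / (1 - rho) * (/ (1 - rho) * Bc) * (/ (1 - rho) * Bc)))%R).
  assert (Hi : (0 < / (1 - rho))%R) by (apply Rinv_0_lt_compat; lra).
  assert (Hk0 := Cmod_ge_0 kappa).
  apply (is_Cderive_CInt_param (fun y (t : R) => z0 * mob y (t * z0)) _ 0 1 x M d).
  - lra.
  - unfold M. repeat apply Rmult_le_pos; lra.
  - exact Hd.
  - intros h t Hh Ht. apply Ccontinuous_mult; [apply continuous_const|].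
    apply Ccontinuous_div; [|now apply Hdc|apply Hden; [easy|now apply Hxh]].
    apply Ccontinuous_plus; [now apply Hcont|].
    apply Ccontinuous_mult; [now apply Hcont|apply continuous_const].
  - intros t Ht. apply Ccontinuous_mult; [apply continuous_const|].
    apply Ccontinuous_mult; [apply Ccontinuous_pow, Ccontinuous_ray|].
    apply Ccontinuous_div; [apply continuous_const|apply Ccontinuous_mult; now apply Hdc|].
    apply Cmult_neq_0; apply Hden; (easy || lra).
  - intros h t Hh Ht. cbv beta.
    set (z := t * z0).
    replace (z0 * mob (x + h) z - z0 * mob x z -
       z0 * (z ^ k * (kappa / (mob_den x z * mob_den x z))) * h)
      with (z0 * (mob (x + h) z - mob x z - z ^ k * (kappa / (mob_den x z * mob_den x z)) * h))
      by ring.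
    rewrite mob_remainder; [|now apply Hseg|apply Hden; (easy || lra)|apply Hden; [easy|now apply Hxh]].
    assert (I1 := Hinv x t Ht ltac:(lra)). assert (I2 := Hinv (x + h) t Ht (Hxh h Hh)).
    assert (I3 := Hq t Ht). fold z in I1, I2, I3.
    assert (Hzk : (0 <= Cmod z ^ k <= 1)%R).
    { split; [apply pow_le, Cmod_ge_0|]. rewrite <- (pow1 k). apply pow_incr.
      split; [apply Cmod_ge_0|]. now apply Rlt_le, Hseg. }
    set (q := z * e z / mob_den x z) in *.
    set (u := / mob_den x z) in *. set (v := / mob_den (x + h) z) in *.
    rewrite Cmod_mult, Cmod_opp, !Cmod_mult, Cmod_pow.
    unfold M. rewrite (Rmult_assoc (Cmod z0)).
    apply Rmult_le_compat_l; [lra|].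
    apply Rmult_le_compat_r; [apply Rle_0_sqr|].
    assert (Pq := Cmod_ge_0 q). assert (Pu := Cmod_ge_0 u). assert (Pv := Cmod_ge_0 v).
    assert (K1 : (0 <= Cmod kappa * Cmod z ^ k <= Cmod kappa)%R) by nra.
    assert (K2 : (0 <= Cmod kappa * Cmod z ^ k * Cmod q <= Cmod kappa * / (1 - rho))%R).
    { split; [now apply Rmult_le_pos|now apply Rmult_le_compat]. }
    assert (K3 : (0 <= Cmod kappa * Cmod z ^ k * Cmod q * Cmod u)%R) by now apply Rmult_le_pos.
    apply Rmult_le_compat; try easy. now apply Rmult_le_compat.
Qed.

Section Extremal.

Variables (eps : C) (chi : C -> C).
Hypothesis Heps : (Cmod eps <= 1)%R.

(** The derivative of the Moebius map at [eps] is [z ^ k W z]; the solution [N] of Euler's equation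
    for [W] satisfies [dmobint eps = z0 ^ (k + 1) N z0]. *)
Let W (z : C) : C := kappa / (mob_den eps z * mob_den eps z).

Let den_neq_0 (z : C) : unit_disc z -> mob_den eps z <> 0.
Proof. intros Hz. apply Hden_neq_0; [easy|now apply unit_disc_mult_lt]. Qed.

Let analytic_den : analytic_on unit_disc (mob_den eps).
Proof. apply (analytic_on_mob_den (fun _ => eps)), analytic_on_const. Qed.

Let analytic_W : analytic_on unit_disc W.
Proof.
  apply analytic_on_div; [apply analytic_on_const|now apply analytic_on_mult|].
  intros z Hz. now apply Cmult_neq_0; apply den_neq_0.
Qed.

Let W_neq_0 (z : C) : unit_disc z -> W z <> 0.
Proof.
  intros Hz E. assert (H := den_neq_0 z Hz). apply Hkappa.
  transitivity (W z * (mob_den eps z * mob_den eps z)); [unfold W; field; easy|rewrite E; ring].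
Qed.

Let W_starlike (z : C) : unit_disc z -> (0 < Re (INR (S k) + z * C_derive W z / W z))%R.
Proof.
  intros Hz. assert (H := den_neq_0 z Hz). assert (HW := W_neq_0 z Hz).
  assert (dD := analytic_on_C_derive _ _ _ analytic_den Hz).
  assert (D : C_derive W z = - 2 * C_derive (mob_den eps) z / mob_den eps z * W z).
  { apply is_C_derive_unique. eapply is_Cderive_eq.
    - exact (is_Cderive_div (fun _ => kappa) (fun z => mob_den eps z * mob_den eps z) _ _ _
        (is_Cderive_const kappa z) (is_Cderive_mult _ _ _ _ _ dD dD) (Cmult_neq_0 _ _ H H)).
    - unfold W. cbv beta. field. easy. }
  replace (INR (S k) + z * C_derive W z / W z)
    with (INR (S k) - 2 * (z * C_derive (mob_den eps) z / mob_den eps z));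
    [now apply Hstar|].
  rewrite D. field. easy.
Qed.

(** The positive real part of [N / W] excludes zeros of [N]. *)
Lemma dmobint_neq_0 : dmobint eps <> 0.
Proof.
  destruct (euler_equation k W analytic_W) as [N [HN [EN IN]]].
  change (Cint (fun w => w ^ k * W w) z0 <> 0). rewrite IN by easy.
  apply Cmult_neq_0; [now apply Cpow_nz|].
  now apply (euler_neq_0 k W N).
Qed.

Hypothesis Heps0 : eps <> 0.
Hypothesis Hchi : analytic_on unit_disc chi.
Hypothesis Hchi_le : forall z, unit_disc z -> (Cmod (chi z) <= Cmod eps)%R.

(* The ratio is [P / N] in the notation of [euler_quotient_nonneg], for the right-hand side
   [q = (M(eps) - M(chi)) / (eps M'(eps))], which takes values in the right half-plane since
   each Moebius map sends the unit disc onto a disc. *)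
Lemma mobint_support :
  (0 <= Re ((mobint eps - Cint (fun z => mob (chi z) z) z0) / (eps * dmobint eps)))%R /\
  (Re ((mobint eps - Cint (fun z => mob (chi z) z) z0) / (eps * dmobint eps)) = 0%R ->
   forall z, unit_disc z -> chi z = eps).
Proof.
  assert (Hle1 : forall z, unit_disc z -> (Cmod (chi z) <= 1)%R).
  { intros z Hz. eapply Rle_trans; [now apply Hchi_le|easy]. }
  assert (Hden : forall z, unit_disc z -> mob_den (chi z) z <> 0).
  { intros z Hz. apply Hden_neq_0; [easy|]. apply unit_disc_mult_lt; [easy|now apply Hle1]. }
  (* The difference of two values of a Moebius map is the determinant times [eps - chi] over the
     product of the denominators. The determinant cancels in the quotient, which is therefore
     analytic at [0] as well. *)
  set (q := fun z => (eps - chi z) * mob_den eps z / (eps * mob_den (chi z) z)).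
  assert (Hq : analytic_on unit_disc q).
  { apply analytic_on_div.
    - apply analytic_on_mult; [|easy]. apply analytic_on_minus; [apply analytic_on_const|easy].
    - apply analytic_on_scal. now apply analytic_on_mob_den.
    - intros z Hz. apply Cmult_neq_0; [easy|now apply Hden]. }
  assert (Hme := proj1 (Cmod_gt_0 eps) Heps0).
  assert (Hq2 : forall z, unit_disc z ->
     (0 <= Re (q z))%R /\ (Re (q z) = 0%R -> chi z = eps)).
  { intros z Hz. assert (Hcz := Hc0 z Hz). assert (Hdz := Hden z Hz).
    assert (Hmc := proj1 (Cmod_gt_0 (c z)) Hcz).
    (* In these variables [q = (1 - x) (1 + y) / (1 + y x)]; [|y| < 1] follows from [|e| <= |c|] and
       [|z eps| < 1]. *)
    set (x := chi z / eps). set (y := z * e z * eps / c z).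
    assert (Hx : (Cmod x <= 1)%R).
    { unfold x. rewrite Cmod_div by easy. apply Rle_div_l; [easy|]. rewrite Rmult_1_l. now apply Hchi_le. }
    assert (Hy : (Cmod y < 1)%R).
    { unfold y. rewrite Cmod_div, !Cmod_mult by easy. apply Rlt_div_l; [easy|].
      assert (H1 := unit_disc_mult_lt eps z Hz Heps). assert (H2 := Hec z Hz). assert (P2 := Cmod_ge_0 z). 
      replace (Cmod z * Cmod (e z) * Cmod eps)%R with (Cmod z * Cmod eps * Cmod (e z))%R by ring.
      apply Rle_lt_trans with (Cmod z * Cmod eps * Cmod (c z))%R.
      - apply Rmult_le_compat_l; [apply Rmult_le_pos; lra|easy].
      - apply Rmult_lt_compat_r; easy. }
    assert (E : q z = (1 - x) * (1 + y) / (1 + y * x)).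
    { assert (H : 1 + y * x <> 0).
      { apply one_plus_neq_0. rewrite Cmod_mult. assert (P2 := Cmod_ge_0 y). nra. }
      unfold q, x, y, mob_den in *. field. now repeat split. }
    rewrite E. destruct (mobius_halfplane x y Hx Hy) as [H1 H2].
    split; [exact H1|]. intros H0. specialize (H2 H0).
    transitivity (x * eps); [unfold x; field; easy|rewrite H2; ring]. }
  assert (HWq : analytic_on unit_disc (fun z => W z * q z)) by now apply analytic_on_mult.
  destruct (euler_equation k W analytic_W) as [N [HN [EN IN]]].
  destruct (euler_equation k (fun z => W z * q z) HWq) as [P [HP [EP IP]]].
  assert (N0 := euler_neq_0 k W N analytic_W W_neq_0 W_starlike HN EN z0 Hz0).
  assert (Hz0k : z0 ^ S k <> 0) by now apply Cpow_nz.
  assert (E : (mobint eps - Cint (fun z => mob (chi z) z) z0) / (eps * dmobint eps) = P z0 / N z0).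
  { replace (dmobint eps) with (z0 ^ S k * N z0) by (symmetry; exact (IN z0 Hz0)).
    replace (mobint eps - Cint (fun z => mob (chi z) z) z0) with (eps * (z0 ^ S k * P z0)).
    { field. easy. }
    rewrite <- IP by easy. unfold mobint.
    rewrite Cint_minus; [| |now apply analytic_on_mob|easy].
    2:{ now apply (analytic_on_mob (fun _ => eps)); [apply analytic_on_const|]. }
    rewrite Cint_scal; [|apply analytic_on_mult; [apply analytic_on_pow|easy]|easy].
    apply Cint_ext; [easy|]. intros z Hz _.
    assert (Hdz := Hden z Hz). assert (Hez := den_neq_0 z Hz). 
    unfold q, W.
    transitivity (kappa * z ^ k * ((eps - chi z) / (mob_den eps z * mob_den (chi z) z))).
    { field. easy. }
    rewrite <- Hdet by easy. unfold mob, mob_den in *. field. easy. }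
  rewrite E. split.
  - apply (euler_quotient_nonneg k W N analytic_W W_neq_0 W_starlike HN EN q P); try easy.
    intros z Hz. now apply Hq2.
  - intros H0 z Hz. apply (Hq2 z Hz).
    apply (euler_quotient_zero k W N analytic_W W_neq_0 W_starlike HN EN q P) with z0; try easy.
    intros w Hw. now apply Hq2.
Qed.

End Extremal.

(** * Geometry and range of the functional *)

Lemma closed_disc_mult_lt (x : C) : closed_disc 1 x -> (Cmod z0 * Cmod x < 1)%R.
Proof. now apply unit_disc_mult_lt. Qed.

Lemma closed_disc_mono (r s : R) (x : C) : (r <= s)%R -> closed_disc r x -> closed_disc s x.
Proof. unfold closed_disc. lra. Qed.

(** The point of larger modulus serves as [eps], the other one as the constant function [chi]. Equal
    values are an equality case of [mobint_support]. *)
Lemma mobint_injective : injective_on (closed_disc 1) mobint.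
Proof.
  assert (main : forall x y, (Cmod x <= Cmod y)%R -> (Cmod y <= 1)%R ->
            mobint x = mobint y -> x = y).
  { intros x y Hxy Hy E. destruct (Ceq_dec y 0) as [->|Hy0].
    - apply Cmod_eq_0. rewrite Cmod_0 in Hxy. apply Rle_antisym; [easy|apply Cmod_ge_0].
    - destruct (mobint_support y (fun _ => x) Hy Hy0 (analytic_on_const _ x) (fun _ _ => Hxy))
        as [_ H].
      apply H with (RtoC 0); [|apply unit_disc_0].
      change (Cint (fun z => mob x z) z0) with (mobint x). rewrite E.
      replace ((mobint y - mobint y) / (y * dmobint y)) with (RtoC 0); [easy|].
      unfold Cdiv. ring. }
  intros x y Hx Hy E. destruct (Rle_lt_dec (Cmod x) (Cmod y)).
  - now apply main.
  - symmetry. apply main; [lra|exact Hx|easy].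
Qed.

Lemma mobint_closed_disc_convex (rho : R) :
  (0 < rho <= 1)%R -> convex_set (image (closed_disc rho) mobint).
Proof.
  intros Hrho.
  assert (Hsub : forall x, closed_disc rho x -> closed_disc 1 x)
    by (intros x; apply closed_disc_mono; lra).
  apply (image_closed_disc_convex mobint dmobint); [lra| | |].
  - intros x Hx. apply is_Cderive_mobint, closed_disc_mult_lt. now apply Hsub.
  - intros x Hx. apply dmobint_neq_0. now apply Hsub.
  - intros eps x Heps Hx.
    apply (mobint_support eps (fun _ => x)).
    + lra.
    + apply Cmod_gt_0. lra.
    + apply analytic_on_const.
    + intros z _. rewrite Heps. exact Hx.
Qed.

(** Two points of the open disc lie in a closed disc of radius [rho < 1]; the bound [1 / 2] keeps
    [rho] positive. *)
Lemma mobint_disc_convex : convex_set (image unit_disc mobint).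
Proof.
  intros u v t [x [Hx Ex]] [y [Hy Ey]] Ht. unfold unit_disc in Hx, Hy.
  set (rho := Rmax (/ 2) (Rmax (Cmod x) (Cmod y))).
  assert (H1 : (/ 2 <= rho)%R) by apply Rmax_l.
  assert (H2 : (rho < 1)%R) by (repeat apply Rmax_case; lra).
  destruct (mobint_closed_disc_convex rho ltac:(lra) u v t) as [w [Hw Ew]].
  - exists x. split; [|easy]. unfold closed_disc, rho.
    eapply Rle_trans; [|apply Rmax_r]. apply Rmax_l.
  - exists y. split; [|easy]. unfold closed_disc, rho.
    eapply Rle_trans; [|apply Rmax_r]. apply Rmax_r.
  - easy.
  - exists w. split; [|easy]. now apply (closed_disc_unit_disc rho).
Qed.

Let derive_closed_disc (x : C) : closed_disc 1 x -> is_Cderive mobint x (dmobint x).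
Proof. intros Hx. now apply is_Cderive_mobint, closed_disc_mult_lt. Qed.

Let dmobint_closed_disc (x : C) : closed_disc 1 x -> dmobint x <> 0.
Proof. intros Hx. now apply dmobint_neq_0. Qed.

Lemma mobint_domain : domain (image unit_disc mobint).
Proof.
  split; [|split].
  - exists (mobint 0), 0. split; [apply unit_disc_0|easy].
  - apply open_iff. intros z [x [Hx <-]].
    exact (image_disc_open mobint dmobint 1 Rlt_0_1 derive_closed_disc dmobint_closed_disc
             mobint_injective x Hx).
  - apply convex_connected, mobint_disc_convex.
Qed.

Lemma mobint_closed_jordan_domain : closed_jordan_domain (image (closed_disc 1) mobint).
Proof.
  apply (image_closed_jordan_domain mobint dmobint 1 Rlt_0_1 derive_closed_disc
           dmobint_closed_disc mobint_injective).
  apply mobint_closed_disc_convex. lra.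
Qed.

Lemma mobint_range (chi : C -> C) :
  analytic_on unit_disc chi -> (forall z, unit_disc z -> (Cmod (chi z) <= 1)%R) ->
  image (closed_disc 1) mobint (Cint (fun z => mob (chi z) z) z0).
Proof.
  intros Hchi Hle.
  apply (support_image mobint dmobint 1 Rlt_0_1 derive_closed_disc dmobint_closed_disc).
  intros eps Heps. apply mobint_support; try easy.
  - lra.
  - apply Cmod_gt_0. lra.
  - intros z Hz. rewrite Heps. now apply Hle.
Qed.

Lemma mobint_extremal (eps : C) (chi : C -> C) :
  Cmod eps = 1%R -> analytic_on unit_disc chi ->
  (forall z, unit_disc z -> (Cmod (chi z) <= 1)%R) ->
  Cint (fun z => mob (chi z) z) z0 = mobint eps ->
  forall z, unit_disc z -> chi z = eps.
Proof.
  intros Heps Hchi Hle E.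
  assert (Heps0 : eps <> 0) by (apply Cmod_gt_0; lra).
  rewrite <- Heps in Hle.
  apply (mobint_support eps chi (Req_le _ _ Heps) Heps0 Hchi Hle).
  rewrite E. replace ((mobint eps - mobint eps) / (eps * dmobint eps)) with (RtoC 0); [easy|].
  unfold Cdiv. ring.
Qed.

End MobiusFamily.

(** * The class CV *)

(* The value of [f'' / f'] for [f] in [CV A B] with subordinating function [z * phi z]. *)
Definition pre_schwarzian (A B : C) (phi : C -> C) (z : C) : C :=
  (A - B) * phi z / (1 + B * z * phi z).

Lemma pre_schwarzian_denom (B z x : C) :
  (Cmod B <= 1)%R -> unit_disc z -> (Cmod x <= 1)%R -> 1 + B * z * x <> 0.
Proof.
  intros HB Hz Hx. apply one_plus_neq_0. rewrite !Cmod_mult. unfold unit_disc in Hz.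
  assert (P1 := Cmod_ge_0 B). assert (P2 := Cmod_ge_0 z).
  assert (Cmod B * Cmod z <= 1 * Cmod z)%R by (apply Rmult_le_compat_r; lra).
  assert (Cmod B * Cmod z * Cmod x <= Cmod B * Cmod z * 1)%R
    by (apply Rmult_le_compat_l; [apply Rmult_le_pos|]; lra).
  lra.
Qed.

Lemma analytic_on_pre_schwarzian (A B : C) (phi : C -> C) :
  (Cmod B <= 1)%R -> analytic_on unit_disc phi ->
  (forall z, unit_disc z -> (Cmod (phi z) <= 1)%R) ->
  analytic_on unit_disc (pre_schwarzian A B phi).
Proof.
  intros HB Hphi Hle. apply analytic_on_div.
  - now apply analytic_on_scal.
  - apply analytic_on_plus; [apply analytic_on_const|].
    apply analytic_on_mult; [|easy]. apply analytic_on_scal, analytic_on_id.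
  - intros z Hz. apply pre_schwarzian_denom; auto.
Qed.

Lemma CV_is_log_branch (A B : C) (f : C -> C) :
  CV A B f -> is_log_branch (C_derive f) (Cint (fun z => C_derive (C_derive f) z / C_derive f z)).
Proof.
  intros [Hf [_ [H1 [Hn _]]]].
  apply is_log_branch_Cint; [now apply analytic_on_derive| |easy].
  now apply Ceq_minus.
Qed.

Lemma CV_log_deriv (A B : C) (f : C -> C) (z : C) :
  CV A B f -> unit_disc z ->
  log_deriv f z = Cint (fun z => C_derive (C_derive f) z / C_derive f z) z.
Proof. intros Hf. now apply log_branch_eq, (CV_is_log_branch A B). Qed.

(** The exponential of the logarithm recovers [f'], so uniqueness of extremal functions can be read
    off from [log f']. *)
Lemma CV_eq_integral (A B : C) (f L : C -> C) (z : C) :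
  CV A B f -> (forall w, unit_disc w -> log_deriv f w = L w) -> unit_disc z ->
  f z = Cint (fun w => Cexp (L w)) z.
Proof.
  intros Hf HL Hz.
  destruct (CV_is_log_branch A B f Hf) as [HA [_ HE]].
  assert (Hexp : forall w, unit_disc w -> Cexp (L w) = C_derive f w).
  { intros w Hw. rewrite <- HL, (CV_log_deriv A B) by easy. now apply HE. }
  destruct Hf as [Hf [H0 _]].
  apply (Cint_unique f); try easy.
  - intros w Hw. rewrite Hexp by easy. now apply (analytic_on_C_derive unit_disc).
  - apply (analytic_on_ext_disc (C_derive f)); [intros; now rewrite Hexp|].
    now apply analytic_on_derive.
Qed.

Lemma analytic_on_Cexp (L : C -> C) :
  analytic_on unit_disc L -> analytic_on unit_disc (fun z => Cexp (L z)).
Proof. intros HL z Hz. eexists. now apply is_Cderive_Cexp_comp, (analytic_on_C_derive unit_disc). Qed.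

Lemma C_derive_integral_Cexp (f L : C -> C) (z : C) :
  analytic_on unit_disc L ->
  (forall z, unit_disc z -> f z = Cint (fun w => Cexp (L w)) z) ->
  unit_disc z -> is_Cderive f z (Cexp (L z)).
Proof.
  intros HL Hf Hz.
  apply (is_Cderive_ext_disc (Cint (fun w => Cexp (L w)))); [intros; now rewrite Hf|easy|].
  apply (is_Cderive_Cint (fun w => Cexp (L w))); [now apply analytic_on_Cexp|easy].
Qed.

Lemma log_deriv_integral_Cexp (f L : C -> C) (z : C) :
  analytic_on unit_disc L -> L 0 = 0 ->
  (forall z, unit_disc z -> f z = Cint (fun w => Cexp (L w)) z) ->
  unit_disc z -> log_deriv f z = L z.
Proof.
  intros HL L0 Hf. apply log_branch_eq. split; [easy|]. split; [easy|].
  intros w Hw. symmetry. now apply is_C_derive_unique, C_derive_integral_Cexp.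
Qed.

(** Schwarz's lemma writes the subordinating function as [z phi z]. Away from the origin the formula
    for [f'' / f'] comes from dividing by [z]; [analytic_eq_at_0] extends it to the origin, where
    [f' = 1], and this gives [a2 f]. *)
Lemma CV_representation (A B : C) (f : C -> C) :
  (Cmod B <= 1)%R -> CV A B f ->
  exists phi : C -> C, analytic_on unit_disc phi /\
    (forall z, unit_disc z -> (Cmod (phi z) <= 1)%R) /\
    (forall z, unit_disc z -> log_deriv f z = Cint (pre_schwarzian A B phi) z) /\
    a2 f = (A - B) * phi 0 / 2.
Proof.
  intros HB Hf. assert (Hf' := Hf).
  destruct Hf as [Hf [H0 [H1 [Hn [_ [omega [Ho [Ho1 [Ho0 Hsub]]]]]]]]].
  destruct (schwarz omega Ho) as [phi [Hphi [Ephi Hle]]]; [|easy|].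
  { intros z Hz. now apply Rlt_le, Ho1. }
  assert (Hdf := analytic_on_derive f Hf). assert (Hddf := analytic_on_derive _ Hdf).
  assert (Hpre := analytic_on_pre_schwarzian A B phi HB Hphi Hle).
  assert (Hne : forall z, unit_disc z -> z <> 0 ->
            C_derive (C_derive f) z / C_derive f z = pre_schwarzian A B phi z).
  { intros z Hz Hz0. assert (E := Hsub z Hz). unfold convexity_quotient, P_fun in E.
    rewrite Ephi in E by easy.
    assert (Hd := pre_schwarzian_denom B z (phi z) HB Hz (Hle z Hz)).
    replace (B * (z * phi z)) with (B * z * phi z) in E by ring.
    assert (Hnz := Hn z Hz).
    transitivity (/ z * ((1 + z * C_derive (C_derive f) z / C_derive f z) - 1)); [field; easy|].
    rewrite E. unfold pre_schwarzian. field. easy. }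
  exists phi. split; [easy|]. split; [easy|]. split.
  - intros z Hz. rewrite (CV_log_deriv A B) by easy. now apply Cint_ext.
  - assert (E := analytic_eq_at_0 _ _ (analytic_on_div _ _ _ Hddf Hdf Hn) Hpre Hne).
    cbv beta in E. apply Ceq_minus in H1. rewrite H1 in E. unfold a2.
    replace (C_derive (C_derive f) 0) with (pre_schwarzian A B phi 0) by (rewrite <- E; field).
    unfold pre_schwarzian. rewrite Cmult_0_r, Cmult_0_l, Cplus_0_r. field.
Qed.

Lemma CV_construction (A B : C) (phi : C -> C) :
  (Cmod B <= 1)%R -> analytic_on unit_disc phi ->
  (forall z, unit_disc z -> (Cmod (phi z) <= 1)%R) ->
  exists f : C -> C, CV A B f /\ a2 f = (A - B) * phi 0 / 2 /\
    forall z, unit_disc z -> log_deriv f z = Cint (pre_schwarzian A B phi) z.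
Proof.
  intros HB Hphi Hle.
  assert (Hpre := analytic_on_pre_schwarzian A B phi HB Hphi Hle).
  set (g := pre_schwarzian A B phi) in *.
  assert (HL := analytic_on_Cint g Hpre). set (L := Cint g) in *.
  set (f := Cint (fun w => Cexp (L w))).
  assert (Hf : forall z, unit_disc z -> is_Cderive f z (Cexp (L z)))
    by (intros z; now apply C_derive_integral_Cexp).
  assert (D1 : forall z, unit_disc z -> C_derive f z = Cexp (L z))
    by (intros z Hz; now apply is_C_derive_unique, Hf).
  assert (D2 : forall z, unit_disc z -> C_derive (C_derive f) z = Cexp (L z) * g z).
  { intros z Hz. apply is_C_derive_unique.
    apply (is_Cderive_ext_disc (fun w => Cexp (L w))); [intros; now rewrite D1|easy|].
    apply is_Cderive_Cexp_comp. now apply is_Cderive_Cint. }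
  assert (L0 : L 0 = 0) by apply Cint_0.
  assert (Hcq : forall z, unit_disc z -> convexity_quotient f z = 1 + z * g z).
  { intros z Hz. unfold convexity_quotient. rewrite D1, D2 by easy.
    assert (N := Cexp_neq_0 (L z)). field. easy. }
  exists f. split; [|split].
  - split; [intros z Hz; eexists; now apply Hf|].
    split; [apply Cint_0|]. split; [|split; [|split]].
    + rewrite D1, L0, Cexp_0 by apply unit_disc_0. ring.
    + intros z Hz. rewrite D1 by easy. apply Cexp_neq_0.
    + apply (analytic_on_ext_disc (fun z => 1 + z * g z)); [intros; now rewrite Hcq|].
      apply analytic_on_plus; [apply analytic_on_const|].
      apply (analytic_on_mult unit_disc (fun z => z)); [apply analytic_on_id|easy].
    + exists (fun z => z * phi z). split; [|split; [|split]].
      * apply (analytic_on_mult unit_disc (fun z => z)); [apply analytic_on_id|easy].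
      * intros z Hz. unfold unit_disc. rewrite Cmod_mult. apply unit_disc_mult_lt; auto.
      * ring.
      * intros z Hz. rewrite Hcq by easy. unfold g, pre_schwarzian, P_fun.
        assert (Hd := pre_schwarzian_denom B z (phi z) HB Hz (Hle z Hz)).
        replace (B * (z * phi z)) with (B * z * phi z) by ring. field. easy.
  - unfold a2. rewrite D2, L0, Cexp_0 by apply unit_disc_0.
    unfold g, pre_schwarzian. rewrite Cmult_0_r, Cmult_0_l, Cplus_0_r. field.
  - intros z Hz. now apply (log_deriv_integral_Cexp f L).
Qed.

Lemma image_ext (S : C -> Prop) (f g : C -> C) (w : C) :
  (forall z, S z -> f z = g z) -> image S f w -> image S g w.
Proof. intros H [z [Hz E]]. exists z. split; [easy|]. now rewrite <- H. Qed.

Lemma convex_set_iff (S T : C -> Prop) :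
  (forall w, S w <-> T w) -> convex_set S -> convex_set T.
Proof. intros H HS x y t Hx Hy Ht. apply H. apply HS; try easy; now apply H. Qed.

Lemma closed_jordan_domain_iff (S T : C -> Prop) :
  (forall w, S w <-> T w) -> closed_jordan_domain S -> closed_jordan_domain T.
Proof.
  intros H [J [HJ E]]. exists J. split; [easy|]. intros w. now rewrite <- H.
Qed.

Lemma half_plane_quotient (w : C) : (Cmod w < 1)%R -> (0 < Re ((1 - w) / (1 + w)))%R.
Proof.
  intros Hw. assert (Hn := one_plus_neq_0 w Hw). rewrite Re_div by easy.
  apply Cmod_gt_0 in Hn. apply Rdiv_lt_0_compat; [|now apply Rmult_lt_0_compat].
  apply Cmod_lt_1_sqr in Hw. destruct w as [x y]. simpl in *. nra.
Qed.

(** The constants [chi = x] in [(A - B) x / (1 + B z x)]. The starlikeness quantity is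
    [(1 - w) / (1 + w)] with [w = B z x]. *)
Lemma mobius_family_K (A B : C) :
  (Cmod B <= 1)%R -> A <> B ->
  mobius_family 0 (A - B) (fun _ => 0) (fun _ => A - B) (fun _ => 1) (fun _ => B).
Proof.
  intros HB HAB. split.
  - now apply Cminus_eq_contra.
  - apply analytic_on_const.
  - apply analytic_on_const.
  - apply analytic_on_const.
  - apply analytic_on_const.
  - intros z _. apply C1_nz.
  - intros z _. now rewrite Cmod_1.
  - intros z _. simpl. ring.
  - intros x z Hx Hz.
    assert (Hd := pre_schwarzian_denom B z x HB Hz Hx).
    assert (D : C_derive (mob_den (fun _ => 1) (fun _ => B) x) z = B * x).
    { apply is_C_derive_unique.
      apply (is_Cderive_ext_loc (fun z => 1 + B * x * z) _ _ _ 1); [lra| |apply is_Cderive_affine].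
      intros w _. unfold mob_den. ring. }
    rewrite D. unfold mob_den.
    replace (INR 1 - 2 * (z * (B * x) / (1 + z * B * x)))
      with ((1 - B * z * x) / (1 + B * z * x)).
    + apply half_plane_quotient. rewrite !Cmod_mult. unfold unit_disc in Hz.
      assert (P1 := Cmod_ge_0 B). assert (P2 := Cmod_ge_0 z).
      assert (Cmod B * Cmod z <= 1 * Cmod z)%R by (apply Rmult_le_compat_r; lra).
      assert (Cmod B * Cmod z * Cmod x <= Cmod B * Cmod z * 1)%R
        by (apply Rmult_le_compat_l; [apply Rmult_le_pos|]; lra).
      lra.
    + replace (z * B * x) with (B * z * x) by ring. simpl. field. easy.
Qed.

(** Both sides are integrals over the segment to [x z], rescaled to the segment to [z]. Thus [K] on
    the disc of radius [|z0|] becomes [mobint] on the closed unit disc. *)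
Lemma K_fun_mobint (A B z x : C) :
  K_fun A B (x * z) = mobint z (fun _ => 0) (fun _ => A - B) (fun _ => 1) (fun _ => B) x.
Proof.
  apply CInt_ext; [lra|]. intros t _. unfold mob, mob_den.
  replace (1 + B * (t * (x * z))) with (1 + t * z * B * x) by ring. unfold Cdiv. ring.
Qed.

Lemma K_fun_pre_schwarzian (A B x z : C) :
  K_fun A B (x * z) = Cint (pre_schwarzian A B (fun _ => x)) z.
Proof.
  apply CInt_ext; [lra|]. intros t _. unfold pre_schwarzian.
  replace (1 + B * (t * (x * z))) with (1 + B * (t * z) * x) by ring. unfold Cdiv. ring.
Qed.

Lemma analytic_on_K_fun (A B : C) : (Cmod B <= 1)%R -> analytic_on unit_disc (K_fun A B).
Proof.
  intros HB. apply analytic_on_Cint, analytic_on_div.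
  - apply analytic_on_const.
  - apply analytic_on_plus; [apply analytic_on_const|apply analytic_on_scal, analytic_on_id].
  - intros z Hz. rewrite <- (Cmult_1_r (B * z)). apply pre_schwarzian_denom; try easy.
    rewrite Cmod_1. lra.
Qed.

(** * The region of variability *)

Lemma mob_pre_schwarzian (A B : C) (phi : C -> C) (z : C) :
  mob (fun _ => 0) (fun _ => A - B) (fun _ => 1) (fun _ => B) (phi z) z
  = pre_schwarzian A B phi z.
Proof.
  unfold mob, mob_den, pre_schwarzian.
  replace (1 + z * B * phi z) with (1 + B * z * phi z) by ring. unfold Cdiv. ring.
Qed.

Section FirstPart.

Variables (A B : C).
Hypothesis HB : (Cmod B <= 1)%R.
Hypothesis HAB : A <> B.

Let Kint (z0 : C) : C -> C := mobint z0 (fun _ => 0) (fun _ => A - B) (fun _ => 1) (fun _ => B).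

Let HM := mobius_family_K A B HB HAB.

Lemma V_CV_mobint (z0 w : C) :
  unit_disc z0 -> z0 <> 0 -> (V_CV A B z0 w <-> image (closed_disc 1) (Kint z0) w).
Proof.
  intros Hz0 Hz00. split.
  - intros [f [Hf <-]]. destruct (CV_representation A B f HB Hf) as [phi [Hphi [Hle [E _]]]].
    rewrite E by easy.
    rewrite (Cint_ext _ (fun z => mob (fun _ => 0) (fun _ => A - B) (fun _ => 1) (fun _ => B) (phi z) z));
      [|easy|intros; now rewrite mob_pre_schwarzian].
    now apply (mobint_range _ _ _ _ _ _ _ HM).
  - intros [x [Hx <-]].
    destruct (CV_construction A B (fun _ => x) HB (analytic_on_const _ x) (fun _ _ => Hx))
      as [f [Hf [_ E]]].
    exists f. split; [easy|]. rewrite E by easy.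
    now rewrite <- K_fun_pre_schwarzian, K_fun_mobint.
Qed.

Lemma K_fun_image (z0 w : C) :
  z0 <> 0 ->
  (image (closed_disc (Cmod z0)) (K_fun A B) w <-> image (closed_disc 1) (Kint z0) w).
Proof.
  intros Hz00. assert (Hm := proj1 (Cmod_gt_0 z0) Hz00). unfold Kint. split.
  - intros [z [Hz <-]]. exists (z / z0). split.
    + unfold closed_disc in *. rewrite Cmod_div by easy. apply Rle_div_l; lra.
    + rewrite <- K_fun_mobint. f_equal. field. easy.
  - intros [x [Hx <-]]. exists (x * z0). split.
    + unfold closed_disc in *. rewrite Cmod_mult. rewrite <- (Rmult_1_l (Cmod z0)) at 2.
      apply Rmult_le_compat_r; lra.
    + apply K_fun_mobint.
Qed.

Lemma V_CV_K_fun (z0 w : C) :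
  unit_disc z0 -> z0 <> 0 ->
  (V_CV A B z0 w <-> image (closed_disc (Cmod z0)) (K_fun A B) w).
Proof. intros Hz0 Hz00. rewrite K_fun_image by easy. now apply V_CV_mobint. Qed.

Lemma V_CV_convex (z0 : C) : unit_disc z0 -> z0 <> 0 -> convex_set (V_CV A B z0).
Proof.
  intros Hz0 Hz00. apply (convex_set_iff (image (closed_disc 1) (Kint z0))).
  - intros w. symmetry. now apply V_CV_mobint.
  - apply (mobint_closed_disc_convex _ _ _ _ _ _ _ HM); try easy. lra.
Qed.

Lemma V_CV_closed_jordan_domain (z0 : C) :
  unit_disc z0 -> z0 <> 0 -> closed_jordan_domain (V_CV A B z0).
Proof.
  intros Hz0 Hz00. apply (closed_jordan_domain_iff (image (closed_disc 1) (Kint z0))).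
  - intros w. symmetry. now apply V_CV_mobint.
  - now apply (mobint_closed_jordan_domain _ _ _ _ _ _ _ HM).
Qed.

(** Any two points of the open disc lie in a closed disc of radius [r] with [0 < r < 1], where [K]
    is a rescaled [mobint] with end point [r]. *)
Lemma K_fun_convex_univalent : convex_univalent (K_fun A B).
Proof.
  assert (common : forall x y, unit_disc x -> unit_disc y ->
     exists r : C, unit_disc r /\ r <> 0 /\ closed_disc (Cmod r) x /\ closed_disc (Cmod r) y).
  { intros x y Hx Hy. unfold unit_disc in *.
    set (r := Rmax (/ 2) (Rmax (Cmod x) (Cmod y))).
    assert (H1 : (/ 2 <= r)%R) by apply Rmax_l.
    assert (H2 : (r < 1)%R) by (repeat apply Rmax_case; lra).
    assert (E : Cmod r = r) by (rewrite Cmod_R; apply Rabs_right; lra).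
    exists r. unfold closed_disc. rewrite E. split; [easy|].
    split; [apply RtoC_neq_0; lra|]. unfold r. split.
    - eapply Rle_trans; [|apply Rmax_r]. apply Rmax_l.
    - eapply Rle_trans; [|apply Rmax_r]. apply Rmax_r. }
  split; [now apply analytic_on_K_fun|]. split.
  - intros x y Hx Hy E. destruct (common x y Hx Hy) as [r [Hr [Hr0 [Hxr Hyr]]]].
    assert (Hm := proj1 (Cmod_gt_0 r) Hr0).
    assert (Hdiv : forall z, closed_disc (Cmod r) z -> closed_disc 1 (z / r)).
    { intros z Hz. unfold closed_disc in *. rewrite Cmod_div by easy. apply Rle_div_l; lra. }
    assert (Hc : forall z, z / r * r = z) by (intros z; field; easy).
    rewrite <- (Hc x), <- (Hc y). f_equal.
    apply (mobint_injective _ _ r _ _ _ _ HM); auto.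
    now rewrite <- !K_fun_mobint, !Hc.
  - intros u v t [x [Hx Ex]] [y [Hy Ey]] Ht.
    destruct (common x y Hx Hy) as [r [Hr [Hr0 [Hxr Hyr]]]].
    destruct (proj2 (K_fun_image r ((1 - t) * u + t * v) Hr0)) as [z [Hz Ez]].
    + apply (mobint_closed_disc_convex _ _ r _ _ _ _ HM Hr Hr0 1); [lra| | |easy].
      * apply K_fun_image; [easy|]. now exists x.
      * apply K_fun_image; [easy|]. now exists y.
    + exists z. split; [|easy]. now apply (closed_disc_unit_disc (Cmod r)).
Qed.

Lemma rotated_F_fun (eps z : C) :
  Cmod eps = 1%R -> unit_disc z ->
  / eps * F_fun A B (eps * z) = Cint (fun w => Cexp (K_fun A B (eps * w))) z.
Proof.
  intros Heps Hz.
  assert (Heps0 : eps <> 0) by (apply Cmod_gt_0; lra).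
  assert (Hrot : forall w, unit_disc w -> unit_disc (eps * w)).
  { intros w Hw. unfold unit_disc. now rewrite Cmod_mult, Heps, Rmult_1_l. }
  assert (HK := analytic_on_Cexp _ (analytic_on_K_fun A B HB)).
  assert (HKr : analytic_on unit_disc (fun w => Cexp (K_fun A B (eps * w)))).
  { apply (analytic_on_comp (fun w => Cexp (K_fun A B w)) (fun w => eps * w)); try easy.
    apply analytic_on_scal, analytic_on_id. }
  apply (Cint_unique (fun z => / eps * F_fun A B (eps * z))
           (fun w => Cexp (K_fun A B (eps * w)))); try easy.
  - intros w Hw.
    assert (D := is_Cderive_Cint _ (eps * w) HK (Hrot w Hw)).
    assert (Dr := is_Cderive_scal eps _ _ _ (is_Cderive_id w)).
    eapply is_Cderive_eq.
    + apply is_Cderive_scal. exact (is_Cderive_comp _ (fun w => eps * w) _ _ _ D Dr).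
    + field. easy.
  - rewrite Cmult_0_r. unfold F_fun. rewrite Cint_0. ring.
Qed.

Lemma V_CV_boundary (z0 eps : C) (f : C -> C) :
  unit_disc z0 -> z0 <> 0 -> Cmod eps = 1%R -> CV A B f ->
  (log_deriv f z0 = K_fun A B (eps * z0) <->
   forall z, unit_disc z -> f z = / eps * F_fun A B (eps * z)).
Proof.
  intros Hz0 Hz00 Heps Hf.
  assert (Hrot : forall w, unit_disc w -> unit_disc (eps * w)).
  { intros w Hw. unfold unit_disc. now rewrite Cmod_mult, Heps, Rmult_1_l. }
  split.
  - intros E z Hz.
    destruct (CV_representation A B f HB Hf) as [phi [Hphi [Hle [El _]]]].
    assert (Hpe : forall w, unit_disc w -> phi w = eps).
    { apply (mobint_extremal _ _ z0 _ _ _ _ HM Hz0 Hz00 eps phi Heps Hphi Hle).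
      rewrite <- K_fun_mobint, <- E, El by easy.
      apply Cint_ext; [easy|]. intros; apply mob_pre_schwarzian. }
    rewrite rotated_F_fun by easy.
    apply (CV_eq_integral A B f (fun w => K_fun A B (eps * w))); try easy.
    intros w Hw. rewrite El, K_fun_pre_schwarzian by easy.
    apply Cint_ext; [easy|]. intros v Hv _. unfold pre_schwarzian. now rewrite Hpe.
  - intros E.
    apply (log_deriv_integral_Cexp f (fun w => K_fun A B (eps * w))); try easy.
    + apply (analytic_on_comp (K_fun A B) (fun w => eps * w)); try easy.
      * now apply analytic_on_K_fun.
      * apply analytic_on_scal, analytic_on_id.
    + rewrite Cmult_0_r. apply Cint_0.
    + intros z Hz. rewrite E by easy. now apply rotated_F_fun.
Qed.

End FirstPart.

Lemma coefficient_iff (A B lambda x : C) :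
  A <> B -> ((A - B) * x / 2 = lambda <-> x = 2 * lambda / (A - B)).
Proof.
  intros HAB. assert (H := Cminus_eq_contra _ _ HAB). split.
  - intros <-. field. easy.
  - intros ->. field. easy.
Qed.

(** The coefficient fixes [phi 0 = gamma], of modulus [1], which forces [phi] to be constant. *)
Lemma V_CV_coef_unimodular (A B z0 lambda w : C) :
  (Cmod B <= 1)%R -> A <> B -> unit_disc z0 ->
  let gamma := 2 * lambda / (A - B) in
  Cmod gamma = 1%R ->
  (V_CV_coef A B z0 lambda w <->
   w = Cint (fun zeta => / zeta * (P_fun A B (gamma * zeta) - 1)) z0).
Proof.
  intros HB HAB Hz0 gamma Hg.
  assert (E : Cint (fun zeta => / zeta * (P_fun A B (gamma * zeta) - 1)) z0
              = Cint (pre_schwarzian A B (fun _ => gamma)) z0).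
  { apply Cint_ext; [easy|]. intros z Hz Hz00.
    assert (Hd := pre_schwarzian_denom B z gamma HB Hz (Req_le _ _ Hg)).
    unfold P_fun, pre_schwarzian.
    replace (B * (gamma * z)) with (B * z * gamma) by ring. field. easy. }
  rewrite E. split.
  - intros [f [Hf [Ha <-]]].
    destruct (CV_representation A B f HB Hf) as [phi [Hphi [Hle [El Ea]]]].
    rewrite El by easy. rewrite Ea in Ha. apply coefficient_iff in Ha; [|easy].
    fold gamma in Ha.
    apply Cint_ext; [easy|]. intros z Hz _. unfold pre_schwarzian.
    rewrite (unimodular_center phi Hphi Hle) by (easy || now rewrite Ha). now rewrite Ha.
  - intros ->.
    destruct (CV_construction A B (fun _ => gamma) HB (analytic_on_const _ gamma)
      (fun _ _ => Req_le _ _ Hg)) as [f [Hf [Ha El]]].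
    exists f. split; [easy|]. split; [|now apply El].
    rewrite Ha. now apply coefficient_iff.
Qed.

(** * The region of variability with fixed second coefficient *)

(** The numerator times the conjugate denominator has real part [1 - |b y|^2 + Re T], where
    [|T| <= |g| (|b| + |y|) (1 - |b| |y|)]. This is less than [(1 + |b| |y|) (1 - |b| |y|)], because
    [(1 - |b|) (1 - |y|) > 0]. *)
Lemma Q_denom_halfplane (g b y : C) :
  (Cmod g < 1)%R -> (Cmod b < 1)%R -> (Cmod y < 1)%R ->
  1 + b * g + (Cconj g + b) * y <> 0 ->
  (0 < Re ((1 - b * y) / (1 + b * g + (Cconj g + b) * y)))%R.
Proof.
  intros Hg Hb Hy Hn. rewrite Re_div by easy.
  apply Cmod_gt_0 in Hn. apply Rdiv_lt_0_compat; [|now apply Rmult_lt_0_compat].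
  set (T := g * (b * (1 - Cmod y * Cmod y)%R + Cconj y * (1 - Cmod b * Cmod b)%R)).
  match goal with |- (0 < ?n)%R =>
    assert (E : n = (1 - (Cmod b * Cmod b) * (Cmod y * Cmod y) + Re T)%R) end.
  { unfold T. rewrite !Cmod_sqr. destruct g, b, y. simpl. ring. }
  rewrite E. clear E.
  assert (HT : (- Re T <= Cmod g * (Cmod b * (1 - Cmod y * Cmod y) + Cmod y * (1 - Cmod b * Cmod b)))%R).
  { rewrite <- re_opp. eapply Rle_trans; [apply Re_le_Cmod|].
    rewrite Cmod_opp. unfold T. rewrite Cmod_mult.
    apply Rmult_le_compat_l; [apply Cmod_ge_0|].
    eapply Rle_trans; [apply Cmod_triangle|].
    assert (P1 := Cmod_ge_0 b). assert (P2 := Cmod_ge_0 y).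
    rewrite !Cmod_mult, !Cmod_R, Cmod_conj, !Rabs_right by nra. lra. }
  assert (P1 := Cmod_ge_0 b). assert (P2 := Cmod_ge_0 y).
  assert (F1 : (Cmod b * (1 - Cmod y * Cmod y) + Cmod y * (1 - Cmod b * Cmod b)
              = (Cmod b + Cmod y) * (1 - Cmod b * Cmod y))%R) by ring.
  rewrite F1 in HT.
  assert (F2 : (1 - (Cmod b * Cmod b) * (Cmod y * Cmod y)
              = (1 + Cmod b * Cmod y) * (1 - Cmod b * Cmod y))%R) by ring.
  rewrite F2.
  assert (H1 : (0 < 1 - Cmod b * Cmod y)%R) by nra.
  assert (H2 : (Cmod g * (Cmod b + Cmod y) < 1 + Cmod b * Cmod y)%R).
  { apply Rle_lt_trans with (1 * (Cmod b + Cmod y))%R; [apply Rmult_le_compat_r; lra|].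
    assert (0 < (1 - Cmod b) * (1 - Cmod y))%R by (apply Rmult_lt_0_compat; lra). lra. }
  assert (H3 : (Cmod g * (Cmod b + Cmod y) * (1 - Cmod b * Cmod y)
              < (1 + Cmod b * Cmod y) * (1 - Cmod b * Cmod y))%R)
    by (apply Rmult_lt_compat_r; easy).
  lra.
Qed.

Lemma Cmod_mult_lt_1 (B z : C) : (Cmod B <= 1)%R -> unit_disc z -> (Cmod (B * z) < 1)%R.
Proof.
  intros HB Hz. rewrite Cmod_mult, Rmult_comm. now apply unit_disc_mult_lt.
Qed.

Section SecondPart.

Variables (A B gamma : C).
Hypothesis HB : (Cmod B <= 1)%R.
Hypothesis HAB : A <> B.
Hypothesis Hgamma : (Cmod gamma < 1)%R.

(** Clearing the denominator of [s = sigma gamma (x z)] in [(A - B) s / (1 + B z s)] gives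
    [(qa + qb x) / (qc + z qe x)]. *)
Let qa (z : C) : C := (A - B) * gamma.
Let qb (z : C) : C := (A - B) * z.
Let qc (z : C) : C := 1 + B * gamma * z.
Let qe (z : C) : C := Cconj gamma + B * z.

Let qc_neq_0 (z : C) : unit_disc z -> qc z <> 0.
Proof.
  intros Hz. unfold qc. replace (B * gamma * z) with (B * z * gamma) by ring.
  apply pre_schwarzian_denom; try easy. lra.
Qed.

(** The quotient [qe / qc] is [sigma (Cconj gamma) (B z)]. *)
Let qe_le_qc (z : C) : unit_disc z -> (Cmod (qe z) <= Cmod (qc z))%R.
Proof.
  intros Hz. assert (Hn := qc_neq_0 z Hz).
  assert (Hb := Cmod_mult_lt_1 B z HB Hz).
  assert (H := sigma_le_1 (Cconj gamma) (B * z)). rewrite Cmod_conj in H.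
  specialize (H Hgamma (Rlt_le _ _ Hb)). unfold sigma in H.
  rewrite Cconj_conj in H.
  replace (B * z + Cconj gamma) with (qe z) in H by (unfold qe; ring).
  replace (1 + gamma * (B * z)) with (qc z) in H by (unfold qc; ring).
  rewrite Cmod_div in H by easy. apply Cmod_gt_0 in Hn.
  apply Rle_div_l in H; [|easy]. lra.
Qed.

(** The determinant has the single factor [z] of [qb], whence [k = 1]. The starlikeness quantity is
    twice that of [Q_denom_halfplane] for [b = B z] and [y = x z]. *)
Lemma mobius_family_Q :
  mobius_family 1 ((A - B) * (1 - Cconj gamma * gamma)) qa qb qc qe.
Proof.
  assert (Ha : analytic_on unit_disc qa) by apply analytic_on_const.
  assert (Hb : analytic_on unit_disc qb) by (apply analytic_on_scal, analytic_on_id).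
  assert (Hc : analytic_on unit_disc qc)
    by (apply analytic_on_plus; [apply analytic_on_const|apply analytic_on_scal, analytic_on_id]).
  assert (He : analytic_on unit_disc qe)
    by (apply analytic_on_plus; [apply analytic_on_const|apply analytic_on_scal, analytic_on_id]).
  split; try easy.
  - apply Cmult_neq_0; [now apply Cminus_eq_contra|now apply one_minus_sqr_neq_0].
  - intros z Hz. unfold qa, qb, qc, qe. simpl. ring.
  - intros x z Hx Hz.
    assert (Hden : mob_den qc qe x z <> 0).
    { apply mob_den_neq_0; auto. now apply unit_disc_mult_lt. }
    assert (D : C_derive (mob_den qc qe x) z = B * gamma + Cconj gamma * x + B * x * (2 * z)).
    { apply is_C_derive_unique.
      apply (is_Cderive_ext_loc
        (fun z => (1 + (B * gamma + Cconj gamma * x) * z) + B * x * (z * z)) _ _ _ 1); [lra| |].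
      - intros w _. unfold mob_den, qc, qe. ring.
      - apply is_Cderive_plus; [apply is_Cderive_affine|].
        apply is_Cderive_scal, is_Cderive_sqr. }
    assert (Hn : 1 + B * z * gamma + (Cconj gamma + B * z) * (x * z) <> 0).
    { intros E. apply Hden. rewrite <- E. unfold mob_den, qc, qe. ring. }
    assert (Hxz : (Cmod (x * z) < 1)%R).
    { rewrite Cmod_mult, Rmult_comm. now apply unit_disc_mult_lt. }
    assert (Hpos := Q_denom_halfplane gamma (B * z) (x * z) Hgamma
      (Cmod_mult_lt_1 B z HB Hz) Hxz Hn).
    replace (INR 2 - 2 * (z * C_derive (mob_den qc qe x) z / mob_den qc qe x z))
      with (2 * ((1 - B * z * (x * z)) / (1 + B * z * gamma + (Cconj gamma + B * z) * (x * z)))).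
    + rewrite re_scal_l. lra.
    + rewrite D.
      replace (mob_den qc qe x z) with (1 + B * z * gamma + (Cconj gamma + B * z) * (x * z))
        by (unfold mob_den, qc, qe; ring).
      replace (INR 2) with 2%R by (simpl; ring). field. easy.
Qed.

Let Qint (z0 : C) : C -> C := mobint z0 qa qb qc qe.

Lemma mob_sigma (x z : C) :
  unit_disc z -> (Cmod (x * z) < 1)%R ->
  mob qa qb qc qe x z =
  (A - B) * sigma gamma (x * z) / (1 + B * z * sigma gamma (x * z)).
Proof.
  intros Hz Hxz.
  assert (H1 := sigma_denom gamma (x * z) Hgamma (Rlt_le _ _ Hxz)).
  assert (H2 := pre_schwarzian_denom B z _ HB Hz
    (sigma_le_1 gamma (x * z) Hgamma (Rlt_le _ _ Hxz))).
  unfold mob. 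
  assert (E : mob_den qc qe x z
     = (1 + Cconj gamma * (x * z)) * (1 + B * z * sigma gamma (x * z))).
  { unfold mob_den, qc, qe, sigma. field. easy. }
  rewrite E. unfold qa, qb.
  replace ((A - B) * gamma + (A - B) * z * x)
    with ((1 + Cconj gamma * (x * z)) * ((A - B) * sigma gamma (x * z)))
    by (unfold sigma; field; easy).
  field. easy.
Qed.

Lemma Q_fun_mobint (z0 x : C) :
  unit_disc z0 -> (Cmod z0 * Cmod x < 1)%R -> Q_fun A B gamma z0 x = Qint z0 x.
Proof.
  intros Hz0 Hx. apply CInt_ext; [lra|]. intros t Ht. f_equal. symmetry.
  apply mob_sigma; [apply unit_disc_scale; [easy|lra]|].
  rewrite !Cmod_mult, Cmod_R, Rabs_right by lra.
  assert (P1 := Cmod_ge_0 z0). assert (P2 := Cmod_ge_0 x).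
  replace (Cmod x * (t * Cmod z0))%R with (t * (Cmod z0 * Cmod x))%R by ring. nra.
Qed.

Lemma Q_fun_pre_schwarzian (z x : C) :
  Q_fun A B gamma z x = Cint (pre_schwarzian A B (fun w => sigma gamma (x * w))) z.
Proof. reflexivity. Qed.

Lemma analytic_on_sigma_ray (x : C) :
  (Cmod x <= 1)%R -> analytic_on unit_disc (fun w => sigma gamma (x * w)) /\
  (forall w, unit_disc w -> (Cmod (sigma gamma (x * w)) <= 1)%R).
Proof.
  intros Hx.
  assert (Hxw : forall w, unit_disc w -> unit_disc (x * w)).
  { intros w Hw. unfold unit_disc. rewrite Cmod_mult, Rmult_comm. now apply unit_disc_mult_lt. }
  split.
  - apply (analytic_on_comp (sigma gamma) (fun w => x * w)); [now apply analytic_on_sigma| |easy].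
    apply analytic_on_scal, analytic_on_id.
  - intros w Hw. apply sigma_le_1; [easy|]. now apply Rlt_le, Hxw.
Qed.

Lemma analytic_on_Q_fun (x : C) :
  (Cmod x <= 1)%R -> analytic_on unit_disc (fun z => Q_fun A B gamma z x).
Proof.
  intros Hx. destruct (analytic_on_sigma_ray x Hx) as [H1 H2].
  apply (analytic_on_Cint (pre_schwarzian A B (fun w => sigma gamma (x * w)))).
  now apply analytic_on_pre_schwarzian.
Qed.

(** [sigma (- gamma)] sends [gamma] to [0], so Schwarz's lemma applies to its composition with
    [phi]; [sigma gamma] undoes it. *)
Lemma sigma_factorization (phi : C -> C) :
  analytic_on unit_disc phi -> (forall z, unit_disc z -> (Cmod (phi z) <= 1)%R) ->
  phi 0 = gamma ->
  exists chi : C -> C, analytic_on unit_disc chi /\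
    (forall z, unit_disc z -> (Cmod (chi z) <= 1)%R) /\
    (forall z, unit_disc z -> phi z = sigma gamma (chi z * z)).
Proof.
  intros Hphi Hle H0.
  assert (Hg' : (Cmod (- gamma) < 1)%R) by now rewrite Cmod_opp.
  destruct (schwarz (fun z => sigma (- gamma) (phi z))) as [chi [Hchi [E Hc]]].
  - apply analytic_on_div.
    + apply analytic_on_plus; [easy|apply analytic_on_const].
    + apply analytic_on_plus; [apply analytic_on_const|now apply analytic_on_scal].
    + intros z Hz. apply sigma_denom; auto.
  - intros z Hz. apply sigma_le_1; auto.
  - rewrite H0. unfold sigma. replace (gamma + - gamma) with (RtoC 0) by ring.
    unfold Cdiv. ring.
  - exists chi. split; [easy|]. split; [easy|]. intros z Hz.
    rewrite Cmult_comm, <- E, sigma_sigma_opp; auto.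
Qed.

Lemma Cint_pre_schwarzian_mob (phi chi : C -> C) (z0 : C) :
  (forall z, unit_disc z -> (Cmod (chi z) <= 1)%R) ->
  (forall z, unit_disc z -> phi z = sigma gamma (chi z * z)) -> unit_disc z0 ->
  Cint (pre_schwarzian A B phi) z0 = Cint (fun z => mob qa qb qc qe (chi z) z) z0.
Proof.
  intros Hle E Hz0. apply Cint_ext; [easy|]. intros z Hz _.
  rewrite mob_sigma; [|easy|].
  - unfold pre_schwarzian. now rewrite E.
  - rewrite Cmod_mult, Rmult_comm. now apply unit_disc_mult_lt; [|apply Hle].
Qed.

Lemma closed_disc_lt (z0 x : C) : unit_disc z0 -> closed_disc 1 x -> (Cmod z0 * Cmod x < 1)%R.
Proof. apply unit_disc_mult_lt. Qed.

Lemma V_CV_coef_Q_fun (z0 lambda w : C) :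
  unit_disc z0 -> z0 <> 0 -> gamma = 2 * lambda / (A - B) ->
  (V_CV_coef A B z0 lambda w <-> image (closed_disc 1) (Q_fun A B gamma z0) w).
Proof.
  intros Hz0 Hz00 Eg. split.
  - intros [f [Hf [Ha <-]]].
    destruct (CV_representation A B f HB Hf) as [phi [Hphi [Hle [El Ea]]]].
    rewrite Ea in Ha. apply coefficient_iff in Ha; [|easy]. rewrite <- Eg in Ha.
    destruct (sigma_factorization phi Hphi Hle Ha) as [chi [Hchi [Hc E]]].
    rewrite El, (Cint_pre_schwarzian_mob phi chi) by easy.
    apply (image_ext _ (Qint z0)).
    + intros x Hx. symmetry. apply Q_fun_mobint; [easy|now apply closed_disc_lt].
    + now apply (mobint_range _ _ _ _ _ _ _ mobius_family_Q).
  - intros [x [Hx <-]]. destruct (analytic_on_sigma_ray x Hx) as [H1 H2].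
    destruct (CV_construction A B (fun w => sigma gamma (x * w)) HB H1 H2) as [f [Hf [Ha El]]].
    exists f. split; [easy|]. split.
    + rewrite Ha. apply coefficient_iff; [easy|]. rewrite <- Eg. unfold sigma.
      rewrite !Cmult_0_r, Cplus_0_r, Cplus_0_l. field.
    + now apply El.
Qed.

Lemma Q_fun_convex_univalent_closed (z0 : C) :
  unit_disc z0 -> z0 <> 0 -> convex_univalent_closed (Q_fun A B gamma z0).
Proof.
  intros Hz0 Hz00. assert (Hm := proj1 (Cmod_gt_0 z0) Hz00).
  assert (HQ : forall x, closed_disc 1 x -> Q_fun A B gamma z0 x = Qint z0 x).
  { intros x Hx. apply Q_fun_mobint; [easy|now apply closed_disc_lt]. }
  assert (Himg : forall w, image unit_disc (Qint z0) w <-> image unit_disc (Q_fun A B gamma z0) w).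
  { intros w. split; apply image_ext; intros x Hx; [symmetry|]; apply HQ; now left. }
  split; [|split; [|split]].
  (* The disc of radius [1 / |z0| > 1], in which no Moebius map along the segment to [z0] has a
     pole. *)
  - exists (fun x => Cmod z0 * Cmod x < 1)%R. split; [|split].
    + apply open_iff. intros x Hx.
      exists ((1 - Cmod z0 * Cmod x) / Cmod z0)%R. split; [apply Rdiv_lt_0_compat; lra|].
      intros y Hy. assert (T := Cmod_triangle x (y - x)). rewrite Cplus_minus in T.
      apply (Rmult_lt_compat_l (Cmod z0)) in Hy; [|easy].
      replace (Cmod z0 * ((1 - Cmod z0 * Cmod x) / Cmod z0))%R
        with (1 - Cmod z0 * Cmod x)%R in Hy by (field; lra).
      apply (Rmult_le_compat_l (Cmod z0)) in T; lra.
    + intros x Hx. now apply closed_disc_lt.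
    + intros x Hx. eexists.
      apply (is_Cderive_ext_lt (Qint z0) _ _ _ (/ Cmod z0)).
      * intros y Hy. symmetry. apply Q_fun_mobint; [easy|].
        apply (Rmult_lt_compat_l (Cmod z0)) in Hy; [|easy]. rewrite Rinv_r in Hy; lra.
      * apply (Rmult_lt_reg_l (Cmod z0)); [easy|]. rewrite Rinv_r; lra.
      * now apply (is_Cderive_mobint _ _ _ _ _ _ _ mobius_family_Q).
  - intros x y Hx Hy E. rewrite !HQ in E by easy.
    now apply (mobint_injective _ _ z0 _ _ _ _ mobius_family_Q).
  - destruct (mobint_domain _ _ z0 _ _ _ _ mobius_family_Q Hz0 Hz00) as [[w Hw] [Ho Hc]].
    split; [|split].
    + exists w. now apply Himg.
    + apply open_iff. intros z Hz. apply Himg in Hz.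
      destruct (proj1 (open_iff _) Ho z Hz) as [d [Hd H]].
      exists d. split; [easy|]. intros v Hv. apply Himg. now apply H.
    + apply convex_connected, (convex_set_iff _ _ Himg).
      now apply (mobint_disc_convex _ _ _ _ _ _ _ mobius_family_Q).
  - apply (convex_set_iff _ _ Himg).
    now apply (mobint_disc_convex _ _ _ _ _ _ _ mobius_family_Q).
Qed.

Lemma V_CV_coef_boundary (z0 lambda eps : C) (f : C -> C) :
  unit_disc z0 -> z0 <> 0 -> gamma = 2 * lambda / (A - B) ->
  Cmod eps = 1%R -> CV A B f -> a2 f = lambda ->
  (log_deriv f z0 = Q_fun A B gamma z0 eps <->
   forall z, unit_disc z -> f z = Cint (fun zeta => Cexp (Q_fun A B gamma zeta eps)) z).
Proof.
  intros Hz0 Hz00 Eg Heps Hf Ha. assert (Hle1 := Req_le _ _ Heps). split.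
  - intros E z Hz.
    destruct (CV_representation A B f HB Hf) as [phi [Hphi [Hle [El Ea]]]].
    rewrite Ea in Ha. apply coefficient_iff in Ha; [|easy]. rewrite <- Eg in Ha.
    destruct (sigma_factorization phi Hphi Hle Ha) as [chi [Hchi [Hc Ephi]]].
    assert (Hce : forall w, unit_disc w -> chi w = eps).
    { apply (mobint_extremal _ _ z0 _ _ _ _ mobius_family_Q Hz0 Hz00 eps chi Heps Hchi Hc).
      rewrite <- (Cint_pre_schwarzian_mob phi chi), <- El, E by easy.
      apply Q_fun_mobint; [easy|now apply closed_disc_lt]. }
    apply (CV_eq_integral A B f (fun w => Q_fun A B gamma w eps)); try easy.
    intros w Hw. rewrite El by easy. rewrite Q_fun_pre_schwarzian.
    apply Cint_ext; [easy|]. intros v Hv _. unfold pre_schwarzian.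
    now rewrite Ephi, Hce.
  - intros E. apply (log_deriv_integral_Cexp f (fun w => Q_fun A B gamma w eps)); try easy.
    + now apply analytic_on_Q_fun.
    + apply Cint_0.
Qed.

End SecondPart.

Theorem corollary2p2 (A B z0 lambda : C)
  (hB : (Cmod B <= 1)%R) (hAB : A <> B)
  (hz0 : unit_disc z0) (hz0_neq0 : z0 <> 0)
  (hlambda : (Cmod lambda <= Cmod (A - B) / 2)%R) :
  let gamma1 := 2 * lambda / (A - B) in
  (* (i) *)
  (convex_set (V_CV A B z0) /\ closed_jordan_domain (V_CV A B z0) /\
   (forall w : C,
      V_CV A B z0 w <-> image (closed_disc (Cmod z0)) (K_fun A B) w) /\
   convex_univalent (K_fun A B) /\
   (forall (eps : C) (f : C -> C), Cmod eps = 1%R -> CV A B f ->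
      (log_deriv f z0 = K_fun A B (eps * z0) <->
       forall z : C, unit_disc z -> f z = / eps * F_fun A B (eps * z))))
  /\
  (* (ii) *)
  (Cmod gamma1 = 1%R ->
   forall w : C,
     V_CV_coef A B z0 lambda w <->
     w = Cint (fun zeta => / zeta * (P_fun A B (gamma1 * zeta) - 1)) z0)
  /\
  (* (iii) *)
  ((Cmod gamma1 < 1)%R ->
   (forall w : C,
      V_CV_coef A B z0 lambda w <->
      image (closed_disc 1) (Q_fun A B gamma1 z0) w) /\
   convex_univalent_closed (Q_fun A B gamma1 z0) /\
   (forall (eps : C) (f : C -> C),
      Cmod eps = 1%R -> CV A B f -> a2 f = lambda ->
      (log_deriv f z0 = Q_fun A B gamma1 z0 eps <->
       forall z : C, unit_disc z ->
         f z = Cint (fun zeta => Cexp (Q_fun A B gamma1 zeta eps)) z))).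
Proof.
  intros gamma1. split; [|split].
  - split; [now apply V_CV_convex|]. split; [now apply V_CV_closed_jordan_domain|].
    split; [intros w; now apply V_CV_K_fun|]. split; [now apply K_fun_convex_univalent|].
    intros eps f Heps Hf. now apply V_CV_boundary.
  - intros Hg w. now apply V_CV_coef_unimodular.
  - intros Hg. split; [intros w; now apply V_CV_coef_Q_fun|].
    split; [now apply Q_fun_convex_univalent_closed|].
    intros eps f Heps Hf Ha. now apply (V_CV_coef_boundary A B gamma1 hB hAB Hg z0 lambda).
Qed.
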